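(* Let $\Gamma\in\mathcal U_\infty$. Let the random infinite graph $G(\infty,\Gamma)$ have connected components $G_j$, $j=1,\dots,N$ (with $1\le N\le\infty$), listed in increasing order of the smallest element, and let $V_j=V(G_j)\subseteq\mathbb N$ be the vertex set of $G_j$. Then, almost surely, the following hold for every component $G_j$. (i) $G_j$ is either infinite or an isolated vertex, i.e., $|V_j|=v(G_j)\in\{1,\infty\}$. (ii) If $G_j$ is infinite, then $G_j|_{V_j\cap[n]}\to\Gamma_j'$ as $n\to\infty$ for some (random) $\Gamma_j'\in\mathcal U_\infty$. (iii) The asymptotic density $\nu_j=\lim_{n\to\infty}|V_j\cap[n]|/n$ exists; furthermore, if $|V_j|=\infty$, then $\nu_j>0$ (and trivially conversely). (iv) Consider the (random, and finite or infinite) sequence $\{(\Gamma_j',\nu_j)\}_{j=1}^N$ defined by (ii) and (iii). Let $\Gamma$ have the decomposition $\Gamma=\bigoplus_{i=1}^M\alpha_i\Gamma_i$ into components, where $0\le M\le\infty$, every $\Gamma_i\in\mathcal U_\infty$ is connected, every $\alpha_i>0$ and $\sum_{i=1}^M\alpha_i\le1$. Then the subsequence $\{(\Gamma_j',\nu_j):\nu_j>0\}$ equals a permutation of $\{(\Gamma_i,\alpha_i)\}_{i=1}^M$. (v) The set $V_0=\bigcup_{|V_j|=1}V_j$ of all isolated vertices in $G(\infty,\Gamma)$ has almost surely a density $\nu_0=\lim_{n\to\infty}|V_0\cap[n]|/n$, and $\nu_0=\alpha_0:=1-\sum_{i=1}^M\alpha_i$ with $\alpha_i$ as in (iv). Furthermore,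 $V_0=\emptyset\iff\alpha_0=0\iff\sum_{i=1}^M\alpha_i=1$, i.e., the direct sum $\bigoplus_{i=1}^M\alpha_i\Gamma_i$ is complete.
   Context: Graphs are finite, simple, undirected, with at least one vertex, unless explicitly infinite (induced subgraphs with empty vertex set, which occur only for small $n$ in (ii), are to be ignored); $v(G)=|V(G)|$, $e(G)=|E(G)|$. $[n]=\{1,\dots,n\}$. $G|_V$ denotes the subgraph of $G$ induced by $V\subseteq V(G)$. Graph limits. For graphs $F,G$, $t(F,G)$ is the probability that a uniformly random map $V(F)\to V(G)$ is a graph homomorphism (maps edges to edges). The set $\mathcal U$ of unlabelled graphs (isomorphism classes) is embedded as a dense subset of a compact metric space $\overline{\mathcal U}$; the elements of $\mathcal U_\infty=\overline{\mathcal U}\setminus\mathcal U$ are called graph limits, and $v(\Gamma)=\infty$ for $\Gamma\in\mathcal U_\infty$. Each $t(F,\cdot)$ extends continuously to $\overline{\mathcal U}$; a graph limit $\Gamma$ is determined by the numbers $t(F,\Gamma)$, $F$ ranging over all graphs; and a sequence $G_n$ in $\overline{\mathcal U}$ converges to $\Gamma\in\mathcal U_\infty$ iff $v(G_n)\to\infty$ and $t(F,G_n)\to t(F,\Gamma)$ for every graph $F$. (Concretely, graph limits can be identified with the families $(t_F)_F$ arising as $t_F=\lim_n t(F,G_n)$ for sequences of graphs with $v(G_n)\to\infty$ for which all these limits exist.) Direct sums and connectedness. For $0\le m\le\infty$, graph limits $(\Gamma_i)_{i=1}^m$ and weights $\alpha_i\ge0$ with $\sum_{i=1}^m\alpha_i\le1$,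 $\bigoplus_{i=1}^m\alpha_i\Gamma_i$ is the unique graph limit $\Gamma$ with $t(F,\Gamma)=\sum_{i=1}^m\alpha_i^{v(F)}t(F,\Gamma_i)$ for every connected graph $F$ with at least one edge (for $m=0$ it is the trivial graph limit $\mathbf 0$, with $t(F,\mathbf 0)=0$ if $e(F)\ge1$ and $1$ if $e(F)=0$); for $m=2$ and weights $\alpha,1-\alpha$ it is written $\alpha\Gamma_1\oplus(1-\alpha)\Gamma_2$. The direct sum is complete if $\sum_i\alpha_i=1$. A graph limit $\Gamma$ is disconnected if there exist $\Gamma_1,\Gamma_2\in\mathcal U_\infty$ and $\alpha\in(0,1)$ with $\Gamma=\alpha\Gamma_1\oplus(1-\alpha)\Gamma_2$; otherwise it is connected. Every graph limit has a decomposition into components of the form stated in (iv), unique up to simultaneous permutation of the $\Gamma_i$ and $\alpha_i$. Random graphs. A kernel on a probability space $(\mathcal S,\mu)$ is a symmetric measurable $W:\mathcal S\times\mathcal S\to[0,1]$; it represents the unique graph limit $\Gamma_W$ with $t(F,\Gamma_W)=\int_{\mathcal S^{v(F)}}\prod_{ij\in E(F)}W(x_i,x_j)\,d\mu(x_1)\cdots d\mu(x_{v(F)})$ for every graph $F$. Every graph limit is represented by some kernel. $G(\infty,\Gamma)$ is the infinite random graph with vertex set $\mathbb N=\{1,2,\dots\}$ obtained, for any kernel $W$ representing $\Gamma$, by taking i.i.d. $X_1,X_2,\dots$ with distribution $\mu$ and, conditionally given these, including each edge $ij$ ($i<j$) independently with probability $W(X_i,X_j)$. Its distribution depends only on $\Gamma$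 and is characterized by $\mathbb P(G(\infty,\Gamma)\supseteq F)=t(F,\Gamma)$ for every graph $F$ with $V(F)=[k]$, $k\ge1$. *)

(* Defs.v *)
From HB Require Import structures.
From mathcomp Require Import all_boot all_order all_algebra.
From mathcomp Require Import all_classical all_reals all_analysis.

Set Implicit Arguments.
Unset Strict Implicit.
Unset Printing Implicit Defensive.

Import Order.TTheory GRing.Theory Num.Theory.
Import numFieldNormedType.Exports.

Local Open Scope classical_set_scope.
Local Open Scope ring_scope.

(* Finite simple graphs. The vertex set of an [sgraph] may be empty, which is
   needed only for the first few terms of a sequence of induced subgraphs; a
   [graph] has at least one vertex. *)
Record sgraph := SGraph {
  vertex :> finType;
  adj : rel vertex;
  adj_sym : symmetric adj;
  adj_irr : irreflexive adj }.

Record graph := Graph {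
  graph_sgraph :> sgraph;
  graph_gt0 : (0 < #|graph_sgraph|)%N }.

Definition connected_graph (F : graph) : Prop :=
  forall x y : F, connect (@adj F) x y.

Definition has_edge (F : graph) : Prop := exists x y : F, adj x y.

Definition is_hom (F G : sgraph) (f : {ffun F -> G}) : bool :=
  [forall x, forall y, adj x y ==> adj (f x) (f y)].

Definition hom_density (R : realType) (F G : sgraph) : R :=
  #|[set f : {ffun F -> G} | is_hom f]%SET|%:R / #|{ffun F -> G}|%:R.

(* A graph limit is identified with the family (t(F, Gamma))_F. *)
Record graph_limit (R : realType) := GraphLimit {
  t_lim :> graph -> R;
  t_limP : exists G : nat -> graph,
    ((fun n => #|G n|) @ \oo --> \oo) /\
    forall F : graph, hom_density R F (G n) @[n --> \oo] --> t_lim F }.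

Definition graph_cvg (R : realType) (G : nat -> sgraph) (Gamma : graph_limit R)
    : Prop :=
  ((fun n => #|G n|) @ \oo --> \oo) /\
  forall F : graph, hom_density R F (G n) @[n --> \oo] --> Gamma F.

(* Lengths of finite or infinite sequences live in [option nat], [None] being
   infinity; sequences are indexed from 0. *)
Definition below (m : option nat) (i : nat) : bool :=
  if m is Some k then (i < k)%N else true.

Definition weight_sum (R : realType) (m : option nat) (alpha : nat -> R)
    : \bar R :=
  \esum_(i in [set i | below m i]) (alpha i)%:E.

Definition is_direct_sum (R : realType) (m : option nat) (alpha : nat -> R)
    (Gammas : nat -> graph_limit R) (Gamma : graph_limit R) : Prop :=
  [/\ forall i, below m i -> 0 <= alpha i,
      (weight_sum m alpha <= 1)%E &
      forall F : graph, connected_graph F -> has_edge F ->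
        (Gamma F)%:E =
        \esum_(i in [set i | below m i]) (alpha i ^+ #|F| * Gammas i F)%:E].

Definition disconnected_limit (R : realType) (Gamma : graph_limit R) : Prop :=
  exists (alpha : nat -> R) (Gammas : nat -> graph_limit R),
    [/\ 0 < alpha 0%N < 1, alpha 1%N = 1 - alpha 0%N &
        is_direct_sum (Some 2) alpha Gammas Gamma].

Definition is_decomposition (R : realType) (Gamma : graph_limit R)
    (M : option nat) (alpha : nat -> R) (Gammas : nat -> graph_limit R)
    : Prop :=
  [/\ forall i, below M i -> ~ disconnected_limit (Gammas i),
      forall i, below M i -> 0 < alpha i &
      is_direct_sum M alpha Gammas Gamma].

Section power.
Context (R : realType) (d : measure_display) (S : measurableType d).

Definition tuple_cons n (x : S * n.-tuple S) : n.+1.-tuple S :=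
  [tuple of x.1 :: x.2].

Lemma measurable_tuple_cons n : measurable_fun setT (@tuple_cons n).
Proof. exact: measurable_cons. Qed.

HB.instance Definition _ n :=
  isMeasurableFun.Build _ _ _ _ (@tuple_cons n) (@measurable_tuple_cons n).

(* The product measure mu^n on S^n. *)
Fixpoint power_prob (mu : probability S R) n : probability (n.-tuple S) R :=
  if n is n'.+1 then
    distribution (mu \x power_prob mu n')%E (@tuple_cons n')
  else \d_ [tuple].

End power.

Definition is_kernel (R : realType) (d : measure_display)
    (S : measurableType d) (W : S * S -> R) : Prop :=
  [/\ measurable_fun setT W,
      forall x y, W (x, y) = W (y, x) &
      forall p, 0 <= W p <= 1].

(* Each edge of F enters the product once, oriented by the enumeration of the
   vertices, which also indexes the coordinates of S^v(F). *)
Definition represents (R : realType) (d : measure_display)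
    (S : measurableType d) (mu : probability S R) (W : S * S -> R)
    (Gamma : graph_limit R) : Prop :=
  forall F : graph,
    (Gamma F)%:E =
    (\int[power_prob mu #|F|]_x
      (\prod_(p : F * F | adj p.1 p.2 && (enum_rank p.1 < enum_rank p.2)%N)
         W (tnth x (enum_rank p.1), tnth x (enum_rank p.2)))%:E)%E.

(* Infinite graphs; the vertices 1, 2, ... are numbered 0, 1, ... here, so that
   [n] is {0, ..., n - 1}. *)
Record igraph := IGraph {
  iadj : rel nat;
  iadj_sym : symmetric iadj;
  iadj_irr : irreflexive iadj }.

Section induced_sgraph.
Context (g : igraph) (V : set nat) (n : nat).

Definition induced_vertex : finType := {i : 'I_n | (i : nat) \in V}.

Definition induced_adj : rel induced_vertex :=
  fun x y => iadj g (val x) (val y).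

Lemma induced_adj_sym : symmetric induced_adj.
Proof. by move=> x y; exact: iadj_sym. Qed.

Lemma induced_adj_irr : irreflexive induced_adj.
Proof. by move=> x; exact: iadj_irr. Qed.

(* g|_(V \cap [n]) *)
Definition induced_sgraph : sgraph := SGraph induced_adj_sym induced_adj_irr.

End induced_sgraph.

Definition component_of (g : igraph) (x : nat) : set nat :=
  [set y | exists p : seq nat, path (iadj g) x p /\ last x p = y].

Definition is_component (g : igraph) (C : set nat) : Prop :=
  exists x, C = component_of g x.

Definition smallest_elt (A : set nat) (x : nat) : Prop :=
  A x /\ forall y, A y -> (x <= y)%N.

Definition lists_components (g : igraph) (N : option nat) (V : nat -> set nat)
    : Prop :=
  [/\ forall j, below N j -> is_component g (V j),
      forall C, is_component g C -> exists2 j, below N j & V j = C &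
      forall i j x y, (i < j)%N -> below N j ->
        smallest_elt (V i) x -> smallest_elt (V j) y -> (x < y)%N].

Definition singleton_set (A : set nat) : Prop := exists x, A = [set x].

Definition has_density (R : realType) (A : set nat) (nu : R) : Prop :=
  (#|[set i : 'I_n | (i : nat) \in A]%SET|%:R / n%:R : R) @[n --> \oo] --> nu.

Section random_graph.
Context (R : realType) (d : measure_display) (S : measurableType d)
  (d' : measure_display) (Omega : measurableType d') (P : probability Omega R).

Definition iid (mu : probability S R) (X : nat -> {RV P >-> S}) : Prop :=
  (forall i (B : set S), measurable B -> distribution P (X i) B = mu B) /\
  forall (s : seq nat) (B : nat -> set S), uniq s ->
    (forall i, measurable (B i)) ->
    P [set w | forall i, i \in s -> B i (X i w)] =
    (\prod_(i <- s) P (X i @^-1` B i))%E.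

Definition sigma_of (X : nat -> {RV P >-> S}) : set (set Omega) :=
  <<s \bigcup_i preimage_set_system setT (X i) measurable >>.

(* p is a version of the conditional probability of A given the sub-sigma-field
   F. *)
Definition is_cond_prob (F : set (set Omega)) (A : set Omega)
    (p : Omega -> R) : Prop :=
  (forall B : set R, measurable B -> F (p @^-1` B)) /\
  forall H, F H -> P (H `&` A) = (\int[P]_(w in H) (p w)%:E)%E.

(* G is distributed as G(oo, Gamma_W). Conditional independence of the edges is
   the product rule for the conditional probability that all edges of a finite
   set E of pairs i < j are present. *)
Definition is_G_infty (mu : probability S R) (W : S * S -> R)
    (G : Omega -> igraph) : Prop :=
  (forall i j, measurable [set w | iadj (G w) i j]) /\
  exists X : nat -> {RV P >-> S},
    iid mu X /\
    forall E : seq (nat * nat), uniq E -> all (fun e => e.1 < e.2)%N E ->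
      is_cond_prob (sigma_of X) [set w | all (fun e => iadj (G w) e.1 e.2) E]
        (fun w => \prod_(e <- E) W (X e.1 w, X e.2 w)).

End random_graph.

(* Main.v *)
Require Import Defs.
From HB Require Import structures.
From mathcomp Require Import all_boot all_order all_algebra.
From mathcomp Require Import all_classical all_reals all_analysis.
From mathcomp Require Import measurable_realfun.
From mathcomp Require Import ring lra zify.
Import Order.TTheory GRing.Theory Num.Theory.
Import numFieldNormedType.Exports.
Local Open Scope classical_set_scope.
Local Open Scope ring_scope.
Set Implicit Arguments.
Unset Strict Implicit.
Unset Printing Implicit Defensive.

(** The random graph enters the proof only through its law L on the graphs with
    vertex set nat, and L only through [samples]: a copy of a finite graph F on
    prescribed distinct vertices has probability Gamma F ([kernel_samples]).
    So L is invariant under injective relabelling of the vertices, and its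
    restrictions to disjoint sets of vertices are independent.

    Existence of densities and limits is one law of large numbers
    ([event_avg_cvg]). Let Z s be an event about a list s of m vertices, and
    suppose that two such events have the same joint probability for all pairs
    of disjoint lists of distinct vertices, perhaps off a fixed root. The averages of
    the indicator of Z over all lists of vertices below n and below n' >= n then
    differ by O(1/n) in mean square, and the averages vary slowly with n, so they
    converge almost surely.
    Applied to the lists which span F inside the component of a vertex, this
    yields the density of the component and the limit of its induced subgraphs.
    If moreover Z can only be gained by adding vertices to the graph, then up to
    null sets it is decided inside any infinite set of vertices that contains s.
    So it is independent for disjoint lists, and the limit is the probability of
    Z ([monotone_avg_cvg]). This applies to the lists which lie in a single
    component and span F.

    A component with two vertices has positive density: by exchangeability two
    vertices lie together in a component of proportion at most e with probability
    at most 2 e ([small_component_le]). No mass escapes along the list of the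
    components either: few nonisolated vertices avoid the components of the first
    J vertices ([far_null]). Hence almost surely the densities nu_j and the limits
    Gamma'_j of the components of positive density satisfy
    - sum_j nu_j = P(the vertex 0 is not isolated) ([series_weight_cvg]),
    - sum_j nu_j^k Gamma'_j(F) = P(k vertices lie in one component and span F) for
      each F with k >= 2 vertices ([series_heavy_cvg]).

    The last probability also equals sum_i alpha_i^k Gamma_i(F)
    ([join_prob_direct_sum]). The random graph of a connected limit is almost
    surely connected, for otherwise the component of a vertex and its complement
    would split the limit ([ae_connected]). Keep each vertex of the random graph of
    Gamma_i with probability alpha_i: the retained vertices are still connected to
    each other, so k vertices lie in one component and span F with probability
    alpha_i^k Gamma_i(F) ([thinned_law_exists]). The sum over i of these thinned
    laws agrees with L on copies of connected graphs, by definition of the direct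
    sum; the event that given vertices lie in one component and span F is a union of
    countably many events of this form, a family closed under intersection.

    It remains to see that the numbers sum_j nu_j^k Gamma'_j(F) determine the
    pairs (Gamma'_j, nu_j) up to order ([weighted_matching]). Padding F with
    isolated vertices raises k, and joining a disjoint graph F0 to F multiplies
    each term by Gamma'_j(F0). With finitely many such operations a pair is
    isolated among those of weight at least its own, and the smaller weights are
    negligible in high powers. The isolated vertices have density
    1 - sum_j nu_j = 1 - sum_i alpha_i; when this is 0, almost surely no vertex is
    isolated, because the vertex 0 is almost surely not. *)

(** * Homomorphism densities and graph limits *)

Section finite_averages.
Context (R : realType).

Definition favg (F H : finType) (h : {ffun F -> H} -> R) : R :=
  (\sum_f h f) / #|{ffun F -> H}|%:R.

Lemma hom_densityE (F H : sgraph) :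
  hom_density R F H = favg (fun f : {ffun F -> H} => (is_hom f)%:R).
Proof.
rewrite /hom_density /favg -sum1_card natr_sum; congr (_ / _).
by rewrite big_mkcond; apply: eq_bigr => f _; rewrite inE; case: is_hom.
Qed.

Lemma favg_ge0 (F H : finType) (h : {ffun F -> H} -> R) :
  (forall f, 0 <= h f) -> 0 <= favg h.
Proof. by move=> h0; rewrite divr_ge0 ?sumr_ge0. Qed.

(** Every map on F has equally many extensions along the injection i. *)
Lemma favg_marginal (F F' H : finType) (i : F -> F') (x0 : F)
    (h : {ffun F -> H} -> R) : injective i ->
  favg (fun f : {ffun F' -> H} => h [ffun x => f (i x)]) = favg h.
Proof.
move=> inj_i; rewrite /favg.
pose r (f : {ffun F' -> H}) : {ffun F -> H} := [ffun x => f (i x)].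
pose patch (f : {ffun F -> H}) (g : {ffun F' -> H}) : {ffun F' -> H} :=
  [ffun y => if [pick x | i x == y] is Some x then f x else g y].
have rpatch f g : r (patch f g) = f.
  apply/ffunP => x; rewrite /r /patch !ffunE; case: pickP => [z /eqP/inj_i -> //|].
  by move=> /(_ x); rewrite eqxx.
pose fib f := [set g | r g == f]%SET.
have fib_le f1 f2 : (#|fib f1| <= #|fib f2|)%N.
  rewrite -(@card_in_imset _ _ (patch f2) (fib f1)); last first.
    move=> g g' /[!inE] /eqP rg /eqP rg' /ffunP e; apply/ffunP => y.
    have := e y; rewrite /patch !ffunE; case: pickP => // x /eqP <- _.
    by have /ffunP/(_ x) : r g = r g' by [rewrite rg rg']; rewrite !ffunE.
  apply/subset_leq_card/fintype.subsetP => _ /imsetP[g _ ->].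
  by rewrite inE rpatch.
have [H0|H_gt0] := posnP #|H|.
  have F0 : (0 < #|F|)%N by apply/card_gt0P; exists x0.
  have F'0 : (0 < #|F'|)%N by apply/card_gt0P; exists (i x0).
  by rewrite !card_ffun H0 !exp0n// invr0 !mulr0.
have [z0 _] := card_gt0P H_gt0.
pose c := #|fib [ffun=> z0]|.
have fibE f : #|fib f| = c by apply/eqP; rewrite eqn_leq !fib_le.
have sumE (k : {ffun F -> H} -> R) : \sum_g k (r g) = c%:R * \sum_f k f.
  rewrite (partition_big r predT)//= mulr_sumr; apply: eq_bigr => f _.
  rewrite (eq_bigr (fun=> k f)); last by move=> g /eqP ->.
  by rewrite sumr_const -(fibE f) mulr_natl /fib cardsE.
rewrite sumE.
have cE : #|{ffun F' -> H}|%:R = c%:R * #|{ffun F -> H}|%:R :> R.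
  by have := sumE (fun=> 1); rewrite !sumr_const.
rewrite cE.
have c0 : c%:R != 0 :> R.
  rewrite pnatr_eq0 -lt0n; apply/card_gt0P.
  by exists [ffun=> z0]; rewrite inE; apply/eqP/ffunP => x; rewrite !ffunE.
by rewrite invfM mulrACA mulfV ?mul1r.
Qed.

Lemma favg_prod (F1 F2 H : finType) (h1 : {ffun F1 -> H} -> R)
    (h2 : {ffun F2 -> H} -> R) :
  favg (fun f : {ffun F1 + F2 -> H} =>
    h1 [ffun x => f (inl x)] * h2 [ffun x => f (inr x)]) = favg h1 * favg h2.
Proof.
rewrite /favg mulrACA -invfM -natrM; congr (_ / _%:R); last first.
  by rewrite !card_ffun card_sum expnD.
rewrite big_distrlr/= pair_big/=.
pose join (p : {ffun F1 -> H} * {ffun F2 -> H}) : {ffun F1 + F2 -> H} :=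
  [ffun u => match u with inl x => p.1 x | inr x => p.2 x end].
rewrite (reindex join)/=.
  apply: eq_bigr => -[f1 f2] _; congr (h1 _ * h2 _); apply/ffunP => x;
  by rewrite !ffunE.
exists (fun f => ([ffun x => f (inl x)], [ffun x => f (inr x)])).
  by move=> [f1 f2] _; congr (_, _); apply/ffunP => x; rewrite !ffunE.
by move=> f _; apply/ffunP => -[x|x]; rewrite !ffunE.
Qed.

End finite_averages.

Section graph_limits.
Context (R : realType).
Implicit Types (F : graph) (Gam : graph_limit R).

Lemma graph_limit_eq Gam Gam' : (forall F, Gam F = Gam' F) -> Gam = Gam'.
Proof.
case: Gam Gam' => [t tP] [t' tP'] /= tt'.
have e : t = t' by apply: funext.
by move: tP tP'; rewrite e => tP tP'; congr GraphLimit; exact: Prop_irrelevance.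
Qed.

Lemma hom_density_ge0 (F G : sgraph) : 0 <= hom_density R F G.
Proof. by rewrite divr_ge0. Qed.

Lemma hom_density_le1 (F G : sgraph) : hom_density R F G <= 1.
Proof.
rewrite /hom_density; have [->|n0] := eqVneq #|{ffun F -> G}| 0%N.
  by rewrite invr0 mulr0.
by rewrite ler_pdivrMr ?mul1r ?ler_nat ?max_card// ltr0n lt0n.
Qed.

Lemma graph_limit_transfer Gam F (P : R -> Prop) : closed [set x | P x] ->
  (forall G : sgraph, (0 < #|G|)%N -> P (hom_density R F G)) -> P (Gam F).
Proof.
move=> cP PG; have [G [Goo /(_ F) cvG]] := t_limP Gam.
have := @closed_cvg _ _ \oo _ (fun n => hom_density R F (G n)) [set x | P x].
by apply => //; near=> n; exact/PG/graph_gt0.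
Unshelve. all: by end_near. Qed.

Lemma graph_limit_ge0 Gam F : 0 <= Gam F.
Proof.
apply: (@graph_limit_transfer Gam F (fun x => 0 <= x)); first exact: closed_ge.
by move=> G _; exact: hom_density_ge0.
Qed.

Lemma graph_limit_le1 Gam F : Gam F <= 1.
Proof.
apply: (@graph_limit_transfer Gam F (fun x => x <= 1)); first exact: closed_le.
by move=> G _; exact: hom_density_le1.
Qed.

(** The vertices of F' outside the image of i are isolated, hence mapped freely.
    *)
Lemma hom_density_embed F (F' : graph) (i : F -> F') (G : sgraph) :
    injective i ->
    (forall x y, adj x y -> adj (i x) (i y)) ->
    (forall u v : F', adj u v -> exists x y, [/\ i x = u, i y = v & adj x y]) ->
  hom_density R F' G = hom_density R F G.
Proof.
move=> inj_i ih hi; rewrite !hom_densityE.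
have [x0 _] := card_gt0P (graph_gt0 F).
rewrite -(favg_marginal x0 _ inj_i); rewrite /favg; congr (_ / _).
apply: eq_bigr => f _; congr (_%:R); apply: congr1.
apply/forallP/forallP => /= fh x; apply/forallP => y; apply/implyP => xy.
  by rewrite !ffunE; move/forallP/(_ (i y))/implyP : (fh (i x)); apply; exact: ih.
have [a [b [<- <- ab]]] := hi _ _ xy.
by move/forallP/(_ b)/implyP/(_ ab) : (fh a); rewrite !ffunE.
Qed.

Lemma graph_limit_embed Gam F (F' : graph) (i : F -> F') : injective i ->
    (forall x y, adj x y -> adj (i x) (i y)) ->
    (forall u v : F', adj u v -> exists x y, [/\ i x = u, i y = v & adj x y]) ->
  Gam F' = Gam F.
Proof.
move=> inj_i ih hi; have [G [Goo cvG]] := t_limP Gam.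
apply: (cvg_unique (@norm_hausdorff _ R^o) (cvG F')) => //.
rewrite (_ : (fun n => _) = fun n => hom_density R F (G n)); first exact: cvG.
by apply/funext => n; exact: (hom_density_embed _ inj_i).
Qed.

Section disjoint_union.
Context (F1 F2 : graph).
Definition disjoint_adj : rel (F1 + F2)%type := fun u v =>
  match u, v with
  | inl x, inl y => adj x y
  | inr x, inr y => adj x y
  | _, _ => false
  end.
Lemma disjoint_adj_sym : symmetric disjoint_adj.
Proof. by move=> [x|x] [y|y] //=; rewrite adj_sym. Qed.
Lemma disjoint_adj_irr : irreflexive disjoint_adj.
Proof. by move=> [x|x] /=; rewrite adj_irr. Qed.
Lemma disjoint_gt0 : (0 < #|SGraph disjoint_adj_sym disjoint_adj_irr|)%N.
Proof. by rewrite /= card_sum addn_gt0 graph_gt0. Qed.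
Definition disjoint_union : graph := Graph disjoint_gt0.

Lemma hom_density_disjoint (G : sgraph) :
  hom_density R disjoint_union G = hom_density R F1 G * hom_density R F2 G.
Proof.
rewrite !hom_densityE -favg_prod; rewrite /favg; congr (_ / _).
apply: eq_bigr => f _; rewrite -natrM mulnb; congr (_%:R); apply: congr1.
apply/forallP/andP => [fh|[/forallP f1 /forallP f2]].
  split; apply/forallP => x; apply/forallP => y; apply/implyP => xy; rewrite !ffunE.
    by move/forallP/(_ (inl y))/implyP : (fh (inl x)); apply.
  by move/forallP/(_ (inr y))/implyP : (fh (inr x)); apply.
move=> [x|x]; apply/forallP => -[y|y]//; apply/implyP => /= xy.
  by move/forallP/(_ y)/implyP/(_ xy) : (f1 x); rewrite !ffunE.
by move/forallP/(_ y)/implyP/(_ xy) : (f2 x); rewrite !ffunE.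
Qed.

Lemma graph_limit_disjoint Gam : Gam disjoint_union = Gam F1 * Gam F2.
Proof.
have [G [Goo cvG]] := t_limP Gam.
apply: (cvg_unique (@norm_hausdorff _ R^o) (cvG disjoint_union)) => //.
rewrite (_ : (fun n => _) =
    fun n => hom_density R F1 (G n) * hom_density R F2 (G n)); last first.
  by apply/funext => n; exact: hom_density_disjoint.
by apply: cvgM; exact: cvG.
Qed.

End disjoint_union.

End graph_limits.

(** * Laws of infinite random graphs *)

(** The data of an igraph, on a type small enough to carry a measurable
    structure: the sigma-algebra is the one generated by the cylinders. *)
Record ngraph := NGraph {
  nadj : nat -> nat -> bool;
  nadj_sym : forall x y, nadj x y = nadj y x;
  nadj_irr : forall x, nadj x x = false }.

Coercion igraph_of (g : ngraph) : igraph := IGraph (@nadj_sym g) (@nadj_irr g).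

Definition ngraph_of (g : igraph) : ngraph := NGraph (@iadj_sym g) (@iadj_irr g).

Lemma ngraph_ofK g : igraph_of (ngraph_of g) = g.
Proof.
by case: g => a s i; rewrite /igraph_of /=; congr IGraph; exact: Prop_irrelevance.
Qed.

HB.instance Definition _ := gen_eqMixin ngraph.
HB.instance Definition _ := gen_choiceMixin ngraph.
HB.instance Definition _ := isPointed.Build ngraph
  (@NGraph (fun _ _ => false) (fun _ _ => erefl) (fun=> erefl)).

Definition contains (E : seq (nat * nat)) : set ngraph :=
  [set g | all (fun p => nadj g p.1 p.2) E].

HB.instance Definition _ :=
  Measurable.copy ngraph (g_sigma_algebraType (range contains)).

Lemma measurable_contains E : measurable (contains E).
Proof. by apply: sub_sigma_algebra; exists E. Qed.

Lemma measurable_edge i j : measurable [set g | nadj g i j].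
Proof.
rewrite (_ : [set g | _] = contains [:: (i, j)]); first exact: measurable_contains.
by apply/seteqP; split => g /=; rewrite /contains /= andbT.
Qed.

Lemma contains_cat E1 E2 : contains (E1 ++ E2) = contains E1 `&` contains E2.
Proof.
apply/seteqP; split => g; rewrite /contains /= all_cat.
  by move=> /andP[].
by move=> [-> ->].
Qed.

Lemma containsI_closed : setI_closed (range contains).
Proof.
by move=> _ _ [E1 _ <-] [E2 _ <-]; exists (E1 ++ E2) => //; exact: contains_cat.
Qed.

Lemma contains_nil : contains [::] = setT.
Proof. by apply/seteqP; split. Qed.

Lemma measurable_to_ngraph d (T : measurableType d) (f : T -> ngraph) :
  (forall i j, measurable [set x | nadj (f x) i j]) -> measurable_fun setT f.
Proof.
move=> mf; apply: (@measurability _ _ _ _ setT f (range contains)) => //.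
move=> _ [_ [E _ <-] <-]; rewrite setTI.
elim: E => [|[i j] E IH]; first by rewrite contains_nil preimage_setT.
rewrite -cat1s contains_cat preimage_setI; apply: measurableI => //.
rewrite (_ : _ @^-1` _ = [set x | nadj (f x) i j]); first exact: mf.
by apply/seteqP; split => x /=; rewrite /contains /= andbT.
Qed.

Section pull.
Context (s : nat -> nat) (g : ngraph).
Definition pull_adj := fun i j => nadj g (s i) (s j).
Lemma pull_adj_sym : symmetric pull_adj.
Proof. by move=> x y; exact: nadj_sym. Qed.
Lemma pull_adj_irr : irreflexive pull_adj.
Proof. by move=> x; exact: nadj_irr. Qed.
Definition pull : ngraph := NGraph pull_adj_sym pull_adj_irr.
End pull.

Lemma measurable_pull s : measurable_fun setT (pull s).
Proof. by apply: measurable_to_ngraph => i j; exact: measurable_edge. Qed.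

HB.instance Definition _ s :=
  isMeasurableFun.Build _ _ _ _ (pull s) (measurable_pull s).

Section law.
Context (R : realType).

(** The cylinders form a pi-system. *)
Lemma ngraph_measure_unique (m1 m2 : {measure set ngraph -> \bar R}) :
    (m1 setT < +oo)%E ->
    (forall E, m1 (contains E) = m2 (contains E)) ->
  forall X, measurable X -> m1 X = m2 X.
Proof.
move=> fin1 m12 X mX.
apply: (@measure_unique _ _ _ (range contains) (fun=> setT)) => //.
- exact: containsI_closed.
- by move=> _; exists [::] => //; exact: contains_nil.
- by rewrite bigcup_const//; exists 0%N.
- by move=> _ [E _ <-].
Qed.

Definition copy (F : sgraph) (f : F -> nat) : set ngraph :=
  [set g | forall x y : F, adj x y -> nadj g (f x) (f y)].

Definition edges_of (F : sgraph) (f : F -> nat) : seq (nat * nat) :=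
  [seq (f p.1, f p.2) | p <- enum [pred p : F * F | adj p.1 p.2]].

Lemma copyE (F : sgraph) (f : F -> nat) : copy f = contains (edges_of f).
Proof.
apply/seteqP; split=> g /=.
  move=> fg; apply/allP => _ /mapP[p + ->] /=.
  by rewrite mem_enum inE => /fg.
move=> /allP fg x y xy; apply: (fg (f x, f y)).
by apply/mapP; exists (x, y) => //; rewrite mem_enum inE.
Qed.

Lemma measurable_copy (F : sgraph) (f : F -> nat) : measurable (copy f).
Proof. by rewrite copyE; exact: measurable_contains. Qed.

Section edge_graph.
Context (K : nat) (E : seq (nat * nat)).
Definition edge_adj : rel 'I_K.+1 := fun x y =>
  (x != y) && (((x : nat, y : nat) \in E) || ((y : nat, x : nat) \in E)).
Lemma edge_adj_sym : symmetric edge_adj.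
Proof. by move=> x y; rewrite /edge_adj eq_sym orbC. Qed.
Lemma edge_adj_irr : irreflexive edge_adj.
Proof. by move=> x; rewrite /edge_adj eqxx. Qed.
Lemma edge_graph_gt0 : (0 < #|SGraph edge_adj_sym edge_adj_irr|)%N.
Proof. by rewrite card_ord. Qed.
Definition edge_graph : graph := Graph edge_graph_gt0.
End edge_graph.

Definition edge_bound (E : seq (nat * nat)) : nat :=
  \max_(p <- E) maxn p.1 p.2.

Lemma edge_boundP E p : p \in E -> (p.1 <= edge_bound E)%N && (p.2 <= edge_bound E)%N.
Proof.
move=> pE; rewrite -geq_max /edge_bound.
by rewrite (big_rem p)//= leq_maxl.
Qed.

Lemma contains_loop E i : (i, i) \in E -> contains E = set0.
Proof.
move=> iE; apply/seteqP; split => // g /allP/(_ _ iE) /=.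
by rewrite nadj_irr.
Qed.

Lemma contains_edge_graph K E : all (fun p => p.1 != p.2) E ->
    (edge_bound E <= K)%N ->
  contains E = copy (fun x : edge_graph K E => x : nat).
Proof.
move=> /allP noloop EK; apply/seteqP; split=> g /=.
  move=> /allP gE x y /andP[_ /orP[/gE//|/gE]] /=.
  by rewrite nadj_sym.
move=> gE; apply/allP => p pE.
have /andP[p1 p2] := edge_boundP pE.
have l1 : (p.1 < K.+1)%N by rewrite ltnS (leq_trans p1).
have l2 : (p.2 < K.+1)%N by rewrite ltnS (leq_trans p2).
apply: (gE (Ordinal l1) (Ordinal l2)); apply/andP; split.
  by apply: contraNneq (noloop _ pE) => /(congr1 val) /= ->.
by move: pE; rewrite [in X in X -> _](surjective_pairing p) => ->.
Qed.

(** This characterizes the law of the infinite random graph of Gam. *)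
Definition samples (L : {measure set ngraph -> \bar R}) (Gam : graph_limit R) :=
  forall (F : graph) (f : F -> nat), injective f -> L (copy f) = (Gam F)%:E.

Lemma samples_unique (L L' : probability ngraph R) Gam :
    samples L Gam -> samples L' Gam ->
  forall X, measurable X -> L X = L' X.
Proof.
move=> LG L'G; apply: ngraph_measure_unique; first by rewrite /= probability_setT ltry.
move=> E; have [noloop|] := boolP (all (fun p => p.1 != p.2) E).
  by rewrite (contains_edge_graph noloop (leqnn _)) LG ?L'G//; exact: val_inj.
case/allPn => -[i j] ijE /=; rewrite negbK => /eqP ij.
by rewrite (@contains_loop E i) ?measure0// {2}ij.
Qed.

Section consequences.
Context (L : probability ngraph R) (Gam : graph_limit R).
Hypothesis LG : samples L Gam.

(** Exchangeability: placing F by f and then relabelling by s is again an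
    injective placement. *)
Lemma samples_pull (s : nat -> nat) X : injective s -> measurable X ->
  L (pull s @^-1` X) = L X.
Proof.
move=> inj_s mX.
apply: (@samples_unique (distribution L (pull s)) L Gam) => // F f inj_f.
rewrite -(LG (inj_comp inj_s inj_f)).
by congr (L _).
Qed.

(** Two copies on disjoint sets of vertices form a copy of a disjoint union,
    whose density is a product; cylinders on either side determine the joint
    law. *)
Lemma samples_indep (s1 s2 : nat -> nat) X1 X2 :
    injective s1 -> injective s2 -> (forall i j, s1 i != s2 j) ->
    measurable X1 -> measurable X2 ->
  L (pull s1 @^-1` X1 `&` pull s2 @^-1` X2) = (L X1 * L X2)%E.
Proof.
move=> inj1 inj2 dis mX1 mX2.
have mp s X : measurable X -> measurable (pull s @^-1` X).
  by move=> mX; rewrite -[X in measurable X]setTI; exact: measurable_pull.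
have loop0 E : ~~ all (fun p => p.1 != p.2) E -> contains E = set0.
  case/allPn => -[i j] ijE /=; rewrite negbK => /eqP ij.
  by apply: (@contains_loop E i); rewrite {2}ij.
have finL X : measurable X -> L X \is a fin_num.
  by move=> mX; exact: fin_num_measure.
have step (s t : nat -> nat) Y : injective s -> measurable Y ->
    (forall E, L (pull s @^-1` contains E `&` pull t @^-1` Y) =
      (L (contains E) * L Y)%E) ->
    forall X, measurable X -> L (pull s @^-1` X `&` pull t @^-1` Y) =
      (L X * L Y)%E.
  move=> inj_s mY eE X mX.
  have r0 : 0 <= fine (L Y) by exact/fine_ge0/measure_ge0.
  have -> : (L X * L Y)%E = mscale (NngNum r0) L X.
    by rewrite /mscale /= fineK ?finL// muleC.
  rewrite -[LHS]/(pushforward (mrestr L (mp t Y mY)) (pull s) X).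
  apply: ngraph_measure_unique => // [|E].
    by rewrite /= /pushforward /mrestr (le_lt_trans (probability_le1 _ _)) ?ltry//;
      exact: measurableI (mp _ _ _) (mp _ _ _).
  by rewrite /= /pushforward /mrestr /mscale /= fineK ?finL// muleC -eE.
apply: (step s1 s2) => // E1.
rewrite setIC muleC; apply: (step s2 s1 (contains E1)) => //; first exact: measurable_contains.
move=> E2.
have [noloop2|/loop0 ->] := boolP (all (fun p => p.1 != p.2) E2); last first.
  by rewrite preimage_set0 set0I measure0 mul0e.
have [noloop1|/loop0 ->] := boolP (all (fun p => p.1 != p.2) E1); last first.
  by rewrite preimage_set0 setI0 measure0 mule0.
rewrite (contains_edge_graph noloop1 (leqnn _)) (contains_edge_graph noloop2 (leqnn _)).
set F1 := edge_graph _ E1; set F2 := edge_graph _ E2.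
pose f (x : disjoint_union F2 F1) : nat :=
  match x with inl x => s2 (x : 'I__) | inr x => s1 (x : 'I__) end.
have inj_f : injective f.
  move=> [x|x] [y|y] //=.
  - by move=> /inj2/val_inj ->.
  - by move=> /eqP; rewrite eq_sym (negbTE (dis _ _)).
  - by move=> /eqP; rewrite (negbTE (dis _ _)).
  - by move=> /inj1/val_inj ->.
rewrite !LG; [|exact: val_inj|exact: val_inj].
rewrite -EFinM -graph_limit_disjoint -(LG inj_f); congr (L _).
apply/seteqP; split => g /=.
  by move=> [g2 g1] [x|x] [y|y] //= xy; [exact: g2|exact: g1].
move=> gf; split => x y xy.
  exact: (gf (inl x) (inl y)).
exact: (gf (inr x) (inr y)).
Qed.

End consequences.

End law.

(** * Averages over tuples of vertices *)

Section iterated_averages.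
Context (R : realType).
Implicit Types (f : seq nat -> R) (ns : seq nat) (n m : nat).

(** The average of f over the lists s with as many entries as ns and each entry
    below the corresponding one of ns. Nesting the averages makes products of
    averages into averages over concatenated lists. *)
Fixpoint avgs ns f : R :=
  if ns is n :: ns' then n%:R^-1 * \sum_(x < n) avgs ns' (fun s => f ((x : nat) :: s))
  else f [::].

Lemma eq_avgs ns f1 f2 : (forall s, size s = size ns -> f1 s = f2 s) ->
  avgs ns f1 = avgs ns f2.
Proof.
elim: ns f1 f2 => [|n ns IH] f1 f2 e /=; first exact: e.
by congr (_ * _); apply: eq_bigr => x _; apply: IH => s ss; apply: e; rewrite /= ss.
Qed.

Lemma ler_avgs ns f1 f2 : (forall s, size s = size ns -> f1 s <= f2 s) ->
  avgs ns f1 <= avgs ns f2.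
Proof.
elim: ns f1 f2 => [|n ns IH] f1 f2 e /=; first exact: e.
apply: ler_wpM2l; first by rewrite invr_ge0.
by apply: ler_sum => x _; apply: IH => s ss; apply: e; rewrite /= ss.
Qed.

Lemma avgsD ns f1 f2 : avgs ns (fun s => f1 s + f2 s) = avgs ns f1 + avgs ns f2.
Proof.
elim: ns f1 f2 => [|n ns IH] f1 f2 //=; rewrite -mulrDr -big_split/=.
by congr (_ * _); apply: eq_bigr => x _; rewrite IH.
Qed.

Lemma avgsZ ns a f : avgs ns (fun s => a * f s) = a * avgs ns f.
Proof.
elim: ns f => [|n ns IH] f //=; rewrite mulrCA; congr (_ * _).
by rewrite mulr_sumr; apply: eq_bigr => x _; rewrite IH.
Qed.

Lemma avgsB ns f1 f2 : avgs ns (fun s => f1 s - f2 s) = avgs ns f1 - avgs ns f2.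
Proof.
rewrite -[- avgs ns f2]mulN1r -avgsZ -avgsD.
by apply: eq_avgs => s _; rewrite mulN1r.
Qed.

Lemma avgs_sum ns (I : Type) (r : seq I) (P : pred I) (f : I -> seq nat -> R) :
  avgs ns (fun s => \sum_(i <- r | P i) f i s) = \sum_(i <- r | P i) avgs ns (f i).
Proof.
elim: r => [|i r IH].
  rewrite big_nil -[RHS](mul0r (avgs ns (fun=> 0))) -avgsZ.
  by apply: eq_avgs => s _; rewrite big_nil mul0r.
rewrite big_cons -IH; case: ifPn => Pi; last first.
  by apply: eq_avgs => s _; rewrite big_cons (negbTE Pi).
by rewrite -avgsD; apply: eq_avgs => s _; rewrite big_cons Pi.
Qed.

Lemma avgs_cst ns a : all (fun n => 0 < n)%N ns -> avgs ns (fun=> a) = a.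
Proof.
elim: ns => [|n ns IH] //= /andP[n0 /IH {}IH].
under eq_bigr do rewrite IH.
by rewrite sumr_const card_ord -[a *+ n]mulr_natl mulKf// pnatr_eq0 -lt0n.
Qed.

Lemma avgs_ge0 ns f : (forall s, size s = size ns -> 0 <= f s) -> 0 <= avgs ns f.
Proof.
move=> f0; rewrite -[0](mul0r (avgs ns (fun=> 0))) -avgsZ.
by apply: ler_avgs => s ss; rewrite mul0r f0.
Qed.

Lemma avgs_le1 ns f : (forall s, size s = size ns -> 0 <= f s <= 1) ->
  0 <= avgs ns f <= 1.
Proof.
elim: ns f => [|n ns IH] f f01 /=; first exact: f01.
have ih x : 0 <= avgs ns (fun s => f (x :: s)) <= 1.
  by apply: IH => s ss; apply: f01; rewrite /= ss.
apply/andP; split.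
  by rewrite mulr_ge0// ?invr_ge0// sumr_ge0// => x _; case/andP: (ih x).
have [->|n0] := posnP n; first by rewrite big_ord0 mulr0.
rewrite ler_pdivrMl ?ltr0n// mulr1.
have -> : n%:R = \sum_(x < n) (1 : R) by rewrite sumr_const card_ord.
by apply: ler_sum => x _; case/andP: (ih x).
Qed.

Lemma avgs_mul ns ms f1 f2 : avgs ns f1 * avgs ms f2 =
  avgs (ns ++ ms) (fun s => f1 (take (size ns) s) * f2 (drop (size ns) s)).
Proof.
elim: ns f1 => [|n ns IH] f1 /=; first by rewrite -avgsZ; apply: eq_avgs => s _; rewrite take0 drop0.
rewrite -mulrA; congr (_ * _); rewrite mulr_suml; apply: eq_bigr => x _.
by rewrite IH.
Qed.

Lemma sum_mem_le n (r : seq nat) :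
  \sum_(x < n) ((x : nat) \in r)%:R <= (size r)%:R :> R.
Proof.
rewrite -natr_sum ler_nat.
rewrite -[X in (X <= _)%N](big_mkord predT (fun x => (x \in r : nat))).
have -> : (\sum_(0 <= i < n) (i \in r) = count (mem r) (index_iota 0 n))%N.
  by rewrite -sum1_count [RHS]big_mkcond; apply: eq_bigr => i _ /=; case: (i \in r).
rewrite -size_filter; apply: uniq_leq_size; first by rewrite filter_uniq ?iota_uniq.
by move=> i; rewrite mem_filter => /andP[].
Qed.

(** Few of the sampled tuples repeat an index: the average of a function that
    is constant on the repetition-free tuples is close to this constant. *)
Lemma avgs_uniq ns f c r n0 : (0 < n0)%N -> all (fun n => n0 <= n)%N ns ->
    (forall s, size s = size ns -> `|f s - c| <= 1) ->
    uniq r -> (forall s, size s = size ns -> uniq (s ++ r) -> f s = c) ->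
  `|avgs ns f - c| <= (size ns * (size ns + size r))%:R / n0%:R.
Proof.
move=> n0_gt0; elim: ns f r => [|n ns IH] f r /=.
  by move=> _ _ ur /(_ [::] erefl ur) ->; rewrite subrr normr0 mul0r.
move=> /andP[n0n ns_n0] f1 ur fc.
have n_gt0 : (0 < n)%N by exact: leq_trans n0n.
have all0 : all (fun n => 0 < n)%N ns.
  by apply/allP => k /(allP ns_n0); exact: leq_trans.
pose h x := avgs ns (fun s => f (x :: s)).
have h1 x : `|h x - c| <= 1.
  rewrite ler_norml; apply/andP; split.
    rewrite -lerBlDr opprK addrC -(avgs_cst (c - 1) all0).
    apply: ler_avgs => s ss; have := f1 (x :: s); rewrite /= ss => /(_ erefl).
    by rewrite ler_norml => /andP[+ _]; lra.
  rewrite lerBlDr -(avgs_cst (1 + c) all0).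
  apply: ler_avgs => s ss; have := f1 (x :: s); rewrite /= ss => /(_ erefl).
  by rewrite ler_norml => /andP[_]; lra.
pose B : R := (size ns * (size ns + (size r).+1))%:R / n0%:R.
have B0 : 0 <= B by rewrite divr_ge0.
have hB x : x \notin r -> `|h x - c| <= B.
  move=> xr; apply: (IH _ (x :: r)) => //=.
  - by move=> s ss; apply: f1; rewrite /= ss.
  - by rewrite xr.
  - move=> s ss us; apply: fc; first by rewrite /= ss.
    by move: us; rewrite -[x :: r]cat1s uniq_catCA.
have -> : n%:R^-1 * \sum_(x < n) h x - c = n%:R^-1 * \sum_(x < n) (h x - c).
  rewrite sumrB mulrBr sumr_const card_ord -[c *+ n]mulr_natl mulKf//.
  by rewrite pnatr_eq0 -lt0n.
rewrite normrM ger0_norm ?invr_ge0//.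
have hx x : `|h x - c| <= B + (x \in r)%:R.
  have [xr|/hB] := boolP (x \in r); last by rewrite addr0.
  by rewrite (le_trans (h1 _))// lerDr.
have cnt : \sum_(x < n) ((x : nat) \in r)%:R <= (size r)%:R :> R by exact: sum_mem_le.
have : n%:R^-1 * `|\sum_(x < n) (h x - c)| <= B + (size r)%:R / n%:R.
  have e : n%:R * ((size r)%:R / n%:R) = (size r)%:R :> R.
    by rewrite mulrC divfK ?pnatr_eq0 -?lt0n.
  rewrite ler_pdivrMl ?ltr0n// mulrDr e.
  apply: (le_trans (ler_norm_sum _ _ _)).
  apply: (le_trans (ler_sum _ (fun (x : 'I_n) _ => hx x))).
  by rewrite big_split/= sumr_const card_ord mulr_natl lerD2l.
move=> /le_trans; apply; rewrite /B.
have le_n : (size r)%:R / n%:R <= (size r)%:R / n0%:R :> R.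
  by rewrite ler_wpM2l// lef_pV2 ?posrE ?ltr0n// ler_nat.
apply: (le_trans (lerD (lexx _) le_n)).
rewrite -mulrDl -natrD ler_wpM2r ?invr_ge0// ler_nat.
move: (size ns) (size r) => a b; have -> : (a + b.+1 = a.+1 + b)%N by lia.
by rewrite mulSn addnC leq_add2r; lia.
Qed.

Definition tuple_sum m n f : R := n%:R ^+ m * avgs (nseq m n) f.

Lemma tuple_sumS m n f : (0 < n)%N ->
  tuple_sum m.+1 n f = \sum_(x < n) tuple_sum m n (fun s => f ((x : nat) :: s)).
Proof.
move=> n0; rewrite /tuple_sum /= -mulr_sumr exprSr -mulrA mulVKf//.
by rewrite pnatr_eq0 -lt0n.
Qed.

(** A larger n only adds nonnegative terms. *)
Lemma tuple_sum_mono m n n' f : (0 < n <= n')%N -> (forall s, 0 <= f s) ->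
  tuple_sum m n f <= tuple_sum m n' f.
Proof.
move=> /andP[n0 nn']; have n'0 : (0 < n')%N by exact: leq_trans nn'.
elim: m f => [|m IH] f f0; first by rewrite /tuple_sum !expr0.
rewrite !tuple_sumS//.
rewrite -[leLHS](big_mkord predT (fun x => tuple_sum m n (fun s => f (x :: s)))).
rewrite -[leRHS](big_mkord predT (fun x => tuple_sum m n' (fun s => f (x :: s)))).
rewrite [leRHS](big_cat_nat (leq0n n) nn')/=.
rewrite -[leLHS]addr0; apply: lerD.
  by apply: ler_sum => x _; exact: IH.
apply: sumr_ge0 => x _; rewrite mulr_ge0// ?exprn_ge0//.
by apply: avgs_ge0 => s _; exact: f0.
Qed.

Lemma one_sub_expr_le m (t : R) : 0 <= t <= 1 -> 1 - t ^+ m <= m%:R * (1 - t).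
Proof.
move=> /andP[t0 t1]; elim: m => [|m IH]; first by rewrite expr0 subrr mul0r.
rewrite -natr1 mulrDl mul1r exprS.
have tm : 0 <= t ^+ m <= 1 by rewrite exprn_ge0//= exprn_ile1.
have : (1 - t) * (1 - t ^+ m) >= 0 by rewrite mulr_ge0 ?subr_ge0//; case/andP: tm.
nra.
Qed.

(** The sums of f and of 1 - f over the tuples both increase with n, so the
    average moves by at most the proportion of new tuples. *)
Lemma avgs_slow m n n' f : (0 < n <= n')%N -> (forall s, 0 <= f s <= 1) ->
  `|avgs (nseq m n') f - avgs (nseq m n) f| <= m%:R * (1 - n%:R / n'%:R).
Proof.
move=> nn' f01; have /andP[n0 lenn'] := nn'.
have n'0 : (0 < n')%N by exact: leq_trans lenn'.
have pos k : (0 < k)%N -> all (fun n => 0 < n)%N (nseq m k).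
  by move=> k0; rewrite all_nseq k0 orbT.
have f0 s : 0 <= f s by case/andP: (f01 s).
have f1 s : 0 <= 1 - f s by rewrite subr_ge0; case/andP: (f01 s).
have a01 k : 0 <= avgs (nseq m k) f <= 1 by apply: avgs_le1.
have m1 := tuple_sum_mono m nn' f0.
have m2 := tuple_sum_mono m nn' f1.
move: m1 m2; rewrite /tuple_sum !avgsB !avgs_cst ?pos//.
move: (a01 n) (a01 n'); move: (avgs _ f) (avgs _ f) => x x'.
move=> /andP[x0 x1] /andP[x'0 x'1].
have n'R : 0 < n'%:R :> R by rewrite ltr0n.
set t : R := n%:R / n'%:R.
have t01 : 0 <= t <= 1.
  by rewrite divr_ge0//= ler_pdivrMr// mul1r ler_nat.
have -> : n%:R ^+ m = t ^+ m * n'%:R ^+ m :> R.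
  by rewrite /t expr_div_n divfK// expf_eq0 gt_eqF ?andbF.
have N0 : 0 < n'%:R ^+ m :> R by rewrite exprn_gt0.
rewrite ![t ^+ m * _]mulrC -!mulrA !ler_pM2l// => i1 i2.
apply: le_trans (one_sub_expr_le m t01).
have tm : 0 <= t ^+ m <= 1.
  by case/andP: t01 => ? ?; rewrite exprn_ge0//= exprn_ile1.
by rewrite ler_norml; apply/andP; split; nra.
Qed.

End iterated_averages.

(** * Slowly varying sequences *)

Section deterministic_convergence.
Context (R : realType).
Implicit Types (X Y : nat -> R).

Lemma is_cvg_series_invsq : cvgn (series (fun k => (k.+1%:R ^+ 2)^-1 : R)).
Proof.
apply: nondecreasing_is_cvgn.
  by apply: nondecreasing_series => n _ _; rewrite invr_ge0 exprn_ge0.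
exists 2 => _ [n _ <-]; rewrite /series /=.
suff : \sum_(0 <= k < n) (k.+1%:R ^+ 2)^-1 <= 2 - 2 / n.+1%:R :> R.
  by move/le_trans; apply; rewrite gerBl divr_ge0.
elim: n => [|n IH]; first by rewrite big_geq// divr1 subrr.
rewrite big_nat_recr//=; apply: le_trans (lerD IH (lexx _)) _.
have n1 : 0 < n.+1%:R :> R by [].
have n2 : n.+2%:R = n.+1%:R + 1 :> R by rewrite -[n.+2]addn1 natrD.
rewrite n2; move: n1; set x := n.+1%:R => x0.
have x1 : 1 <= x by rewrite /x ler1n.
rewrite -subr_ge0.
have -> : 2 - 2 / (x + 1) - (2 - 2 / x + (x ^+ 2)^-1) = (x - 1) / (x ^+ 2 * (x + 1)).
  by field; apply/andP; split; lra.
by apply: divr_ge0; [lra|rewrite mulr_ge0 ?exprn_ge0//; lra].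
Qed.

(** Consecutive fourth powers have ratio tending to 1, so a slowly varying
    sequence stays close to its values there. *)
Lemma cvg_of_slow_subseq X (M l : R) : 0 <= M ->
    (forall n n', (0 < n <= n')%N -> `|X n' - X n| <= M * (1 - n%:R / n'%:R)) ->
    X (k.+1 ^ 4)%N @[k --> \oo] --> l ->
  X n @[n --> \oo] --> l.
Proof.
move=> M0 slow subl; apply/cvgrPdist_le => e e0.
have e2 : 0 < e / 2 by rewrite divr_gt0.
have [K _ HK] : \forall k \near \oo, `|l - X (k.+1 ^ 4)%N| <= e / 2.
  by move/cvgrPdist_le : subl; apply.
(* beyond C the relative gap 4 / k between fourth powers costs at most e / 2 *)
pose C := (8 * M / e).
have C0 : 0 <= C by rewrite divr_ge0 ?mulr_ge0// ltW.
pose K' := maxn K (Num.truncn C).+1.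
exists (K'.+1 ^ 4)%N => // n /= nK.
have n0 : (0 < n)%N by apply: leq_trans nK; rewrite expn_gt0.
have ex : exists k, (k.+1 ^ 4 <= n)%N by exists 0%N; rewrite exp1n.
have bd k : (k.+1 ^ 4 <= n)%N -> (k <= n)%N.
  move=> h; apply: leq_trans h; apply: leq_trans (leqnSn k) _.
  by rewrite -{1}(expn1 k.+1) leq_pexp2l.
case: (ex_maxnP ex bd) => k kn kmax.
have kK : (K' <= k)%N by exact: kmax.
have nk : (n < k.+2 ^ 4)%N.
  by rewrite ltnNge; apply/negP => /kmax; rewrite ltnn.
have kk : (0 < k.+1 ^ 4 <= n)%N by rewrite expn_gt0 kn.
have := slow _ _ kk; rewrite distrC => sl.
have h1 : `|l - X (k.+1 ^ 4)%N| <= e / 2.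
  by apply: HK => /=; apply: leq_trans kK; exact: leq_maxl.
rewrite (splitr e) -[l - X n](subrKA (X (k.+1 ^ 4)%N)).
apply: le_trans (ler_normD _ _) _; apply: lerD => //.
apply: le_trans sl _.
have nR : 0 < n%:R :> R by rewrite ltr0n.
pose t : R := k.+1%:R / k.+2%:R.
have t01 : 0 <= t <= 1 by rewrite divr_ge0//= ler_pdivrMr// mul1r ler_nat.
have le1 : t ^+ 4 <= (k.+1 ^ 4)%:R / n%:R.
  rewrite /t expr_div_n -!natrX ler_wpM2l// lef_pV2 ?posrE ?ltr0n ?expn_gt0//.
  by rewrite ler_nat ltnW.
have le2 := one_sub_expr_le 4 t01.
have le3 : 4 * (1 - t) = 4 / k.+2%:R.
  rewrite /t; have -> : k.+2%:R = k.+1%:R + 1 :> R by rewrite -[k.+2]addn1 natrD.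
  have : 0 < k.+1%:R :> R by [].
  move: k.+1%:R => x x0; have x1 : x + 1 != 0 by rewrite gt_eqF// addr_gt0.
  by field.
have le4 : 1 - (k.+1 ^ 4)%:R / n%:R <= 4 / k.+2%:R :> R.
  by rewrite -le3; apply: le_trans le2; rewrite lerD2l lerN2.
apply: le_trans (ler_wpM2l M0 le4) _.
have Ck : C <= k.+2%:R.
  apply: le_trans (ltW (truncnS_gt C)) _; rewrite ler_nat.
  apply: (leq_trans (leq_maxr K _)); apply: (leq_trans kK).
  exact: leq_trans (leqnSn k) (leqnSn _).
rewrite mulrA ler_pdivrMr ?ltr0n//.
have := ler_wpM2l (ltW e2) Ck.
have -> : e / 2 * C = M * 4 by rewrite /C; field; rewrite gt_eqF.
by [].
Qed.

(** The increments x are absolutely summable, because 2 |x| <= a^2 x^2 + a^-2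
    for a = k + 1. *)
Lemma cvg_of_summable_sqr Y :
  cvgn (series (fun k => k.+1%:R ^+ 2 * (Y k.+1 - Y k) ^+ 2)) -> cvgn Y.
Proof.
move=> c1.
have c2 : cvgn (series (fun k => k.+1%:R ^+ 2 * (Y k.+1 - Y k) ^+ 2 + (k.+1%:R ^+ 2)^-1)).
  by apply: is_cvg_seriesD => //; exact: is_cvg_series_invsq.
have c3 : cvgn [normed series (telescope Y)].
  apply: series_le_cvg c2 => n //=.
    by apply: addr_ge0; [apply: mulr_ge0; exact: sqr_ge0|rewrite invr_ge0 sqr_ge0].
  rewrite /telescope /=; set x := Y n.+1 - Y n; set a : R := n.+1%:R.
  have a0 : a != 0 by rewrite pnatr_eq0.
  have := sqr_ge0 (a * `|x| - a^-1).
  have e : a * `|x| / a = `|x| by rewrite mulrAC divff// mul1r.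
  rewrite sqrrB e exprMn -normrX (ger0_norm (sqr_ge0 x)) exprVn.
  have := normr_ge0 x; move: (a ^+ 2 * _) (a ^- 2) => u v; lra.
have c4 := normed_cvg c3; rewrite telescopeK in c4.
have -> : Y = (fun n => (Y n - Y 0%N) + Y 0%N) by apply/funext => n; rewrite subrK.
by apply: is_cvgD => //; exact: is_cvg_cst.
Qed.

Lemma cvg_to_of_summable_sqr Y q :
  cvgn (series (fun k => (Y k - q) ^+ 2)) -> Y @ \oo --> q.
Proof.
move=> /cvg_series_cvg_0 c; apply/cvgrPdist_lt => e e0.
have e2 : 0 < e ^+ 2 by rewrite exprn_gt0.
move/cvgrPdist_lt : c => /(_ _ e2) [N _ HN]; exists N => // n /HN /=.
rewrite sub0r normrN normrX distrC => h; rewrite -(ltr_pXn2r (n := 2)) ?nnegrE//.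
exact: ltW.
Qed.

End deterministic_convergence.

(** * A law of large numbers for events indexed by tuples *)

Section bounded_measurable.
Context d (T : measurableType d) (R : realType) (L : probability T R).
Implicit Types (h : T -> R).

Definition bounded_mfun h :=
  measurable_fun setT h /\ exists C, forall x, `|h x| <= C.

Lemma bounded_mfun_integrable h : bounded_mfun h ->
  L.-integrable setT (EFin \o h).
Proof.
move=> [mh [C hC]]; apply: measurable_bounded_integrable => //.
  by rewrite /= probability_setT ltry.
exists C; split; first exact: num_real.
by move=> M CM x _ /=; rewrite (le_trans (hC x))// ltW.
Qed.

Lemma bounded_mfunD h1 h2 : bounded_mfun h1 -> bounded_mfun h2 ->
  bounded_mfun (fun x => h1 x + h2 x).
Proof.
move=> [m1 [C1 b1]] [m2 [C2 b2]]; split; first exact: measurable_funD.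
by exists (C1 + C2) => x; rewrite (le_trans (ler_normD _ _))// lerD.
Qed.

Lemma bounded_mfunM h1 h2 : bounded_mfun h1 -> bounded_mfun h2 ->
  bounded_mfun (fun x => h1 x * h2 x).
Proof.
move=> [m1 [C1 b1]] [m2 [C2 b2]]; split; first exact: measurable_funM.
by exists (C1 * C2) => x; rewrite normrM ler_pM.
Qed.

Lemma bounded_mfun_cst a : bounded_mfun (fun=> a).
Proof. by split; [exact: measurable_cst|exists `|a|]. Qed.

Lemma bounded_mfunZ a h : bounded_mfun h -> bounded_mfun (fun x => a * h x).
Proof. by move=> bh; apply: bounded_mfunM => //; exact: bounded_mfun_cst. Qed.

Lemma bounded_mfunB h1 h2 : bounded_mfun h1 -> bounded_mfun h2 ->
  bounded_mfun (fun x => h1 x - h2 x).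
Proof.
move=> b1 b2; have := bounded_mfunD b1 (bounded_mfunZ (-1) b2).
by under eq_fun do rewrite mulN1r.
Qed.

Lemma bounded_mfun_indic A : measurable A -> bounded_mfun (\1_A : T -> R).
Proof.
move=> mA; split; first exact: measurable_indic.
by exists 1 => x; rewrite indicE; case: (_ \in _); rewrite ?normr1 ?normr0.
Qed.

Lemma bounded_mfun_sum (I : Type) (r : seq I) (h : I -> T -> R) :
  (forall i, bounded_mfun (h i)) -> bounded_mfun (fun x => \sum_(i <- r) h i x).
Proof.
move=> bh; elim: r => [|i r IH].
  by under eq_fun do rewrite big_nil; exact: bounded_mfun_cst.
by under eq_fun do rewrite big_cons; exact: bounded_mfunD.
Qed.

Lemma bounded_mfun_avgs ns (h : seq nat -> T -> R) : (forall s, bounded_mfun (h s)) ->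
  bounded_mfun (fun x => avgs ns (fun s => h s x)).
Proof.
elim: ns h => [|n ns IH] h bh /=; first exact: bh.
by apply: bounded_mfunZ; apply: bounded_mfun_sum => i; exact: IH.
Qed.

Lemma fine_prob01 (A : set T) : measurable A -> 0 <= fine (L A) <= 1.
Proof.
move=> mA; rewrite fine_ge0//= -lee_fin fineK ?fin_num_measure//.
exact: probability_le1.
Qed.

Definition mean h : R := \int[L]_x h x.

Lemma meanD h1 h2 : bounded_mfun h1 -> bounded_mfun h2 ->
  mean (fun x => h1 x + h2 x) = mean h1 + mean h2.
Proof.
by move=> b1 b2; rewrite /mean RintegralD//; exact: bounded_mfun_integrable.
Qed.

Lemma meanB h1 h2 : bounded_mfun h1 -> bounded_mfun h2 ->
  mean (fun x => h1 x - h2 x) = mean h1 - mean h2.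
Proof.
by move=> b1 b2; rewrite /mean RintegralB//; exact: bounded_mfun_integrable.
Qed.

Lemma meanZ a h : bounded_mfun h -> mean (fun x => a * h x) = a * mean h.
Proof.
by move=> b; rewrite /mean RintegralZl//; exact: bounded_mfun_integrable.
Qed.

Lemma mean_cst a : mean (fun=> a) = a.
Proof. by rewrite /mean Rintegral_cst//= probability_setT/= mulr1. Qed.

Lemma mean_indic A : measurable A -> mean (\1_A : T -> R) = fine (L A).
Proof. by move=> mA; rewrite /mean /Rintegral integral_indic// setIT. Qed.

Lemma mean_le h1 h2 : bounded_mfun h1 -> bounded_mfun h2 ->
  (forall x, h1 x <= h2 x) -> mean h1 <= mean h2.
Proof.
by move=> b1 b2 h12; apply: le_Rintegral => //; exact: bounded_mfun_integrable.
Qed.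

Lemma mean_sum (I : Type) (r : seq I) (h : I -> T -> R) :
  (forall i, bounded_mfun (h i)) ->
  mean (fun x => \sum_(i <- r) h i x) = \sum_(i <- r) mean (h i).
Proof.
move=> bh; elim: r => [|i r IH].
  by rewrite big_nil; under eq_fun do rewrite big_nil; rewrite mean_cst.
rewrite big_cons -IH; under eq_fun do rewrite big_cons.
by rewrite meanD//; exact: bounded_mfun_sum.
Qed.

Lemma mean_avgs ns (h : seq nat -> T -> R) : (forall s, bounded_mfun (h s)) ->
  mean (fun x => avgs ns (fun s => h s x)) = avgs ns (fun s => mean (h s)).
Proof.
elim: ns h => [|n ns IH] h bh //=.
rewrite meanZ; last by apply: bounded_mfun_sum => i; exact: bounded_mfun_avgs.
congr (_ * _); rewrite mean_sum; last by move=> i; exact: bounded_mfun_avgs.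
by apply: eq_bigr => i _; exact: IH.
Qed.

Lemma meanE h : bounded_mfun h -> (\int[L]_x (h x)%:E)%E = (mean h)%:E.
Proof.
move=> bh; rewrite /mean /Rintegral fineK//.
by have := integrable_fin_num measurableT (bounded_mfun_integrable bh).
Qed.

(** The sum of the series has finite expectation. *)
Lemma ae_summable (Y : nat -> T -> R) C :
    (forall k, bounded_mfun (Y k)) -> (forall k x, 0 <= Y k x) ->
    (forall k, mean (Y k) <= C * (k.+1%:R ^+ 2)^-1) ->
  {ae L, forall x, cvgn (series (Y ^~ x))}.
Proof.
move=> bY Y0 YC.
have C0 : 0 <= C.
  have : 0 <= mean (Y 0%N) by apply: Rintegral_ge0 => x _; exact: Y0.
  by move/le_trans => /(_ _ (YC 0%N)); rewrite expr1n invr1 mulr1.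
pose f x := (\sum_(k <oo) (Y k x)%:E)%E.
have mYE k : measurable_fun setT (fun x => (Y k x)%:E).
  by apply/measurable_EFinP; case: (bY k).
have intf : (\int[L]_x f x < +oo)%E.
  rewrite /f integral_nneseries//; last by move=> k x _; rewrite lee_fin.
  under eq_eseriesr do rewrite meanE//.
  have cS := @is_cvg_series_invsq R.
  set u : R^nat := (fun k => (k.+1%:R ^+ 2)^-1) in cS.
  apply: (@le_lt_trans _ _ (C * limn (series u))%:E); last first.
    exact: ltry.
  apply: lime_le.
    apply: is_cvg_nneseries => k _ _; rewrite lee_fin.
    by apply: Rintegral_ge0 => x _; exact: Y0.
  apply: nearW => n; rewrite sumEFin lee_fin.
  apply: (@le_trans _ _ (C * series u n)).
    by rewrite /series /= mulr_sumr; apply: ler_sum => i _; exact: YC.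
  rewrite ler_wpM2l//; apply: nondecreasing_cvgn_le => //.
  by apply: nondecreasing_series => k _ _; rewrite invr_ge0 sqr_ge0.
have mf : measurable_fun setT f.
  by apply: ge0_emeasurable_sum => // k x _ _; rewrite lee_fin.
have f0 x : (0 <= f x)%E by apply: nneseries_ge0 => k _ _; rewrite lee_fin.
have intgf : L.-integrable setT f.
  apply/integrableP; split => //.
  by under eq_integral do rewrite gee0_abs//.
have := integrable_ae measurableT intgf.
apply: filterS => x /(_ I) fx.
apply: nondecreasing_is_cvgn; first by apply: nondecreasing_series => k _ _.
exists (fine (f x)) => _ [n _ <-]; rewrite -lee_fin fineK// /series /= -sumEFin.
by apply: nneseries_lim_ge => k _ _; rewrite lee_fin.
Qed.

End bounded_measurable.

(** The second moment method. All pairs of disjoint lists of distinct indices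
    that avoid the roots r have the same probability c of occurring together,
    and few pairs of lists are of another kind. *)
Section averaged_events.
Context d (T : measurableType d) (R : realType) (L : probability T R).
Context (Z : seq nat -> set T) (m : nat) (r : seq nat) (c : R).
Hypothesis mZ : forall s, measurable (Z s).
Hypothesis ur : uniq r.
Hypothesis c01 : 0 <= c <= 1.
Hypothesis LZ : forall s1 s2, size s1 = m -> size s2 = m ->
  uniq (s1 ++ s2 ++ r) -> L (Z s1 `&` Z s2) = c%:E.

Definition event_avg (n : nat) (x : T) : R :=
  avgs (nseq m n) (fun s => \1_(Z s) x).

Let K : R := ((m + m) * (m + m + size r))%:R.

Let ind01 A (x : T) : 0 <= (\1_A x : R) <= 1.
Proof. by rewrite indicE; case: (_ \in _); rewrite /= lexx ler01. Qed.

Let bI s : bounded_mfun (\1_(Z s) : T -> R). Proof. exact: bounded_mfun_indic. Qed.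

Lemma bounded_event_avg n : bounded_mfun (event_avg n).
Proof. exact: bounded_mfun_avgs. Qed.

Lemma event_avg_cov n0 n n' : (0 < n0)%N -> (n0 <= n)%N -> (n0 <= n')%N ->
  `|mean L (fun x => event_avg n x * event_avg n' x) - c| <= K / n0%:R.
Proof.
move=> n0_gt0 n0n n0n'; rewrite /event_avg.
under eq_fun do rewrite avgs_mul size_nseq.
rewrite mean_avgs; last by move=> s; exact: bounded_mfunM.
have zE s : (fun x : T => \1_(Z (take m s)) x * \1_(Z (drop m s)) x) =
    \1_(Z (take m s) `&` Z (drop m s)) :> (T -> R).
  by rewrite indicI.
have -> : K = (size (nseq m n ++ nseq m n') *
    (size (nseq m n ++ nseq m n') + size r))%:R.
  by rewrite size_cat !size_nseq.
apply: avgs_uniq => //.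
- by rewrite all_cat !all_nseq n0n n0n' !orbT.
- move=> s _; rewrite zE mean_indic; last exact: measurableI.
  have := fine_prob01 L (measurableI _ _ (mZ (take m s)) (mZ (drop m s))).
  by case/andP: c01 => ? ? /andP[? ?]; rewrite ler_norml; apply/andP; split; lra.
- move=> s; rewrite size_cat !size_nseq => ss us.
  rewrite zE mean_indic; last exact: measurableI.
  rewrite LZ//.
  + by rewrite size_takel// ss leq_addr.
  + by rewrite size_drop ss addnK.
  + by rewrite catA cat_take_drop.
Qed.

(** The second moments and the mixed moment of the two averages are all close to
    c. *)
Lemma event_avg_sqr_diff n0 n n' : (0 < n0)%N -> (n0 <= n)%N -> (n0 <= n')%N ->
  mean L (fun x => (event_avg n' x - event_avg n x) ^+ 2) <= 4 * K / n0%:R.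
Proof.
move=> h0 h h'.
have bM k k' : bounded_mfun (fun x => event_avg k x * event_avg k' x).
  by apply: bounded_mfunM; exact: bounded_event_avg.
have -> : (fun x => (event_avg n' x - event_avg n x) ^+ 2) =
    (fun x => event_avg n' x * event_avg n' x - 2 * (event_avg n x * event_avg n' x)
      + event_avg n x * event_avg n x).
  by apply/funext => x; ring.
rewrite meanD ?meanB ?meanZ//; try exact: bounded_mfunZ; last first.
  by apply: bounded_mfunB => //; exact: bounded_mfunZ.
have := event_avg_cov h0 h h; have := event_avg_cov h0 h' h'.
have := event_avg_cov h0 h h'.
rewrite !ler_norml -mulrA => /andP[? ?] /andP[? ?] /andP[? ?].
lra.
Qed.

Lemma event_avg_slow n n' x : (0 < n <= n')%N ->
  `|event_avg n' x - event_avg n x| <= m%:R * (1 - n%:R / n'%:R).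
Proof. by move=> nn'; apply: avgs_slow. Qed.

(** Along the fourth powers of k the squared increments have mean of order k^-4,
    which remains summable when multiplied by k^2; in between, the averages vary
    slowly. *)
Lemma event_avg_cvg : {ae L, forall x, cvgn (event_avg ^~ x)}.
Proof.
pose Y k x := k.+1%:R ^+ 2 * (event_avg (k.+2 ^ 4) x - event_avg (k.+1 ^ 4) x) ^+ 2.
have : {ae L, forall x, cvgn (series (Y ^~ x))}.
  have bS k : bounded_mfun (fun x => (event_avg (k.+2 ^ 4) x - event_avg (k.+1 ^ 4) x) ^+ 2).
    by apply: bounded_mfunM; apply: bounded_mfunB; exact: bounded_event_avg.
  apply: (@ae_summable _ _ _ _ _ (4 * K)).
  - by move=> k; exact: bounded_mfunZ.
  - by move=> k x; rewrite mulr_ge0// sqr_ge0.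
  - move=> k; rewrite meanZ//.
    have n0 : (0 < k.+1 ^ 4)%N by rewrite expn_gt0.
    have le4 : (k.+1 ^ 4 <= k.+2 ^ 4)%N by rewrite leq_exp2r.
    have := event_avg_sqr_diff n0 (leqnn _) le4.
    rewrite natrX; set a : R := k.+1%:R; have a0 : 0 < a by rewrite ltr0n.
    have a2 : 0 < a ^+ 2 by rewrite exprn_gt0.
    move=> /(ler_wpM2l (ltW a2)); move=> /le_trans; apply.
    rewrite le_eqVlt; apply/orP; left; apply/eqP; field.
    by rewrite gt_eqF.
apply: filterS => x cY.
have /cvg_ex[l cl] : cvgn (fun k => event_avg (k.+1 ^ 4) x).
  exact: cvg_of_summable_sqr.
apply/cvg_ex; exists l.
apply: (@cvg_of_slow_subseq _ _ m%:R) => // n n' nn'; exact: event_avg_slow.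
Qed.

(** When c is the square of the probability q of a single event, the averages
    have variance of order 1/n. *)
Lemma event_avg_cvg_to q : c = q ^+ 2 ->
    (forall s, size s = m -> uniq (s ++ r) -> L (Z s) = q%:E) ->
    0 <= q <= 1 ->
  {ae L, forall x, event_avg n x @[n --> \oo] --> q}.
Proof.
move=> cq Lq q01.
have mean1 n : (0 < n)%N -> `|mean L (event_avg n) - q| <= K / n%:R.
  move=> n0; rewrite mean_avgs//.
  apply: (@le_trans _ _ ((size (nseq m n) * (size (nseq m n) + size r))%:R / n%:R)).
    apply: avgs_uniq => //.
    - by rewrite all_nseq leqnn orbT.
    - move=> s _; rewrite mean_indic//; have := fine_prob01 L (mZ s).
      by case/andP: q01 => ? ? /andP[? ?]; rewrite ler_norml; apply/andP; split; lra.
    - by move=> s; rewrite size_nseq => ss us; rewrite mean_indic// Lq.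
  by rewrite ler_wpM2r ?invr_ge0// ler_nat size_nseq leq_mul// ?leq_add2r leq_addr.
pose Y k x := (event_avg (k.+1 ^ 4) x - q) ^+ 2.
have bA := bounded_event_avg.
have : {ae L, forall x, cvgn (series (Y ^~ x))}.
  apply: (@ae_summable _ _ _ _ _ (3 * K)).
  - by move=> k; apply: bounded_mfunM; apply: bounded_mfunB => //;
      exact: bounded_mfun_cst.
  - by move=> k x; rewrite sqr_ge0.
  - move=> k; set n := (k.+1 ^ 4)%N; have n0 : (0 < n)%N by rewrite expn_gt0.
    have bAA : bounded_mfun (fun x => event_avg n x * event_avg n x) by exact: bounded_mfunM.
    have -> : Y k = (fun x => (event_avg n x * event_avg n x - (2 * q) * event_avg n x) + q ^+ 2).
      by apply/funext => x; rewrite /Y -/n; ring.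
    rewrite meanD ?meanB ?meanZ ?mean_cst//; try exact: bounded_mfunZ; try exact: bounded_mfun_cst; last first.
      by apply: bounded_mfunB => //; exact: bounded_mfunZ.
    have := event_avg_cov n0 (leqnn _) (leqnn _); have := mean1 _ n0.
    rewrite !ler_norml cq => /andP[h1 h2] /andP[h3 h4].
    have K0 : 0 <= K / n%:R by rewrite divr_ge0.
    apply: (@le_trans _ _ (3 * (K / n%:R))).
      by case/andP: q01 => ? ?; nra.
    rewrite -mulrA ler_wpM2l// ler_wpM2l ?ler0n// lef_pV2 ?posrE ?exprn_gt0 ?ltr0n//.
    by rewrite -natrX ler_nat leq_pexp2l.
apply: filterS => x cY.
apply: (@cvg_of_slow_subseq _ _ m%:R) => //.
  by move=> n n' nn'; exact: event_avg_slow.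
exact: cvg_to_of_summable_sqr.
Qed.

End averaged_events.

(** * Connectivity in infinite graphs *)

Section connectivity.
Implicit Types (g : ngraph) (i j k : nat).

Lemma ngraph_eq g g' : (forall i j, nadj g i j = nadj g' i j) -> g = g'.
Proof.
case: g g' => [a s r] [a' s' r'] /= e.
have ee : a = a' by apply/funext => i; apply/funext => j.
by subst a'; congr NGraph; exact: Prop_irrelevance.
Qed.

Definition conn g i : set nat := component_of g i.

Lemma conn_refl g i : conn g i i. Proof. by exists [::]. Qed.

Lemma conn_trans g i j k : conn g i j -> conn g j k -> conn g i k.
Proof.
move=> [p [pp pl]] [p' [pp' pl']]; exists (p ++ p').
by rewrite cat_path pp last_cat pl.
Qed.

Lemma conn_edge g i j : nadj g i j -> conn g i j.
Proof. by move=> ij; exists [:: j]; rewrite /= ij. Qed.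

Lemma conn_sym g i j : conn g i j -> conn g j i.
Proof.
move=> [p [+ <-]]; elim: p i => [|k p IH] i /=; first by move=> _; exact: conn_refl.
move=> /andP[ik /IH kp]; apply: conn_trans kp _.
by apply: conn_edge; rewrite nadj_sym.
Qed.

Lemma conn_pull s g i j : conn (pull s g) i j -> conn g (s i) (s j).
Proof.
move=> [p [+ <-]]; elim: p i => [|k p IH] i /=; first by move=> _; exact: conn_refl.
by move=> /andP[ik /IH]; apply: conn_trans; exact: conn_edge.
Qed.

Lemma pullK s t g : cancel s t -> pull s (pull t g) = g.
Proof. by move=> st; apply: ngraph_eq => i j; rewrite /pull /= /pull_adj /= /pull_adj !st. Qed.

Lemma conn_pullE s t g i j : cancel s t -> cancel t s ->
  conn (pull s g) i j <-> conn g (s i) (s j).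
Proof.
move=> st ts; split; first exact: conn_pull.
rewrite -{1}(pullK g ts) => /conn_pull.
by rewrite !st.
Qed.

Definition nonisolated g i := exists j, nadj g i j.

Lemma nonisolatedP g i : nonisolated g i <-> exists2 j, j != i & conn g i j.
Proof.
split=> [[j ij]|[j ji [[|k p] [+ pl]]]].
- exists j; last exact: conn_edge.
  by apply: contraTneq ij => ->; rewrite nadj_irr.
- by move: ji; rewrite -pl eqxx.
- by move=> /= /andP[ik _]; exists k.
Qed.

Lemma measurable_path i p : measurable [set g : ngraph | path (iadj g) i p].
Proof.
elim: p i => [|j p IH] i /=.
  by rewrite (_ : [set _ | _] = setT)//; apply/seteqP; split.
rewrite (_ : [set _ | _] = [set g : ngraph | nadj g i j] `&`
    [set g : ngraph | path (iadj g) j p]).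
  by apply: measurableI => //; exact: measurable_edge.
by apply/seteqP; split => g /=; [move/andP|move=> [-> ->]].
Qed.

Lemma measurable_ex_count (I : countType) d (T : measurableType d) (A : I -> set T) :
  (forall u, measurable (A u)) -> measurable [set x | exists u, A u x].
Proof.
move=> mA; rewrite (_ : [set _ | _] =
  \bigcup_n (if @unpickle I n is Some u then A u else set0)).
  by apply: bigcupT_measurable => n; case: unpickle.
apply/seteqP; split=> [x [u Aix]|x [n _]].
  by exists (pickle u) => //; rewrite pickleK.
by case: unpickle => // u Aix; exists u.
Qed.

Lemma measurable_all_count (I : countType) d (T : measurableType d) (A : I -> set T) :
  (forall u, measurable (A u)) -> measurable [set x | forall u, A u x].
Proof.
move=> mA; rewrite (_ : [set _ | _] = ~` [set x | exists u, (~` A u) x]).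
  by apply/measurableC/measurable_ex_count => u; exact: measurableC.
apply/seteqP; split=> [x Ax [u]|x nA u]; first exact.
by apply: contrapT => nAi; apply: nA; exists u.
Qed.

Lemma measurable_imply d (T : measurableType d) (P : Prop) (A : set T) :
  measurable A -> measurable [set x | P -> A x].
Proof.
move=> mA; have [p|np] := pselect P.
  by rewrite (_ : [set _ | _] = A)//; apply/seteqP; split => x /=; [apply|].
by rewrite (_ : [set _ | _] = setT)//; apply/seteqP; split => // x _ /np.
Qed.

Lemma measurable_conn i j : measurable [set g : ngraph | conn g i j].
Proof.
apply: (@measurable_ex_count (seq nat) _ ngraph
  (fun p => [set g : ngraph | path (iadj g) i p /\ last i p = j])) => p.
have [pl|npl] := pselect (last i p = j).
  rewrite (_ : [set _ | _] = [set g : ngraph | path (iadj g) i p]); first exact: measurable_path.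
  by apply/seteqP; split => g /= [].
by rewrite (_ : [set _ | _] = set0)//; apply/seteqP; split => g //= [].
Qed.

Lemma measurable_nonisolated i : measurable [set g : ngraph | nonisolated g i].
Proof.
by apply: (@measurable_ex_count nat _ ngraph (fun j => [set g | nadj g i j])) => j;
  exact: measurable_edge.
Qed.

End connectivity.

Section permutations.

Definition swap (a b x : nat) : nat := if x == a then b else if x == b then a else x.

Lemma swapK a b : involutive (swap a b).
Proof.
move=> x; rewrite /swap; have [->|xa] := eqVneq x a.
  by have [//|_] := eqVneq b a; rewrite eqxx.
have [->|xb] := eqVneq x b; first by rewrite eqxx.
by rewrite (negbTE xa) (negbTE xb).
Qed.

Lemma swap_out a b x : x != a -> x != b -> swap a b x = x.
Proof. by rewrite /swap => /negbTE -> /negbTE ->. Qed.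

(** A composition of transpositions, one for each entry. *)
Lemma perm_of_uniq (s t : seq nat) : uniq s -> uniq t -> size s = size t ->
  exists f f', [/\ cancel f f', cancel f' f & map f s = t].
Proof.
elim: s t => [|x s IH] [|y t] //=.
  by move=> _ _ _; exists id, id.
move=> /andP[xs us] /andP[yt ut] [st].
have [f [f' [ff' f'f fst]]] := IH _ us ut st.
pose h := swap (f x) y.
exists (h \o f), (f' \o h); split.
- by move=> u; rewrite /h /= swapK ff'.
- by move=> u; rewrite /h /= f'f swapK.
- rewrite /h /= {1}/swap eqxx; congr (_ :: _); rewrite -fst.
  apply/eq_in_map => u us' /=; apply: swap_out.
    by apply: contraNneq xs => /(can_inj ff') <-.
  by apply: contraNneq yt => <-; rewrite -fst map_f.
Qed.

End permutations.

(** * Equivariant events *)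

Section graph_events.
Implicit Types (g : ngraph) (e : seq (nat * nat)) (l s : seq nat).

(** The edges e join positions in the list s, not vertices. *)
Definition sees e s : set ngraph :=
  [set g | all (fun p => [&& (p.1 < size s)%N, (p.2 < size s)%N &
                            nadj g (nth 0%N s p.1) (nth 0%N s p.2)]) e].

(** The sign b selects the component of i or its complement. *)
Definition rooted (i : nat) (b : bool) e s : set ngraph :=
  [set g | sees e s g /\ forall x, x \in s -> (conn g i x <-> b)].

Definition joined e s : set ngraph :=
  [set g | sees e s g /\ forall x y, x \in s -> y \in s -> conn g x y].

Definition noniso s : set ngraph := [set g | nonisolated g (nth 0%N s 0)].

Definition touching (J : nat) s : set ngraph :=
  [set g | exists i, (i < J)%N /\ conn g i (nth 0%N s 0)].

Lemma measurable_sees e s : measurable (sees e s).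
Proof.
elim: e => [|p e IH].
  by rewrite (_ : sees _ _ = setT)//; apply/seteqP; split.
have -> : sees (p :: e) s = [set g | (p.1 < size s)%N -> (p.2 < size s)%N ->
      nadj g (nth 0%N s p.1) (nth 0%N s p.2)] `&`
    (if (p.1 < size s)%N && (p.2 < size s)%N then sees e s else set0).
  apply/seteqP; split => g; rewrite /sees /=.
    by move=> /andP[/and3P[h1 h2 h3] h4]; rewrite h1 h2; split.
  case: ifP => [/andP[h1 h2] [h h4]|_ []//].
  by rewrite h1 h2 h//; exact: h4.
apply: measurableI; last by case: ifP.
by apply: measurable_imply; apply: measurable_imply; exact: measurable_edge.
Qed.

Lemma measurable_iff d (T : measurableType d) (A : set T) (b : bool) :
  measurable A -> measurable [set x | A x <-> b].
Proof.
move=> mA; case: b.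
  by rewrite (_ : [set _ | _] = A)//; apply/seteqP; split => x /=; [move=> [_ h]; exact: h|].
rewrite (_ : [set _ | _] = ~` A); first exact: measurableC.
by apply/seteqP; split => x /=; [move=> [nA _] /nA|move=> nA; split].
Qed.

Lemma measurable_rooted i b e s : measurable (rooted i b e s).
Proof.
apply: (measurableI (sees e s)); first exact: measurable_sees.
apply: (@measurable_all_count nat _ ngraph
  (fun x => [set g | x \in s -> (conn g i x <-> b)])) => x.
by apply/measurable_imply/measurable_iff; exact: measurable_conn.
Qed.

Lemma measurable_joined e s : measurable (joined e s).
Proof.
apply: (measurableI (sees e s)); first exact: measurable_sees.
apply: (@measurable_all_count nat _ ngraph
  (fun x => [set g | forall y, x \in s -> y \in s -> conn g x y])) => x.
apply: (@measurable_all_count nat _ ngraph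
  (fun y => [set g | x \in s -> y \in s -> conn g x y])) => y.
by do 2 apply: measurable_imply; exact: measurable_conn.
Qed.

Lemma measurable_noniso s : measurable (noniso s).
Proof. exact: measurable_nonisolated. Qed.

Lemma measurable_touching J s : measurable (touching J s).
Proof.
apply: (@measurable_ex_count nat _ ngraph
  (fun i => [set g | (i < J)%N /\ conn g i (nth 0%N s 0)])) => i.
have [iJ|iJ] := boolP (i < J)%N.
  rewrite (_ : [set _ | _] = [set g : ngraph | conn g i (nth 0%N s 0)]).
    exact: measurable_conn.
  by apply/seteqP; split => [g /= []|g /=].
by rewrite (_ : [set _ | _] = set0)//; apply/seteqP; split => g //= [].
Qed.

(** Equivariance under the permutations of the vertices that fix the roots r. *)
Definition natural (m : nat) (r : seq nat) (Z : seq nat -> set ngraph) :=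
  forall (f f' : nat -> nat) l g, cancel f f' -> cancel f' f -> map f r = r ->
    size l = m -> (Z l (pull f g) <-> Z (map f l) g).

(** Some permutation that fixes r maps one pair of lists to the other, and L is
    exchangeable. *)
Lemma natural_setI_eq (R : realType) (L : probability ngraph R) Gam m r Z s1 s2 t1 t2 :
    samples L Gam -> natural m r Z -> (forall s, measurable (Z s)) ->
    size s1 = m -> size s2 = m -> size t1 = m -> size t2 = m ->
    uniq (s1 ++ s2 ++ r) -> uniq (t1 ++ t2 ++ r) ->
  L (Z s1 `&` Z s2) = L (Z t1 `&` Z t2).
Proof.
move=> LG nZ mZ ss1 ss2 st1 st2 us ut.
have [|f [f' [ff' f'f]]] := perm_of_uniq us ut; first by rewrite !size_cat ss1 ss2 st1 st2.
rewrite !map_cat => /eqP; rewrite eqseq_cat; last by rewrite size_map ss1.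
rewrite eqseq_cat; last by rewrite size_map ss2.
case/and3P => /eqP e1 /eqP e2 /eqP er.
rewrite -(samples_pull LG (can_inj ff') (measurableI _ _ (mZ s1) (mZ s2))).
congr (L _); rewrite -e1 -e2; apply/seteqP.
by split => g /= -[h1 h2]; split; apply/(nZ f f').
Qed.

Lemma natural_eq (R : realType) (L : probability ngraph R) Gam m r Z s t :
    samples L Gam -> natural m r Z -> (forall s, measurable (Z s)) ->
    size s = m -> size t = m -> uniq (s ++ r) -> uniq (t ++ r) ->
  L (Z s) = L (Z t).
Proof.
move=> LG nZ mZ ss st us ut.
have [|f [f' [ff' f'f]]] := perm_of_uniq us ut; first by rewrite !size_cat ss st.
rewrite !map_cat => /eqP; rewrite eqseq_cat; last by rewrite size_map ss.
case/andP => /eqP e1 /eqP er.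
rewrite -(samples_pull LG (can_inj ff') (mZ s)).
by congr (L _); rewrite -e1; apply/seteqP; split => g h; apply/(nZ f f').
Qed.

Lemma sees_pull e s f g : sees e s (pull f g) <-> sees e (map f s) g.
Proof.
rewrite /sees /= size_map; split => /allP h; apply/allP => p /h /and3P[p1 p2].
  by rewrite p1 p2 !(nth_map 0%N).
by rewrite p1 p2 !(nth_map 0%N).
Qed.

Lemma natural_rooted m i b e : natural m [:: i] (rooted i b e).
Proof.
move=> f f' l g ff' f'f [fi] _; split=> -[sg h]; split; try exact/sees_pull.
  move=> x /mapP[y yl ->]; rewrite -{1}fi -(conn_pullE _ _ _ ff' f'f); exact: h.
by move=> x xl; rewrite (conn_pullE _ _ _ ff' f'f) fi; apply: h; exact: map_f.
Qed.

Lemma natural_joined m e : natural m [::] (joined e).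
Proof.
move=> f f' l g ff' f'f _ _; split=> -[sg h]; split; try exact/sees_pull.
  move=> x y /mapP[x' xl ->] /mapP[y' yl ->]; rewrite -(conn_pullE _ _ _ ff' f'f).
  exact: h.
by move=> x y xl yl; rewrite (conn_pullE _ _ _ ff' f'f); apply: h; exact: map_f.
Qed.

Lemma natural_noniso : natural 1 [::] noniso.
Proof.
move=> f f' [|a []]// g ff' f'f _ _; split=> -[j]; rewrite /= => aj.
  by exists (f j).
by exists (f' j); rewrite /= /pull_adj f'f.
Qed.

Lemma map_fix_in (f : nat -> nat) s x : map f s = s -> x \in s -> f x = x.
Proof.
move=> fs xs; have : nth 0%N (map f s) (index x s) = f x.
  by rewrite (nth_map 0%N) ?index_mem// nth_index.
by rewrite fs nth_index.
Qed.

Lemma natural_touching J : natural 1 (iota 0 J) (touching J).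
Proof.
move=> f f' [|a []]// g ff' f'f fJ _.
have fi i : (i < J)%N -> f i = i.
  by move=> iJ; apply: (map_fix_in fJ); rewrite mem_iota.
split=> -[i [iJ]] /=.
  by rewrite (conn_pullE _ _ _ ff' f'f) fi// => ci; exists i.
by move=> ci; exists i; split => //=; rewrite (conn_pullE _ _ _ ff' f'f) fi.
Qed.

Lemma setI_null_eq d (T : measurableType d) (R : realType) (L : probability T R)
    (A B C D : set T) :
    measurable A -> measurable B -> measurable C -> measurable D ->
    A `<=` B -> C `<=` D -> L A = L B -> L C = L D ->
  L (A `&` C) = L (B `&` D).
Proof.
move=> mA mB mC mD AB CD LAB LCD.
have null X Y : measurable X -> measurable Y -> X `<=` Y -> L X = L Y -> L (Y `\` X) = 0%E.
  move=> mX mY XY LXY; rewrite measureD//; last by rewrite (le_lt_trans (probability_le1 _ mY))// ltry.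
  by rewrite setIidr//= LXY subee// fin_num_measure.
apply/eqP; rewrite eq_le; apply/andP; split.
  by apply: le_measure; rewrite ?inE; [exact: measurableI|exact: measurableI|exact: setISS].
have sub : B `&` D `<=` (A `&` C) `|` ((B `\` A) `|` (D `\` C)).
  move=> x [Bx Dx]; have [Ax|nAx] := pselect (A x); last by right; left.
  by have [Cx|nCx] := pselect (C x); [left|right; right].
apply: (@le_trans _ _ (L ((A `&` C) `|` ((B `\` A) `|` (D `\` C))))).
  apply: le_measure; rewrite ?inE//; first exact: measurableI.
  by apply: measurableU; [exact: measurableI|apply: measurableU; exact: measurableD].
have mBA : measurable (B `\` A) by exact: measurableD.
have mDC : measurable (D `\` C) by exact: measurableD.
apply: (le_trans (measureU2 _ (measurableI _ _ mA mC) (measurableU _ _ mBA mDC))).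
rewrite -[leRHS]adde0 leeD2l//.
apply: (le_trans (measureU2 _ mBA mDC)).
by rewrite /= !null// adde0.
Qed.

(** Up to null sets, events that can only be gained by adding vertices are decided
    inside any infinite set of vertices, here inside two disjoint ones. *)
Lemma monotone_indep (R : realType) (L : probability ngraph R) Gam m Z :
    samples L Gam -> natural m [::] Z -> (forall s, measurable (Z s)) ->
    (forall f l g, injective f -> size l = m -> Z l (pull f g) -> Z (map f l) g) ->
  forall s1 s2, size s1 = m -> size s2 = m -> uniq (s1 ++ s2) ->
  L (Z s1 `&` Z s2) = (L (Z (iota 0 m)) * L (Z (iota 0 m)))%E.
Proof.
move=> LG nZ mZ monZ s1 s2 ss1 ss2 us.
(* the vertices of s1 and s2 are moved into the even and the odd numbers *)
pose f1 i := i.*2; pose f2 i := i.*2.+1.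
have inj1 : injective f1 by move=> i j; rewrite /f1; lia.
have inj2 : injective f2 by move=> i j; rewrite /f2; lia.
have dis i j : f1 i != f2 j by rewrite /f1 /f2; lia.
pose t := iota 0 m; have st : size t = m by rewrite size_iota.
have ut : uniq (map f1 t ++ map f2 t ++ [::]).
  rewrite cats0 cat_uniq !map_inj_uniq// iota_uniq /= andbT.
  apply/hasPn => _ /mapP[j _ ->]; apply/mapP => -[i _ /eqP].
  by rewrite eq_sym (negbTE (dis _ _)).
rewrite (natural_setI_eq (t1 := map f1 t) (t2 := map f2 t) LG nZ)//; rewrite ?cats0 ?size_map//.
have mp f X : measurable X -> measurable (pull f @^-1` X).
  by move=> mX; rewrite -[X in measurable X]setTI; exact: measurable_pull.
rewrite -(samples_indep LG inj1 inj2 dis (mZ t) (mZ t)).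
have ut1 : uniq (map f1 t) by rewrite map_inj_uniq// iota_uniq.
have ut2 : uniq (map f2 t) by rewrite map_inj_uniq// iota_uniq.
have sub f : injective f -> pull f @^-1` Z t `<=` Z (map f t).
  by move=> inj_f g; exact: monZ.
have eqL f : injective f -> L (pull f @^-1` Z t) = L (Z (map f t)).
  move=> inj_f; rewrite (samples_pull LG)//.
  by apply: (natural_eq LG nZ); rewrite ?size_map ?cats0 ?map_inj_uniq ?iota_uniq.
by apply/esym; apply: setI_null_eq; try exact: mp; try exact: mZ; try exact: sub; try exact: eqL.
Qed.

Lemma joined_mono m e f l g : injective f -> size l = m ->
  joined e l (pull f g) -> joined e (map f l) g.
Proof.
move=> inj_f _ [/sees_pull sg h]; split=> // x y /mapP[x' xl ->] /mapP[y' yl ->].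
by apply: conn_pull; exact: h.
Qed.

Lemma noniso_mono f l g : injective f -> size l = 1%N ->
  noniso l (pull f g) -> noniso (map f l) g.
Proof.
by case: l => [|a []]//= _ _ [j aj]; exists (f j).
Qed.

End graph_events.

(** * Almost sure convergence of averages of equivariant events *)

Section almost_everywhere_tools.
Context d (T : measurableType d) (R : realType) (L : probability T R).

Lemma ae_all_count (I : countType) (P : I -> T -> Prop) :
  (forall u, {ae L, forall x, P u x}) -> {ae L, forall x, forall u, P u x}.
Proof.
move=> aeP.
pose Q n x := if @unpickle I n is Some u then P u x else True.
have aeQ n : {ae L, forall x, Q n x}.
  by rewrite /Q; case: unpickle => [u|]; [exact: aeP|exact: aeW].
have [N [mN N0 sub]] := ae_foralln aeQ.
exists N; split=> // x nP; apply: sub => allP; apply: nP => u.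
by have := allP (pickle u); rewrite /Q pickleK.
Qed.

Lemma negligible_small (A : set T) : (forall e, 0 < e ->
    exists2 B, measurable B /\ A `<=` B & (L B <= e%:E)%E) ->
  L.-negligible A.
Proof.
move=> hA.
have h n : exists B, [/\ measurable B, A `<=` B & (L B <= (n.+1%:R^-1)%:E)%E].
  by have [|B [mB AB] LB] := hA (n.+1%:R^-1); [rewrite invr_gt0|exists B].
have [B hB] := choice h.
exists (\bigcap_n B n); split.
- by apply: bigcapT_measurable => n; have [] := hB n.
- apply/eqP; rewrite -measure_le0; apply/lee_addgt0Pr => e e0.
  rewrite add0e.
  have [n ne] : exists n, n.+1%:R^-1 < e by exists (Num.truncn e^-1);
    rewrite invf_plt ?posrE//; exact: truncnS_gt.
  have [mB _ LB] := hB n.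
  apply: (@le_trans _ _ (L (B n))).
    apply: le_measure; rewrite ?inE//; first by apply: bigcapT_measurable => k; have [] := hB k.
    exact: bigcap_inf.
  by apply: le_trans LB _; rewrite lee_fin ltW.
- by move=> x Ax n _; have [_ + _] := hB n; apply.
Qed.

Lemma measure_liminf_le (W : nat -> set T) (n1 : nat) (a : R) :
    (forall n, measurable (W n)) -> (forall n, (n1 <= n)%N -> (L (W n) <= a%:E)%E) ->
  (L (\bigcup_k \bigcap_(n in [set n | (k <= n)%N]) W n) <= a%:E)%E.
Proof.
move=> mW LW.
pose V k := \bigcap_(n in [set n | (k <= n)%N]) W n.
have mV k : measurable (V k) by apply: bigcap_measurable; [exists k => /=|move=> n _; exact: mW].
have ndV : nondecreasing_seq V.
  move=> k k' kk'; apply/subsetPset => x Vx n /= k'n; apply: Vx => /=.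
  exact: leq_trans k'n.
have cV : L \o V @ \oo --> L (\bigcup_n V n).
  by apply: nondecreasing_cvg_mu => //; exact: bigcupT_measurable.
rewrite -/V -(cvg_lim _ cV)//; apply: lime_le; first by apply/cvg_ex; eexists; exact: cV.
apply: nearW => k; apply: (@le_trans _ _ (L (W (maxn k n1)))).
  by apply: le_measure; rewrite ?inE// => x; apply => /=; exact: leq_maxl.
by apply: LW; exact: leq_maxr.
Qed.

Lemma markov_mean (X : T -> R) (e : R) : bounded_mfun X -> (forall x, 0 <= X x) ->
  0 < e -> (L [set x | (e < X x)%R] <= (mean L X / e)%:E)%E.
Proof.
move=> bX X0 e0.
have mA : measurable [set x | (e < X x)%R].
  have [mX _] := bX; rewrite -[X in measurable X]setTI.
  by apply: measurable_fun_ltr => //; exact: measurable_cst.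
rewrite -[leLHS]fineK ?fin_num_measure// lee_fin ler_pdivlMr// mulrC.
rewrite -mean_indic// -meanZ; last exact: bounded_mfun_indic.
apply: mean_le => //; first by apply: bounded_mfunZ; exact: bounded_mfun_indic.
move=> x; rewrite indicE; case: (boolP (x \in _)); last by rewrite mulr0.
by rewrite inE /= mulr1 => /ltW.
Qed.

End almost_everywhere_tools.

Section natural_averages.
Context (R : realType) (L : probability ngraph R) (Gam : graph_limit R).
Hypothesis LG : samples L Gam.

Lemma ex_uniq_lists (m : nat) (r : seq nat) : uniq r ->
  exists s1 s2, [/\ size s1 = m, size s2 = m & uniq (s1 ++ s2 ++ r)].
Proof.
move=> ur; pose N := (\max_(x <- r) x).+1.
have rN x : x \in r -> (x < N)%N.
  by move=> xr; rewrite /N ltnS (big_rem x)//= leq_maxl.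
exists (iota N m), (iota (N + m) m); rewrite !size_iota; split=> //.
rewrite catA -iotaD cat_uniq iota_uniq ur andbT /=.
by apply/hasPn => x /rN xN; rewrite /= mem_iota leqNgt xN.
Qed.

Lemma natural_avg_cvg m r Z : uniq r -> natural m r Z -> (forall s, measurable (Z s)) ->
  {ae L, forall g, cvgn (event_avg R Z m ^~ g)}.
Proof.
move=> ur nZ mZ; have [t1 [t2 [st1 st2 ut]]] := ex_uniq_lists m ur.
apply: (event_avg_cvg (r := r) (c := fine (L (Z t1 `&` Z t2)))) => //.
  by apply: fine_prob01; exact: measurableI.
move=> s1 s2 ss1 ss2 us; rewrite fineK ?fin_num_measure//; last exact: measurableI.
exact: (natural_setI_eq LG nZ).
Qed.

(** By independence the probability that two disjoint lists both satisfy the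
    event is a square, so the averages converge to a constant. *)
Lemma monotone_avg_cvg m Z : natural m [::] Z -> (forall s, measurable (Z s)) ->
    (forall f l g, injective f -> size l = m -> Z l (pull f g) -> Z (map f l) g) ->
  {ae L, forall g, event_avg R Z m n g @[n --> \oo] --> fine (L (Z (iota 0 m)))}.
Proof.
move=> nZ mZ monZ; set q := fine _.
have Lq : L (Z (iota 0 m)) = q%:E by rewrite fineK// fin_num_measure.
have q01 : 0 <= q <= 1 by exact: fine_prob01.
apply: (event_avg_cvg_to (r := [::]) (c := q ^+ 2)) => //.
- by case/andP: q01 => q0 q1; rewrite sqr_ge0 expr_le1.
- move=> s1 s2 ss1 ss2; rewrite cats0 => us.
  by rewrite (monotone_indep LG nZ)// Lq -EFinM -expr2.
- move=> s ss us; rewrite -Lq; apply: (natural_eq LG nZ) => //.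
    by rewrite size_iota.
  by rewrite cats0 iota_uniq.
Qed.

Definition far (J : nat) s : set ngraph := noniso s `\` touching J s.

Lemma measurable_far J s : measurable (far J s).
Proof. by apply: measurableD; [exact: measurable_noniso|exact: measurable_touching]. Qed.

Lemma natural_far J : natural 1 (iota 0 J) (far J).
Proof.
move=> f f' l g ff' f'f fJ sl.
have h1 := natural_noniso g ff' f'f erefl sl.
have h2 := natural_touching g ff' f'f fJ sl.
by split=> -[/h1 n1 n2]; split=> // /h2.
Qed.

(** After a relabelling of J as 0, these events decrease to the impossible event
    that 0 has a neighbour but is connected to no other vertex. *)
Lemma far_null : fine (L (far J [:: J])) @[J --> \oo] --> 0.
Proof.
pose B J : set ngraph := [set g | nonisolated g 0 /\
  forall i, (i < J)%N -> ~ conn g i.+1 0].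
have mB J : measurable (B J).
  apply: (measurableI [set g : ngraph | nonisolated g 0]); first exact: measurable_nonisolated.
  apply: (@measurable_all_count nat _ ngraph (fun i => [set g | (i < J)%N -> ~ conn g i.+1 0])) => i.
  by apply: measurable_imply; apply: measurableC; exact: measurable_conn.
have BE J : L (far J [:: J]) = L (B J).
  have us : uniq (J :: iota 0 J) by rewrite /= iota_uniq mem_iota ltnn andbF.
  have ut : uniq (0%N :: iota 1 J) by rewrite /= iota_uniq mem_iota.
  have [|f [f' [ff' f'f /= [fJ fi]]]] := perm_of_uniq us ut; first by rewrite /= !size_iota.
  rewrite -(samples_pull LG (can_inj ff') (measurable_far J [:: J])).
  have fiE i : (i < J)%N -> f i = i.+1.
    move=> iJ; have : nth 0%N (map f (iota 0 J)) i = nth 0%N (iota 1 J) i by rewrite fi.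
    by rewrite (nth_map 0%N) ?size_iota// !nth_iota.
  congr (L _); apply/seteqP; split => g; rewrite /preimage /= /far /noniso /touching /=.
    move=> [/= [j Jj] nt]; split; first by exists (f j); rewrite -fJ.
    move=> i iJ ci; apply: nt; exists i; split => //.
    by apply/(conn_pullE _ _ _ ff' f'f); rewrite fiE// fJ.
  move=> [[j j0] nt]; split; first by exists (f' j); rewrite /= /pull_adj f'f fJ.
  by move=> [i [iJ /conn_pull]]; rewrite fiE// fJ; exact: nt.
have cvB : L \o B @ \oo --> L (\bigcap_n B n).
  apply: nonincreasing_cvg_mu => //.
  - by rewrite (le_lt_trans (probability_le1 _ _)) ?ltry.
  - exact: bigcapT_measurable.
  - move=> J J' JJ'; apply/subsetPset => g [ng h]; split=> // i iJ.
    by apply: h; exact: leq_trans JJ'.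
have B0 : \bigcap_n B n = set0.
  apply/seteqP; split=> // g Bg.
  have [/nonisolatedP[j j0 cj] _] := Bg 0%N I.
  have [_ h] := Bg j I.
  have jj : (j.-1 < j)%N by rewrite ltn_predL lt0n.
  by apply: (h _ jj); rewrite prednK ?lt0n//; exact: conn_sym.
rewrite B0 measure0 in cvB.
apply: (@fine_cvg R _ _ _ _ 0).
by apply: cvg_trans cvB; apply: near_eq_cvg; apply: nearW => J /=; rewrite BE.
Qed.

End natural_averages.

(** * Typical graphs *)

Section typical_graph.
Context (R : realType) (L : probability ngraph R) (Gam : graph_limit R).
Hypothesis LG : samples L Gam.

(** The proportion of far vertices has small mean for large J, uniformly in
    large n; by Markov's inequality it is unlikely to be large for all large n.
    *)
Lemma ae_far_small : {ae L, forall g, forall k, exists J, forall n0, exists n,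
  (n0 <= n)%N /\ event_avg R (far J) 1 n g <= k.+1%:R^-1}.
Proof.
apply: ae_all_count => k.
set a : R := k.+1%:R^-1.
have a0 : 0 < a by rewrite invr_gt0.
apply: negligible_small => e e0.
have ea0 : 0 < e * a / 2 by rewrite divr_gt0// mulr_gt0.
have [J cJ] : exists J, fine (L (far J [:: J])) <= e * a / 2.
  have /cvgrPdist_le/(_ _ ea0)[J _ /(_ J)] := far_null LG.
  rewrite /= sub0r normrN => h; exists J.
  by apply: le_trans (h _); [exact: ler_norm|rewrite leqnn].
pose c : R := fine (L (far J [:: J])).
pose X n : ngraph -> R := event_avg R (far J) 1 n.
have bX n : bounded_mfun (X n).
  by apply: bounded_event_avg => s; exact: measurable_far.
have X0 n g : 0 <= X n g.
  by apply: avgs_ge0 => s _; rewrite indicE.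
have meanX n : (0 < n)%N -> mean L (X n) <= c + (1 * (1 + J))%:R / n%:R.
  move=> n0; rewrite addrC -lerBlDr.
  apply: le_trans (ler_norm _) _.
  rewrite /X /event_avg mean_avgs; last first.
    by move=> s; apply: bounded_mfun_indic; exact: measurable_far.
  have -> : (1 * (1 + J))%:R = (size (nseq 1 n) * (size (nseq 1 n) + size (iota 0 J)))%:R :> R.
    by rewrite size_iota.
  apply: avgs_uniq => //=.
  - by rewrite leqnn.
  - move=> s _; rewrite mean_indic; last exact: measurable_far.
    have := fine_prob01 L (measurable_far J s); have := fine_prob01 L (measurable_far J [:: J]).
    by rewrite -/c => /andP[? ?] /andP[? ?]; rewrite ler_norml; apply/andP; split; lra.
  - exact: iota_uniq.
  - move=> s ss us; rewrite mean_indic; last exact: measurable_far.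
    rewrite /c; congr fine; apply: (natural_eq LG (@natural_far J)) => //.
    + by move=> ?; exact: measurable_far.
    + by rewrite /= mem_iota ltnn andbF iota_uniq.
pose W n := [set g | a < X n g].
have mW n : measurable (W n).
  have [mX _] := bX n; rewrite -[X in measurable X]setTI.
  by apply: measurable_fun_ltr => //; exact: measurable_cst.
pose n1 := (Num.truncn ((1 * (1 + J))%:R / (e * a / 2))).+1.
have LW n : (n1 <= n)%N -> (L (W n) <= e%:E)%E.
  move=> nn; apply: le_trans (markov_mean L (bX n) (X0 n) a0) _.
  rewrite lee_fin ler_pdivrMr//.
  have n0 : (0 < n)%N by exact: leq_trans nn.
  apply: le_trans (meanX _ n0) _.
  rewrite [leRHS](splitr (e * a)) lerD// ler_pdivrMr ?ltr0n// mulrC -ler_pdivrMr//.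
  by apply: le_trans (ltW (truncnS_gt _)) _; rewrite ler_nat.
exists (\bigcup_k \bigcap_(n in [set n | (k <= n)%N]) W n).
  split.
    apply: bigcupT_measurable => i; apply: bigcap_measurable => //.
    by exists i => /=.
  move=> g /= ng; apply: contrapT => ngW; apply: ng; exists J => n0.
  apply: contrapT => nn; apply: ngW; exists n0 => // n /= n0n.
  by rewrite /W /= ltNge; apply/negP => h; apply: nn; exists n.
exact: measure_liminf_le LW.
Qed.

Definition component_avg i : nat -> ngraph -> R := event_avg R (rooted i true [::]) 1.

Lemma component_avgE i n g : component_avg i n g =
  n%:R^-1 * \sum_(x <- iota 0 n) \1_[set g : ngraph | conn g i x] g.
Proof.
rewrite /component_avg /event_avg /=; congr (_ * _).
have -> : iota 0 n = index_iota 0 n by rewrite /index_iota subn0.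
rewrite big_mkord.
apply: eq_bigr => x _; rewrite !indicE; congr (_%:R); congr nat_of_bool.
apply/idP/idP; rewrite !inE /rooted /=.
  by move=> [_ h]; apply/(h x (mem_head _ _)).
by move=> cx; split=> // y; rewrite mem_seq1 => /eqP ->.
Qed.

Lemma component_avg_swap i a b n g : i != a -> i != b -> (a < n)%N -> (b < n)%N ->
  component_avg i n (pull (swap a b) g) = component_avg i n g.
Proof.
move=> ia ib an bn; rewrite !component_avgE; congr (_ * _).
have fi : swap a b i = i by exact: swap_out.
have -> : \sum_(x <- iota 0 n) \1_[set g : ngraph | conn g i x] (pull (swap a b) g) =
    \sum_(x <- map (swap a b) (iota 0 n)) \1_[set g : ngraph | conn g i x] g :> R.
  rewrite big_map; apply: eq_bigr => x _; rewrite !indicE; congr (_%:R); congr nat_of_bool.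
  have K := conn_pullE g i x (swapK a b) (swapK a b).
  by apply/idP/idP; rewrite !inE /=; rewrite fi in K; move/K.
apply: perm_big; apply: uniq_perm; rewrite ?map_inj_uniq ?iota_uniq//.
  exact: can_inj (swapK a b).
have sw x : (x < n)%N -> (swap a b x < n)%N.
  by rewrite /swap; case: ifP => // _; case: ifP.
move=> x; apply/mapP/idP => [[y + ->]|]; rewrite !mem_iota/= !add0n; first exact: sw.
by move=> xn; exists (swap a b x); rewrite ?swapK// mem_iota add0n sw.
Qed.

(** By exchangeability every vertex x <> i below n is as likely as j to lie in a
    component of i that has proportion at most e; such a component contains at
    most e n of these vertices. *)
Lemma small_component_le (i j n : nat) (e : R) : i != j -> (i < n)%N -> (j < n)%N -> (1 < n)%N ->
    0 < e ->
  (L ([set g : ngraph | conn g i j] `&` [set g | (component_avg i n g <= e)%R]) <= (2 * e)%:E)%E.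
Proof.
move=> ij ltin ltjn n1 e0.
have bX : bounded_mfun (component_avg i n).
  by apply: bounded_event_avg => s; exact: measurable_rooted.
have mS : measurable [set g | component_avg i n g <= e].
  have [mX _] := bX; rewrite -[X in measurable X]setTI.
  by apply: measurable_fun_ler => //; exact: measurable_cst.
pose A x := [set g : ngraph | conn g i x] `&` [set g | component_avg i n g <= e].
have mA x : measurable (A x) by apply: measurableI => //; exact: measurable_conn.
have LA x : (x < n)%N -> x != i -> L (A x) = L (A j).
  move=> xn xi; rewrite -(samples_pull LG (can_inj (swapK j x)) (mA x)).
  have fi : swap j x i = i by apply: swap_out => //; rewrite eq_sym.
  congr (L _); apply/seteqP; split=> g; rewrite /A /preimage /=;
    rewrite component_avg_swap// 1?eq_sym// => -[h1 h2]; split=> //.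
    by move: h1 => /conn_pull; rewrite fi /swap eqxx; case: eqP => // ->.
  apply/(conn_pullE _ _ _ (swapK j x) (swapK j x)); rewrite fi.
  by rewrite /swap eqxx; case: eqP => // ->.
have sumle : \sum_(x <- iota 0 n | x != i) mean L (\1_(A x)) <= n%:R * e.
  have -> : \sum_(x <- iota 0 n | x != i) mean L (\1_(A x)) =
     mean L (fun g => \sum_(x <- [seq x <- iota 0 n | x != i]) \1_(A x) g).
    rewrite mean_sum; first by rewrite big_filter.
    by move=> x; exact: bounded_mfun_indic.
  rewrite -[leRHS](@mean_cst _ _ _ L); apply: mean_le.
  - by apply: bounded_mfun_sum => x; exact: bounded_mfun_indic.
  - exact: bounded_mfun_cst.
  move=> g; have [small|large] := leP (component_avg i n g) e.
    apply: (@le_trans _ _ (n%:R * component_avg i n g)); last by rewrite ler_wpM2l.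
    rewrite component_avgE mulrA mulfV ?mul1r; last by rewrite pnatr_eq0; lia.
    rewrite big_filter big_mkcond/=; apply: ler_sum => x _.
    case: ifP => _; last by rewrite indicE.
    rewrite !indicE; case: (boolP (g \in A x)) => [|_]; last by rewrite ler0n.
    by rewrite inE => -[cx _]; rewrite mem_set.
  rewrite big1 ?mulr_ge0 ?(ltW e0)// => x _; rewrite indicE memNset//.
  by move=> [_ /=]; rewrite leNgt large.
rewrite -/(A j) -[L (A j)]fineK ?fin_num_measure// lee_fin.
have sumE : \sum_(x <- iota 0 n | x != i) mean L (\1_(A x)) = n%:R * fine (L (A j)) - fine (L (A j)).
  have := bigD1_seq i _ (iota_uniq 0 n) (F := fun=> fine (L (A j))) (x := 0) (op := +%R).
  rewrite mem_iota add0n ltin => /(_ isT).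
  have e1 : iota 0 n = index_iota 0 n by rewrite /index_iota subn0.
  rewrite {1}e1 sumr_const_nat subn0 -[_ *+ n]mulr_natl => ->.
  rewrite addrC addKr [LHS]big_seq_cond [RHS]big_seq_cond.
  apply: eq_bigr => x /andP[]; rewrite mem_iota add0n => xn xi.
  by rewrite mean_indic// LA.
move: sumle; rewrite sumE; have := fine_prob01 L (mA j); set l := fine _ => /andP[l0 l1].
have n2 : 2 <= n%:R :> R by rewrite ler_nat.
nra.
Qed.

End typical_graph.

Section typical.
Context (R : realType) (L : probability ngraph R) (Gam : graph_limit R).
Hypothesis LG : samples L Gam.

(** The bound of [small_component_le] is uniform in n, so with probability at
    least 1 - 2 a the component of i, when it contains j, does not remain of
    proportion at most a. *)
Lemma ae_component_density : {ae L, forall g, forall i j, i != j -> conn g i j ->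
  exists k, forall n0, exists n, (n0 <= n)%N /\ k.+1%:R^-1 < component_avg R i n g}.
Proof.
apply: ae_all_count => i; apply: ae_all_count => j.
have [->|ij] := eqVneq i j; first by apply: aeW.
apply: negligible_small => e e0.
have [k ke] : exists k, 2 * k.+1%:R^-1 <= e.
  exists (Num.truncn (2 / e)); rewrite ler_pdivrMr// mulrC -ler_pdivrMr//.
  exact/ltW/truncnS_gt.
set a : R := k.+1%:R^-1.
pose W n := [set g : ngraph | conn g i j] `&` [set g | component_avg R i n g <= a].
have mW n : measurable (W n).
  apply: measurableI; first exact: measurable_conn.
  have [mX _] : bounded_mfun (component_avg R i n).
    by apply: bounded_event_avg => s; exact: measurable_rooted.
  rewrite -[X in measurable X]setTI.
  by apply: measurable_fun_ler => //; exact: measurable_cst.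
have LW n : (maxn i j + 2 <= n)%N -> (L (W n) <= e%:E)%E.
  move=> nij; apply: (@le_trans _ _ (2 * a)%:E); last by rewrite lee_fin.
  by apply: (small_component_le LG ij); rewrite ?invr_gt0//; lia.
exists (\bigcup_k \bigcap_(n in [set n | (k <= n)%N]) W n).
  split.
    apply: bigcupT_measurable => l; apply: bigcap_measurable => //.
    by exists l => /=.
  move=> g /= ng; apply: contrapT => ngW; apply: ng => _ cij; exists k => n0.
  apply: contrapT => nn; apply: ngW; exists n0 => // n /= n0n.
  by split=> //=; rewrite leNgt; apply/negP => h; apply: nn; exists n.
exact: measure_liminf_le LW.
Qed.

Definition join_prob e m : R := fine (L (joined e (iota 0 m))).

Definition noniso_prob : R := fine (L (noniso [:: 0%N])).

(** The almost sure properties that determine the densities and the limits of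
    the components; from here on the arguments about a typical graph are
    deterministic. *)
Record typical (g : ngraph) : Prop := Typical {
  typical_rooted : forall i b e m, cvgn (event_avg R (rooted i b e) m ^~ g);
  typical_joined : forall e m,
    event_avg R (joined e) m n g @[n --> \oo] --> join_prob e m;
  typical_noniso : event_avg R noniso 1 n g @[n --> \oo] --> noniso_prob;
  typical_far : forall k, exists J, forall n0, exists n,
    (n0 <= n)%N /\ event_avg R (far J) 1 n g <= k.+1%:R^-1;
  typical_component : forall i j, i != j -> conn g i j ->
    exists k, forall n0, exists n, (n0 <= n)%N /\ k.+1%:R^-1 < component_avg R i n g;
  typical_complete : noniso_prob = 1 -> forall i, nonisolated g i }.

Lemma ae_typical : {ae L, forall g, typical g}.
Proof.
have h1 : {ae L, forall g, forall i b e m, cvgn (event_avg R (rooted i b e) m ^~ g)}.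
  apply: ae_all_count => i; apply: ae_all_count => b; apply: ae_all_count => e.
  apply: ae_all_count => m.
  apply: (natural_avg_cvg LG (r := [:: i])) => //; first exact: natural_rooted.
  by move=> s; exact: measurable_rooted.
have h2 : {ae L, forall g, forall e m,
    event_avg R (joined e) m n g @[n --> \oo] --> join_prob e m}.
  apply: ae_all_count => e; apply: ae_all_count => m.
  apply: (monotone_avg_cvg LG (@natural_joined m e)); first exact: measurable_joined.
  by move=> f l g; exact: joined_mono.
have h3 : {ae L, forall g, event_avg R noniso 1 n g @[n --> \oo] --> noniso_prob}.
  apply: (monotone_avg_cvg LG natural_noniso); first exact: measurable_noniso.
  by move=> f l g; exact: noniso_mono.
have h4 := ae_far_small LG; have h5 := ae_component_density.
have h6 : {ae L, forall g, noniso_prob = 1 -> forall i, nonisolated g i}.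
  have [p1|p1] := pselect (noniso_prob = 1); last by apply: aeW => g /p1.
  have : {ae L, forall g, forall i, nonisolated g i}; last by apply: filterS.
  apply: ae_all_count => i.
  exists (~` noniso [:: i]); split => //.
  - by apply: measurableC; exact: measurable_noniso.
  - rewrite probability_setC; last exact: measurable_noniso.
    rewrite (natural_eq (t := [:: 0%N]) LG natural_noniso)//; last exact: measurable_noniso.
    rewrite -[L _]fineK ?fin_num_measure//; last exact: measurable_noniso.
    by rewrite -/noniso_prob p1 subee.
by apply: filterS3 (filterI h1 h2) (filterI h3 h4) (filterI h5 h6)
  => g [a1 a2] [a3 a4] [a5 a6]; split.
Qed.

End typical.

(** * Limits of induced subgraphs *)

Section induced_densities.
Context (R : realType).

Lemma tuple_sum_ffun k n (f : seq nat -> R) : (0 < n)%N ->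
  tuple_sum k n f =
  \sum_(phi : {ffun 'I_k -> 'I_n}) f [seq (phi i : nat) | i <- enum 'I_k].
Proof.
move=> n0; elim: k f => [|k IH] f.
  have e0 : enum 'I_0 = [::] by apply: size0nil; rewrite size_enum_ord.
  rewrite /tuple_sum expr0 mul1r /= e0 /= sumr_const card_ffun !card_ord expn0.
  by rewrite mulr1n.
rewrite tuple_sumS//.
under eq_bigr do rewrite IH.
rewrite pair_big/=.
pose ext (p : 'I_n * {ffun 'I_k -> 'I_n}) : {ffun 'I_k.+1 -> 'I_n} :=
  [ffun i => if unlift ord0 i is Some j then p.2 j else p.1].
rewrite [RHS](reindex ext)/=.
  apply: eq_bigr => -[x phi] _ /=; congr f; rewrite enum_ordSl /= /ext ffunE unlift_none /=.
  congr (_ :: _); rewrite -map_comp; apply: eq_map => i /=.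
  by rewrite ffunE liftK.
exists (fun phi => (phi ord0, [ffun i => phi (lift ord0 i)])).
  move=> [x phi] _; rewrite /ext ffunE unlift_none /=; congr (_, _).
  by apply/ffunP => i; rewrite !ffunE liftK.
move=> phi _; apply/ffunP => i; rewrite ffunE /=.
by case: unliftP => [j ->|->]; rewrite ?ffunE.
Qed.

(** With its vertices replaced by their ranks, F becomes a list of edges between
    positions, as in [sees]. *)
Definition edge_code (F : graph) : seq (nat * nat) :=
  [seq (enum_rank p.1 : nat, enum_rank p.2 : nat) | p <- enum [pred p : F * F | adj p.1 p.2]].

Definition inside (g : ngraph) (V : set nat) (e : seq (nat * nat)) : set (seq nat) :=
  [set s | sees e s g /\ forall x, x \in s -> V x].

Definition density (V : set nat) n : R := n%:R^-1 * \sum_(x < n) \1_V (x : nat).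

Lemma card_induced (g : igraph) (V : set nat) n :
  (#|induced_sgraph g V n|)%:R = \sum_(x < n) \1_V (x : nat) :> R.
Proof.
rewrite card_sig -sum1_card natr_sum big_mkcond /=; apply: eq_bigr => x _.
by rewrite indicE; case: ifP => h; rewrite -topredE /= in h; rewrite h.
Qed.

Lemma densityE (V : set nat) n :
  #|[set i : 'I_n | (i : nat) \in V]%SET|%:R / n%:R = density V n.
Proof.
rewrite /density mulrC; congr (_ * _).
rewrite -sum1_card natr_sum big_mkcond /=; apply: eq_bigr => x _.
by rewrite indicE inE; case: ifP.
Qed.

(** Homomorphisms into the induced subgraph are the lists of vertices of V below
    n that see the edges of F. *)
Lemma card_hom_induced (F : graph) (g : ngraph) (V : set nat) n : (0 < n)%N ->
  #|[set f : {ffun F -> induced_sgraph g V n} | is_hom f]%SET|%:R =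
  tuple_sum #|F| n (\1_(inside g V (edge_code F))) :> R.
Proof.
move=> n0; rewrite tuple_sum_ffun//.
pose h (psi : {ffun F -> induced_sgraph g V n}) : {ffun 'I_#|F| -> 'I_n} :=
  [ffun i => val (psi (enum_val i))].
pose good (phi : {ffun 'I_#|F| -> 'I_n}) : bool :=
  [seq (phi i : nat) | i <- enum 'I_#|F|] \in inside g V (edge_code F).
have inj_h : injective h.
  move=> p1 p2 /ffunP e; apply/ffunP => x; apply: val_inj.
  by have := e (enum_rank x); rewrite !ffunE enum_rankK.
have nthE (phi : {ffun 'I_#|F| -> 'I_n}) (x : F) :
    nth 0%N [seq (phi i : nat) | i <- enum 'I_#|F|] (enum_rank x) = phi (enum_rank x).
  by rewrite (nth_map (enum_rank x)) ?size_enum_ord// nth_ord_enum.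
have goodE (phi : {ffun 'I_#|F| -> 'I_n}) : good phi <->
    (forall x y : F, adj x y -> nadj g (phi (enum_rank x)) (phi (enum_rank y))) /\
    (forall i, V (phi i)).
  rewrite /good inE /inside /=; split=> -[h1 h2]; split.
  - move=> x y xy; have xyF : (enum_rank x : nat, enum_rank y : nat) \in edge_code F.
      by apply/mapP; exists (x, y) => //; rewrite mem_enum inE.
    by move/allP: h1 => /(_ _ xyF); rewrite /= !nthE => /and3P[].
  - by move=> i; apply: h2; apply: map_f; rewrite mem_enum.
  - apply/allP => _ /mapP[[x y] + ->]; rewrite mem_enum inE /= => xy.
    rewrite size_map size_enum_ord !ltn_ord /= !nthE; exact: h1.
  - by move=> _ /mapP[i _ ->].
have -> : \sum_(phi : {ffun 'I_#|F| -> 'I_n}) (\1_(inside g V (edge_code F)))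
     [seq (phi i : nat) | i <- enum 'I_#|F|] = #|[set phi | good phi]%SET|%:R :> R.
  rewrite -sum1_card natr_sum [RHS]big_mkcond /=; apply: eq_bigr => phi _.
  by rewrite indicE inE -/(good phi); case: (good phi).
congr (_%:R); rewrite -(card_imset _ inj_h); apply: eq_card => phi; rewrite [RHS]inE.
apply/imsetP/idP => [[psi + ->]|/goodE[h1 h2]].
  rewrite inE => /forallP hom; apply/goodE; split=> [x y xy|i].
    by rewrite !ffunE !enum_rankK; move/forallP/(_ y)/implyP/(_ xy) : (hom x).
  by rewrite ffunE; have := valP (psi (enum_val i)); rewrite inE.
have memV i : (phi i : nat) \in V by rewrite inE.
exists [ffun x => Sub (phi (enum_rank x)) (memV (enum_rank x))].
  rewrite inE; apply/forallP => x; apply/forallP => y; apply/implyP => xy.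
  by rewrite !ffunE /= /induced_adj /= h1.
by apply/ffunP => i; rewrite !ffunE /= enum_valK.
Qed.

Lemma hom_density_induced (F : graph) (g : ngraph) (V : set nat) n : (0 < n)%N ->
  hom_density R F (induced_sgraph g V n) =
  avgs (nseq #|F| n) (\1_(inside g V (edge_code F))) / density V n ^+ #|F|.
Proof.
move=> n0; rewrite /hom_density card_hom_induced// card_ffun natrX (card_induced g).
have nR : n%:R != 0 :> R by rewrite pnatr_eq0 -lt0n.
rewrite /tuple_sum /density exprMn exprVn invfM invrK -mulrA.
by rewrite mulrCA; congr (_ * _); rewrite mulrC.
Qed.

Lemma cvg_exprn (u : nat -> R) (a : R) k : u @ \oo --> a -> u n ^+ k @[n --> \oo] --> a ^+ k.
Proof.
move=> ua; elim: k => [|k IH].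
  by under eq_fun do rewrite expr0; rewrite expr0; exact: cvg_cst.
by under eq_fun do rewrite exprS; rewrite exprS; exact: cvgM.
Qed.

Lemma density_ge0 V n : 0 <= density V n.
Proof. by rewrite mulr_ge0 ?invr_ge0// sumr_ge0. Qed.

(** The homomorphism densities of the induced subgraphs are quotients of
    converging averages. The first few subgraphs may be empty, and are dropped
    to obtain a sequence of graphs. *)
Lemma induced_limit_exists (g : ngraph) (V : set nat) (nu : R) (l : graph -> R) :
    0 < nu -> density V n @[n --> \oo] --> nu ->
    (forall F : graph,
      avgs (nseq #|F| n) (\1_(inside g V (edge_code F))) @[n --> \oo] --> l F) ->
  exists Gam : graph_limit R, (forall F, Gam F = l F / nu ^+ #|F|) /\
    graph_cvg (induced_sgraph g V) Gam.
Proof.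
move=> nu0 dV lF.
have cvF (F : graph) : hom_density R F (induced_sgraph g V n) @[n --> \oo] --> l F / nu ^+ #|F|.
  have : avgs (nseq #|F| n) (\1_(inside g V (edge_code F))) / density V n ^+ #|F| @[n --> \oo]
      --> l F / nu ^+ #|F|.
    apply: cvgM; first exact: lF.
    apply: cvgV; first by rewrite expf_neq0// gt_eqF.
    exact: cvg_exprn.
  apply: cvg_trans; apply: near_eq_cvg; exists 1%N => // n /= n0.
  by rewrite hom_density_induced.
have cardoo : (fun n => #|induced_sgraph g V n|) @ \oo --> \oo.
  apply/cvgnyPge => A.
  have nu2 : nu / 2 < nu by lra.
  have [N _ HN] : \forall n \near \oo, nu / 2 < density V n by exact: (cvgr_gt nu).
  exists (maxn N (Num.truncn (A%:R / (nu / 2))).+1) => // n /= nN.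
  have h1 : nu / 2 < density V n by apply: HN => /=; apply: leq_trans nN; exact: leq_maxl.
  have h2 : ((Num.truncn (A%:R / (nu / 2))).+1 <= n)%N by apply: leq_trans nN; exact: leq_maxr.
  have n0 : (0 < n)%N by exact: leq_trans h2.
  rewrite -(@ler_nat R) (card_induced g).
  have h3 : A%:R / (nu / 2) <= n%:R.
    by apply: le_trans (ltW (truncnS_gt _)) _; rewrite ler_nat.
  move: h3; rewrite ler_pdivrMr; last lra.
  move=> /le_trans; apply.
  move: h1; rewrite /density -ltr_pdivrMl ?invr_gt0 ?ltr0n// invrK.
  exact: ltW.
have [N HN] : exists N, forall n, (0 < #|induced_sgraph g V (n + N)|)%N.
  move/cvgnyPge : (cardoo) => /(_ 1%N) [N _ HN]; exists N => n.
  by apply: HN => /=; exact: leq_addl.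
pose G n := Graph (HN n).
have GP : ((fun n => #|G n|) @ \oo --> \oo) /\
    forall F : graph, hom_density R F (G n) @[n --> \oo] --> l F / nu ^+ #|F|.
  split.
    have := cardoo; rewrite -(cvg_shiftn N) => h; exact: h.
  move=> F; have := cvF F; rewrite -(cvg_shiftn N) => h; exact: h.
by exists (GraphLimit (ex_intro _ G GP)).
Qed.

End induced_densities.

(** * Components of a typical graph *)

Section real_sequences.
Context (R : realType).

Lemma cvg_div_nat (c : R) : c / n%:R @[n --> \oo] --> 0.
Proof.
apply/cvgrPdist_lt => e e0.
exists (Num.truncn (`|c| / e)).+1 => // n /= nN.
have n0 : 0 < n%:R :> R by rewrite ltr0n; exact: leq_trans nN.
rewrite sub0r normrN normrM normfV (ger0_norm (ltW n0)) ltr_pdivrMr// mulrC.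
rewrite -ltr_pdivrMr//; apply: lt_le_trans (truncnS_gt _) _.
by rewrite ler_nat.
Qed.

Lemma frequently_ge_lim (u : nat -> R) (l a : R) : u @ \oo --> l ->
  (forall n0, exists n, (n0 <= n)%N /\ a <= u n) -> a <= l.
Proof.
move=> ul fa; rewrite leNgt; apply/negP => la.
have [N _ HN] : \forall n \near \oo, u n < a by exact: (cvgr_lt l).
have [n [nN]] := fa N.
by rewrite leNgt HN.
Qed.

Lemma frequently_le_lim (u : nat -> R) (l a : R) : u @ \oo --> l ->
  (forall n0, exists n, (n0 <= n)%N /\ u n <= a) -> l <= a.
Proof.
move=> ul fa; rewrite leNgt; apply/negP => la.
have [N _ HN] : \forall n \near \oo, a < u n by exact: (cvgr_gt l).
have [n [nN]] := fa N.
by rewrite leNgt HN.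
Qed.

Lemma indic_asbool T (A : set T) x : \1_A x = `[< A x >]%:R :> R.
Proof. by rewrite indicE; congr (_%:R); apply/idP/asboolP; rewrite inE. Qed.

Lemma sum_asbool_unique (J : nat) (Q : nat -> Prop) :
    (forall i j, Q i -> Q j -> i = j) ->
  \sum_(j < J) `[< Q j >]%:R = `[< exists j, (j < J)%N /\ Q j >]%:R :> R.
Proof.
move=> uQ; have [[j [jJ Qj]]|nQ] := pselect (exists j, (j < J)%N /\ Q j).
  rewrite (bigD1 (Ordinal jJ))//= big1 ?addr0 => [|i /eqP ij].
    by congr (_%:R); congr nat_of_bool; apply/asboolP/asboolP => _ //; exists j.
  by rewrite asboolF// => /uQ /(_ Qj) e; apply: ij; exact: val_inj.
rewrite big1 => [|i _]; first by rewrite asboolF.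
by rewrite asboolF// => Qi; apply: nQ; exists i; rewrite ltn_ord.
Qed.

Lemma densityD1 (V : set nat) n : density R V n = avgs (nseq 1 n) (fun s => \1_V (nth 0%N s 0)).
Proof. by []. Qed.

Lemma avgs_head k n (h : nat -> R) : (0 < n)%N ->
  avgs (nseq k.+1 n) (fun s => h (nth 0%N s 0)) = n%:R^-1 * \sum_(x < n) h x.
Proof.
move=> n0 /=; congr (_ * _); apply: eq_bigr => x _.
by rewrite avgs_cst// all_nseq n0 orbT.
Qed.

Lemma avgs_repeat k n : (0 < n)%N ->
  avgs (nseq k.+2 n) (fun s => (nth 0%N s 0 == nth 0%N s 1)%:R) = n%:R^-1 :> R.
Proof.
move=> n0 /=; have nR : n%:R != 0 :> R by rewrite pnatr_eq0 -lt0n.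
under eq_bigr => x _.
  under eq_bigr => y _ do rewrite avgs_cst ?all_nseq ?n0 ?orbT//.
  rewrite (bigD1 x)//= eqxx big1 ?addr0 ?mulr1; last first.
    by move=> y yx; rewrite (_ : _ == _ = false)//; apply/negbTE; rewrite eq_sym.
  over.
by rewrite sumr_const card_ord -(mulr_natl n%:R^-1 n) mulfV// mulr1.
Qed.

Lemma density_finite (V : set nat) : finite_set V -> density R V n @[n --> \oo] --> 0.
Proof.
move=> /finite_seqP[s Vs].
apply: (squeeze_cvgr _ (cvg_cst 0) (cvg_div_nat (size s)%:R)).
apply: nearW => n; rewrite density_ge0/= /density mulrC ler_wpM2r ?invr_ge0//.
apply: le_trans (sum_mem_le _ n s); apply: ler_sum => x _.
by rewrite indicE; have [|//] := boolP (_ \in V); rewrite inE Vs /= => ->.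
Qed.

Lemma le_density (A B : set nat) n : A `<=` B -> density R A n <= density R B n.
Proof.
move=> AB; rewrite ler_wpM2l ?invr_ge0//; apply: ler_sum => x _.
rewrite !indicE; have [|_] := boolP ((x : nat) \in A); last by rewrite ler0n.
by rewrite inE => /AB Bx; rewrite mem_set.
Qed.

Lemma densityC (A : set nat) n : (0 < n)%N -> density R (~` A) n = 1 - density R A n.
Proof.
move=> n0; apply/eqP; rewrite eq_sym subr_eq eq_sym addrC -mulrDr -big_split/=.
rewrite (eq_bigr (fun=> 1)) => [|x _].
  by rewrite sumr_const card_ord mulVf// pnatr_eq0 -lt0n.
by rewrite !indicE in_setC; case: (_ \in A); rewrite ?addr0 ?add0r.
Qed.

End real_sequences.

Section typical_components.
Context (R : realType) (L : probability ngraph R) (g : ngraph).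
Hypothesis typ : typical L g.

(** Written as in [rooted], to treat a component and its complement at once. *)
Definition side i (b : bool) : set nat := [set x | conn g i x <-> b].

Lemma side_true i : side i true = conn g i.
Proof. by apply/seteqP; split=> x /=; [move=> [_]; apply|]. Qed.

Lemma side_false i : side i false = ~` conn g i.
Proof. by apply/seteqP; split=> x /=; [move=> [h _] /h|move=> h; split]. Qed.

Lemma rooted_avgE i b e m n :
  event_avg R (rooted i b e) m n g = avgs (nseq m n) (\1_(inside g (side i b) e)).
Proof. by apply: eq_avgs => s _; rewrite !indic_asbool. Qed.

Lemma density_inside V n : density R V n = avgs (nseq 1 n) (\1_(inside g V [::])).
Proof.
rewrite /density /=; congr (_ * _); apply: eq_bigr => x _; rewrite !indic_asbool.
congr (_%:R); congr nat_of_bool; apply/asboolP/asboolP => [Vx|[_]].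
  by split=> // y; rewrite mem_seq1 => /eqP ->.
by apply; rewrite mem_head.
Qed.

Lemma cvg_inside i b e m :
  cvgn (fun n => avgs (nseq m n) (\1_(inside g (side i b) e)) : R).
Proof.
have := @typical_rooted _ _ _ typ i b e m.
by under eq_fun do rewrite rooted_avgE.
Qed.

Lemma cvg_density_side i b : cvgn (density R (side i b)).
Proof.
have := @cvg_inside i b [::] 1.
by under eq_fun do rewrite -density_inside.
Qed.

Lemma cvg_density_conn i : cvgn (density R (conn g i)).
Proof. by rewrite -side_true; exact: cvg_density_side. Qed.

Lemma component_avg_density i n : component_avg R i n g = density R (conn g i) n.
Proof. by rewrite /component_avg rooted_avgE -density_inside side_true. Qed.

(** The density exists, and is frequently above a positive constant. *)
Lemma conn_density_gt0 i j : i != j -> conn g i j -> 0 < limn (density R (conn g i)).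
Proof.
move=> ij cij; have [k hk] := typical_component typ ij cij.
apply: (@lt_le_trans _ _ k.+1%:R^-1); first by rewrite invr_gt0.
apply: (frequently_ge_lim (@cvg_density_conn i)) => n0.
by have [n [nn h]] := hk n0; exists n; rewrite -component_avg_density ltW.
Qed.

Lemma isolated_conn i : ~ nonisolated g i -> conn g i = [set i].
Proof.
move=> ni; apply/seteqP; split=> [x cx|_ ->]; last exact: conn_refl.
by apply: contrapT => /eqP xi; apply: ni; apply/nonisolatedP; exists x.
Qed.

Lemma nonisolated_density i : nonisolated g i <-> 0 < limn (density R (conn g i)).
Proof.
split=> [/nonisolatedP[j ji cij]|d0].
  by apply: (conn_density_gt0 _ cij); rewrite eq_sym.
apply: contrapT => /isolated_conn e; move: d0; rewrite e.
by rewrite (cvg_lim _ (density_finite (R := R) (finite_set1 i)))// ltxx.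
Qed.

Lemma conn_infinite i : infinite_set (conn g i) <-> 0 < limn (density R (conn g i)).
Proof.
split=> [inf|d0 fin].
  apply/nonisolated_density; apply: contrapT => /isolated_conn e.
  by apply: inf; rewrite e; exact: finite_set1.
by move: d0; rewrite (cvg_lim _ (density_finite (R := R) fin))// ltxx.
Qed.

Lemma side_limit i b : 0 < limn (density R (side i b)) ->
  exists Gam' : graph_limit R, graph_cvg (induced_sgraph g (side i b)) Gam' /\
    forall F : graph, avgs (nseq #|F| n) (\1_(inside g (side i b) (edge_code F))) @[n --> \oo]
      --> limn (density R (side i b)) ^+ #|F| * Gam' F.
Proof.
move=> d0.
have [|Gam' [GE cG]] := induced_limit_exists (g := g) (l := fun F : graph =>
    limn (fun n => avgs (nseq #|F| n) (\1_(inside g (side i b) (edge_code F)))))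
    d0 (@cvg_density_side i b).
  by move=> F; exact: cvg_inside.
exists Gam'; split=> // F; rewrite GE mulrC divfK; first exact: cvg_inside.
by rewrite expf_neq0// gt_eqF.
Qed.

End typical_components.

Lemma cvg_sum_ord (R : realType) J (u : nat -> nat -> R) (l : nat -> R) :
  (forall j, u j @ \oo --> l j) ->
  \sum_(j < J) u j n @[n --> \oo] --> \sum_(j < J) l j.
Proof.
move=> ul; elim: J => [|J IH].
  by under eq_fun do rewrite big_ord0; rewrite big_ord0; exact: cvg_cst.
by under eq_fun do rewrite big_ord_recr; rewrite big_ord_recr /=; exact: cvgD.
Qed.

Lemma ler_cvg_seq (R : realType) (u v : nat -> R) (l l' : R) :
  u @ \oo --> l -> v @ \oo --> l' -> (forall n, (0 < n)%N -> u n <= v n) -> l <= l'.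
Proof.
move=> ul vl uv; rewrite -subr_ge0.
apply: (frequently_ge_lim (u := fun n => v n - u n)); first exact: cvgB.
by move=> n0; exists n0.+1; rewrite subr_ge0 uv.
Qed.

(** * The list of the components *)

Section listed_components.
Context (R : realType) (L : probability ngraph R) (g : ngraph).
Hypothesis typ : typical L g.
Context (N : option nat) (V : nat -> set nat).
Hypothesis hV : lists_components g N V.

Lemma listed_root j : below N j -> exists x, V j = conn g x.
Proof. by case: hV => h _ _ /h. Qed.

Lemma conn_eq i j : conn g i j -> conn g i = conn g j.
Proof.
move=> cij; apply/seteqP; split=> x; first exact/conn_trans/conn_sym.
exact: conn_trans.
Qed.

Lemma conn_smallest i : exists x, smallest_elt (conn g i) x.
Proof.
have ex : exists x, `[< conn g i x >] by exists i; apply/asboolP; exact: conn_refl.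
case: (ex_minnP ex) => x /asboolP cx xmin; exists x; split=> // y cy.
by apply: xmin; apply/asboolP.
Qed.

Lemma listed_disjoint i j x : below N i -> below N j -> V i x -> V j x -> i = j.
Proof.
move=> bi bj Vi Vj; have e : V i = V j.
  have [y ey] := listed_root bi; have [z ez] := listed_root bj.
  by move: Vi Vj; rewrite ey ez => /conn_eq -> /conn_eq ->.
have [y ey] := listed_root bi; have [u su] := conn_smallest y.
have [_ _ inc] := hV.
case: (ltngtP i j) => // ij.
  by have := inc i j u u ij bj; rewrite -e ey ltnn => /(_ su su).
by have := inc j i u u ij bi; rewrite -e ey ltnn => /(_ su su).
Qed.

(** The value 0 off the list makes this a sequence on nat, whatever the number N
    of components. *)
Definition weight j : R := if below N j then limn (density R (V j)) else 0.

Lemma weight_cvg j : below N j -> density R (V j) @ \oo --> weight j.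
Proof.
by move=> bj; rewrite /weight bj; have [x ->] := listed_root bj; exact: cvg_density_conn typ _.
Qed.

Lemma weight_ge0 j : 0 <= weight j.
Proof.
rewrite /weight; case: ifP => // bj.
have := weight_cvg bj; rewrite /weight bj => c.
by apply: limr_ge; [apply/cvg_ex; eexists; exact: c|apply: nearW => n; exact: density_ge0].
Qed.

Lemma weight_below j : 0 < weight j -> below N j.
Proof. by rewrite /weight; case: ifP => //; rewrite ltxx. Qed.

Lemma weight_nonisolated j x : below N j -> V j x -> (0 < weight j <-> nonisolated g x).
Proof.
move=> bj Vx; rewrite /weight bj; have [y ey] := listed_root bj.
rewrite ey (@conn_eq y x); last by rewrite -ey.
by apply: iff_sym; exact: nonisolated_density typ x.
Qed.

(** Empty when the weight is 0, in particular off the list: these sets are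
    pairwise disjoint over all of nat. *)
Definition heavy j : set nat := [set x | 0 < weight j /\ V j x].

Lemma heavy_unique i j x : heavy i x -> heavy j x -> i = j.
Proof.
by move=> [/weight_below bi Vi] [/weight_below bj Vj]; exact: listed_disjoint Vi Vj.
Qed.

Definition heavy_union J : set nat := [set x | exists j, (j < J)%N /\ heavy j x].

Lemma heavy_cvg j : density R (heavy j) @ \oo --> weight j.
Proof.
have [w0|w0] := ltP 0 (weight j).
  have -> : heavy j = V j by apply/seteqP; split=> x /=; [move=> []|move=> Vx; split].
  by apply: weight_cvg; exact: weight_below.
have -> : heavy j = set0.
  by apply/seteqP; split=> // x [w _]; rewrite ltNge w0 in w.
have -> : weight j = 0 by apply/eqP; rewrite eq_le w0 weight_ge0.
by apply: density_finite; exact: finite_set0.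
Qed.

Lemma heavy_union_cvg J : density R (heavy_union J) n @[n --> \oo] --> series weight J.
Proof.
rewrite /series /= big_mkord.
have -> : (fun n => density R (heavy_union J) n) =
    (fun n => \sum_(j < J) density R (heavy j) n).
  apply/funext => n; rewrite /density -mulr_sumr exchange_big/=; congr (_ * _).
  apply: eq_bigr => x _; rewrite indic_asbool -sum_asbool_unique.
    by apply: eq_bigr => j _; rewrite indic_asbool.
  by move=> i j; exact: heavy_unique.
exact: cvg_sum_ord heavy_cvg.
Qed.

Definition nonisolated_set : set nat := [set x | nonisolated g x].

Lemma nonisolated_density_cvg : density R nonisolated_set n @[n --> \oo] --> noniso_prob L.
Proof.
have := typical_noniso typ; apply: cvg_trans; apply: near_eq_cvg; apply: nearW => n.
by rewrite densityD1; apply: eq_avgs => s _; rewrite !indic_asbool.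
Qed.

Lemma series_weight_le J : series weight J <= noniso_prob L.
Proof.
apply: (ler_cvg_seq (heavy_union_cvg (J := J)) nonisolated_density_cvg) => n _.
apply: le_density => x [j [_ [w0 Vx]]].
by apply/(weight_nonisolated (weight_below w0) Vx).
Qed.

(** The components of the vertices 0, ..., J0 - 1 occur among finitely many
    first terms of the list, and the proportion of nonisolated vertices outside
    them is small. *)
Lemma series_weight_ge k : exists J, forall J', (J <= J')%N ->
  noniso_prob L - series weight J' <= k.+1%:R^-1.
Proof.
have [J0 far0] := typical_far typ k.
have [_ hV2 _] := hV.
have /choice[c hc] : forall i, exists j, below N j /\ V j = conn g i.
  by move=> i; have [|j bj Vj] := hV2 (conn g i); [exists i|exists j].
exists (\max_(i < J0) c i).+1 => J' JJ'.
apply: (frequently_le_lim (u := fun n => density R nonisolated_set n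
    - density R (heavy_union J') n)).
  exact: cvgB nonisolated_density_cvg (heavy_union_cvg (J := J')).
move=> n0.
have [n [nn fn]] := far0 n0; exists n; split=> //=.
apply: le_trans fn; rewrite lerBlDr /event_avg !densityD1 -avgsD.
apply: ler_avgs => s ss; rewrite !indic_asbool.
set x := nth 0%N s 0.
have [nx|nx] := pselect (nonisolated g x); last first.
  by rewrite (asboolF nx) addr_ge0.
have [[i [iJ ci]]|nt] := pselect (touching J0 s g).
  rewrite (@asboolT (heavy_union J' x)).
    by rewrite -[leLHS]add0r lerD//; case: asboolP; rewrite ?ler0n ?lexx.
  exists (c i); have [bi ei] := hc i; split.
    apply: leq_trans JJ'; rewrite ltnS.
    exact: (@leq_bigmax_cond _ predT (fun i : 'I_J0 => c i) (Ordinal iJ)).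
  have Vx : V (c i) x by rewrite ei.
  by split=> //; apply/(weight_nonisolated bi Vx).
rewrite (@asboolT (far J0 s g)); last by split.
by rewrite -[leLHS]addr0 lerD//; case: asboolP; rewrite ?ler0n ?lexx.
Qed.

Lemma series_weight_cvg : series weight @ \oo --> noniso_prob L.
Proof.
apply/cvgrPdist_le => e e0.
have [J hJ] := series_weight_ge (Num.truncn e^-1).
exists J => // J' /= /hJ h.
rewrite ger0_norm ?subr_ge0 ?series_weight_le//.
by apply: le_trans h _; rewrite invf_ple ?posrE// ltW// truncnS_gt.
Qed.

Context (Gs : nat -> graph_limit R).
Hypothesis GsP : forall j, 0 < weight j -> forall F : graph,
  avgs (nseq #|F| n) (\1_(inside g (V j) (edge_code F))) @[n --> \oo]
    --> weight j ^+ #|F| * Gs j F.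

(** A list of vertices that lie in one component and see F either lies in one of
    the first J components of positive weight, or starts with a nonisolated
    vertex outside these components, or repeats an isolated vertex. The second
    case has small density, the third has density at most 1/n. *)
Lemma series_heavy_cvg (F : graph) : (1 < #|F|)%N ->
  series (fun j => weight j ^+ #|F| * Gs j F) @ \oo --> join_prob L (edge_code F) #|F|.
Proof.
move=> F1; set k := #|F|; set q := join_prob _ _ _; set e := edge_code F.
pose IV j : set (seq nat) := [set s | 0 < weight j /\ inside g (V j) e s].
pose IU J : set (seq nat) := [set s | size s = k /\ exists j, (j < J)%N /\ IV j s].
have k0 : (0 < k)%N by exact: ltnW.
have head_in s : size s = k -> nth 0%N s 0 \in s by move=> ss; apply: mem_nth; rewrite ss.
have IV_unique s i j : size s = k -> IV i s -> IV j s -> i = j.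
  move=> ss [wi [_ Vi]] [wj [_ Vj]].
  by apply: (@heavy_unique _ _ (nth 0%N s 0)); split=> //; [apply: Vi|apply: Vj]; exact: head_in.
have cIV j : avgs (nseq k n) (\1_(IV j)) @[n --> \oo] --> weight j ^+ k * Gs j F.
  have [w0|w0] := ltP 0 (weight j).
    have -> : IV j = inside g (V j) e.
      by apply/seteqP; split=> s /=; [move=> []|move=> h; split].
    exact: GsP.
  have -> : weight j = 0 by apply/eqP; rewrite eq_le w0 weight_ge0.
  rewrite expr0n gtn_eqF//= mul0r.
  have -> : IV j = set0 by apply/seteqP; split=> // s [w _]; rewrite ltNge w0 in w.
  have -> : (fun n => avgs (nseq k n) (\1_(@set0 (seq nat)) : _ -> R)) = cst 0.
    apply/funext => n; rewrite -[RHS](mul0r (avgs (nseq k n) (fun=> 0))) -avgsZ.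
    by apply: eq_avgs => s _; rewrite indic0 mul0r.
  exact: cvg_cst.
have cIU J : avgs (nseq k n) (\1_(IU J)) @[n --> \oo] --> series (fun j => weight j ^+ k * Gs j F) J.
  rewrite /series /= big_mkord.
  have -> : (fun n => avgs (nseq k n) (\1_(IU J) : _ -> R)) =
      (fun n => \sum_(j < J) avgs (nseq k n) (\1_(IV j))).
    apply/funext => n; rewrite -avgs_sum; apply: eq_avgs => s.
    rewrite size_nseq => ss; rewrite indic_asbool.
    under [RHS]eq_bigr do rewrite indic_asbool.
    rewrite (@sum_asbool_unique R J (fun j => IV j s)); last by move=> i j; exact: IV_unique.
    by congr (_%:R); congr nat_of_bool; apply/asboolP/asboolP => [[]|].
  exact: cvg_sum_ord cIV.
have cJ := @typical_joined _ _ _ typ e k.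
have bounds J : 0 <= q - series (fun j => weight j ^+ k * Gs j F) J
    <= noniso_prob L - series weight J.
  have c1 : event_avg R (joined e) k n g - avgs (nseq k n) (\1_(IU J)) @[n --> \oo]
      --> q - series (fun j => weight j ^+ k * Gs j F) J.
    by apply: cvgB; [exact: cJ|exact: cIU].
  (* 1 / n is the density of the lists whose first two entries coincide *)
  have c2 : density R nonisolated_set n - density R (heavy_union J) n + 1 / n%:R @[n --> \oo]
      --> noniso_prob L - series weight J + 0.
    apply: cvgD; last exact: cvg_div_nat.
    by apply: cvgB; [exact: nonisolated_density_cvg|exact: heavy_union_cvg].
  apply/andP; split.
    apply: (ler_cvg_seq (cvg_cst 0) c1) => n _ /=.
    rewrite subr_ge0; apply: ler_avgs => s; rewrite size_nseq => ss; rewrite !indic_asbool.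
    have [IUs|nIU] := pselect (IU J s); last by rewrite (asboolF nIU).
    rewrite (@asboolT (joined e s g)) ?ler_nat ?leq_b1//.
    have [_ [j [_ [w0 [sg Vs]]]]] := IUs; split=> // x y xs ys.
    have [r er] := listed_root (weight_below w0).
    have := Vs x xs; have := Vs y ys; rewrite er => cy cx.
    exact: conn_trans (conn_sym cx) cy.
  rewrite -[leRHS]addr0.
  apply: (ler_cvg_seq c1 c2) => n n0 /=; rewrite div1r.
  have [k' kE] : exists k', k = k'.+2 by exists k.-2; rewrite /k; lia.
  have dE A : density R A n = avgs (nseq k n) (fun s => \1_A (nth 0%N s 0)).
    by rewrite kE avgs_head.
  rewrite !dE -(avgs_repeat R k' n0) -kE -!avgsB -avgsD; apply: ler_avgs => s.
  rewrite size_nseq => ss; rewrite !indic_asbool; set x := nth 0%N s 0.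
  have xs : x \in s by exact: head_in.
  have HUle : `[< heavy_union J x >]%:R <= `[< nonisolated_set x >]%:R :> R.
    have [[j [_ [w0 Vx]]]|nH] := pselect (heavy_union J x); last by rewrite (asboolF nH) ler0n.
    rewrite (@asboolT (nonisolated_set x)) ?ler_nat ?leq_b1//.
    exact/(weight_nonisolated (weight_below w0) Vx).
  have b0 : 0 <= (x == nth 0%N s 1)%:R :> R by rewrite ler0n.
  have [Js|nJ] := pselect (joined e s g); last first.
    rewrite (asboolF nJ) sub0r; apply: (@le_trans _ _ 0); first by rewrite oppr_le0 ler0n.
    by apply: addr_ge0 => //; rewrite subr_ge0.
  have [sg Jc] := Js; rewrite (asboolT Js).
  have [Hx|nH] := pselect (heavy_union J x).
    have [j [jJ [w0 Vx]]] := Hx.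
    have IUs : IU J s.
      split=> //; exists j; split=> //; split=> //; split=> // y ys.
      have [r er] := listed_root (weight_below w0).
      by move: Vx; rewrite er => cx; apply: conn_trans cx _; exact: Jc.
    by rewrite (asboolT IUs) subrr; apply: addr_ge0 => //; rewrite subr_ge0.
  rewrite (asboolF nH) subr0.
  have [nx|nx] := pselect (nonisolated_set x).
    rewrite (asboolT nx); apply: (@le_trans _ _ 1); last by rewrite lerDl.
    by rewrite gerBl ler0n.
  rewrite (asboolF nx) add0r.
  have s1 : nth 0%N s 1 \in s by apply: mem_nth; rewrite ss.
  have := Jc _ _ xs s1; rewrite (isolated_conn nx) /= => ->.
  by rewrite eqxx gerBl ler0n.
apply/cvgrPdist_le => d d0.
have := series_weight_cvg => /cvgrPdist_le/(_ _ d0)[J _ HJ].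
exists J => // J' /= /HJ; have /andP[h1 h2] := bounds J'.
rewrite (ger0_norm h1); apply: le_trans; apply: le_trans h2 _.
exact: ler_norm.
Qed.

End listed_components.

(** * Connected limits *)

Section connected_limits.
Context (R : realType).

Lemma conn_of_connect (F : sgraph) (f : F -> nat) g x y : copy f g ->
  connect (@adj F) x y -> conn g (f x) (f y).
Proof.
move=> fg /connectP[p + ->]; elim: p x => [|z p IH] x /=; first by move=> _; exact: conn_refl.
by move=> /andP[/fg/conn_edge xz /IH]; exact: conn_trans.
Qed.

Lemma sees_copy (F : graph) s g : size s = #|F| ->
  sees (edge_code F) s g <-> copy (fun x : F => nth 0%N s (enum_rank x)) g.
Proof.
move=> ss; split=> [/allP h x y xy|h].
  have xyF : (enum_rank x : nat, enum_rank y : nat) \in edge_code F.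
    by apply/mapP; exists (x, y) => //; rewrite mem_enum inE.
  by have /and3P[] := h _ xyF.
apply/allP => _ /mapP[[x y] + ->]; rewrite mem_enum inE /= => xy.
by rewrite ss !ltn_ord; exact: h.
Qed.

Lemma sees_joined (F : graph) s g : connected_graph F -> size s = #|F| ->
  sees (edge_code F) s g -> joined (edge_code F) s g.
Proof.
move=> cF ss sg; split=> // x y xs ys; have fg := (sees_copy g ss).1 sg.
have nthE z : z \in s -> exists u : F, z = nth 0%N s (enum_rank u).
  move=> zs; have iz : (index z s < #|F|)%N by rewrite -ss index_mem.
  by exists (enum_val (Ordinal iz)); rewrite enum_valK /= nth_index.
have [u ->] := nthE _ xs; have [v ->] := nthE _ ys.
exact: (conn_of_connect fg).
Qed.

Lemma join_prob_connected (L : probability ngraph R) Gam (F : graph) :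
  samples L Gam -> connected_graph F -> join_prob L (edge_code F) #|F| = Gam F.
Proof.
move=> LG cF; rewrite /join_prob.
have inj_r : injective (fun x : F => enum_rank x : nat).
  by move=> x y /val_inj/enum_rank_inj.
have -> : joined (edge_code F) (iota 0 #|F|) = copy (fun x : F => enum_rank x : nat).
  have e : (fun x : F => nth 0%N (iota 0 #|F|) (enum_rank x)) = (fun x => enum_rank x : nat).
    by apply/funext => x; rewrite nth_iota// add0n.
  apply/seteqP; split=> g; rewrite -e.
    by move=> [sg _]; apply/sees_copy => //; rewrite size_iota.
  by move=> fg; apply: sees_joined; rewrite ?size_iota//; apply/sees_copy; rewrite ?size_iota.
by rewrite (LG _ _ inj_r).
Qed.

Lemma esum_pair (u : nat -> \bar R) : (forall i, 0 <= u i)%E ->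
  (\esum_(i in [set i | below (Some 2%N) i]) u i = u 0%N + u 1%N)%E.
Proof.
move=> u0; rewrite (_ : [set i | below (Some 2) i] = [set` [:: 0%N; 1%N]]).
  rewrite esum_fset; [|exact: finite_seq|by move=> i _; exact: u0].
  by rewrite -fsbig_seq//= big_cons big_cons big_nil adde0.
apply/seteqP; split=> i /=; last by rewrite !inE => /orP[]/eqP ->.
by case: i => [|[|i]].
Qed.

Lemma direct_sum_pair (a : R) (G1 G2 Gam : graph_limit R) : 0 <= a <= 1 ->
    (forall F : graph, connected_graph F -> has_edge F ->
      Gam F = a ^+ #|F| * G1 F + (1 - a) ^+ #|F| * G2 F) ->
  is_direct_sum (Some 2) (fun i => if i is 0%N then a else 1 - a)
    (fun i => if i is 0%N then G1 else G2) Gam.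
Proof.
move=> /andP[a0 a1] GE; split.
- by case=> [|[|]]//= _; rewrite subr_ge0.
- rewrite /weight_sum esum_pair => [|[|i]]; rewrite ?lee_fin ?subr_ge0//.
  lra.
- move=> F cF eF; rewrite esum_pair; last first.
    by move=> [|i]; rewrite lee_fin mulr_ge0 ?exprn_ge0 ?subr_ge0 ?graph_limit_ge0.
  by rewrite /= -EFinD GE.
Qed.

Lemma ae_ex d (T : measurableType d) (L : probability T R) (P : T -> Prop) :
  {ae L, forall x, P x} -> exists x, P x.
Proof.
move=> [N [mN LN sub]]; apply: contrapT => nP.
have NT : N = setT.
  by apply/seteqP; split=> // x _; apply: sub => Px; apply: nP; exists x.
by move: LN; rewrite NT probability_setT => /eqP; rewrite onee_eq0.
Qed.

(** One typical graph suffices. Without components of positive density the limit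
    vanishes on graphs with an edge, and is the sum of two halves of itself. A
    component of density strictly between 0 and 1 splits the limit into the
    limits of the component and of its complement. So some component has density
    1, and contains almost all pairs of vertices. *)
Lemma connected_join_prob (L : probability ngraph R) Gam : samples L Gam ->
  ~ disconnected_limit Gam -> join_prob L [::] 2 = 1.
Proof.
move=> LG conG; have [g typ] := ae_ex (ae_typical LG).
have q1 : join_prob L [::] 2 <= 1.
  rewrite -lee_fin fineK ?fin_num_measure ?probability_le1//; exact: measurable_joined.
have cF_lim (F : graph) : connected_graph F ->
    event_avg R (joined (edge_code F)) #|F| n g @[n --> \oo] --> Gam F.
  by move=> cF; rewrite -(join_prob_connected LG cF); exact: typical_joined.
have [[i di]|nd] := pselect (exists i, 0 < limn (density R (conn g i))); last first.
  exfalso; apply: conG.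
  (* no vertex has a neighbour, so Gam vanishes on graphs with an edge *)
  exists (fun i => if i is 0%N then 1/2 else 1 - 1/2), (fun i => if i is 0%N then Gam else Gam).
  split=> //; first by rewrite !ltr_pdivlMr ?ltr_pdivrMr//; lra.
  apply: direct_sum_pair; first lra.
  move=> F cF [x [y xy]].
  have -> : Gam F = 0; last by rewrite !mulr0 addr0.
  apply: (cvg_unique (@norm_hausdorff _ R^o) (cF_lim F cF)) => //.
  have -> : (fun n => event_avg R (joined (edge_code F)) #|F| n g) = cst 0.
    apply/funext => n; rewrite /event_avg -[RHS](mul0r (avgs (nseq #|F| n) (fun=> 0))) -avgsZ.
    apply: eq_avgs => s; rewrite size_nseq mul0r => ss; rewrite indic_asbool asboolF//.
    move=> [/(sees_copy g ss)/(_ _ _ xy) exy _]; apply: nd.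
    exists (nth 0%N s (enum_rank x)); apply/(nonisolated_density typ).
    by exists (nth 0%N s (enum_rank y)).
  exact: cvg_cst.
have cd := @cvg_density_conn _ _ _ typ i.
set a := limn _ in di cd.
have a1 : a <= 1.
  apply: (@ler_cvg_seq _ _ (cst 1) _ _ cd); first exact: cvg_cst.
  move=> n n0 /=.
  rewrite densityD1; have := @avgs_le1 R (nseq 1 n) (fun s => \1_(conn g i) (nth 0%N s 0)).
  by case/(_ _)/andP => // s _; rewrite indic_asbool ler0n lern1 leq_b1.
have [a_lt1|a_ge1] := ltP a 1.
  exfalso; apply: conG.
  have cdC : density R (side g i false) n @[n --> \oo] --> 1 - a.
    have : 1 - density R (conn g i) n @[n --> \oo] --> 1 - a by apply: cvgB => //; exact: cvg_cst.
    apply: cvg_trans; apply: near_eq_cvg; exists 1%N => // n n0.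
    by rewrite side_false densityC.
  have l1 : limn (density R (side g i true)) = a by rewrite side_true.
  have l2 : limn (density R (side g i false)) = 1 - a by exact: cvg_lim.
  have [|G1 [_ G1P]] := @side_limit _ _ _ typ i true; first by rewrite l1.
  have [|G2 [_ G2P]] := @side_limit _ _ _ typ i false; first by rewrite l2 subr_gt0.
  exists (fun i => if i is 0%N then a else 1 - a), (fun i => if i is 0%N then G1 else G2).
  split=> //; first by rewrite di a_lt1.
  apply: direct_sum_pair; first by rewrite (ltW di) a1.
  move=> F cF _; rewrite -(cvg_lim (@norm_hausdorff _ R^o) (cF_lim F cF)).
  apply: (cvg_lim (@norm_hausdorff _ R^o)).
  have {}G1P := G1P F; have {}G2P := G2P F; rewrite l1 in G1P; rewrite l2 in G2P.
  rewrite (_ : (fun n => event_avg R (joined (edge_code F)) #|F| n g) = (fun n =>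
      avgs (nseq #|F| n) (\1_(inside g (side g i true) (edge_code F))) +
      avgs (nseq #|F| n) (\1_(inside g (side g i false) (edge_code F))))).
    exact: cvgD.
  apply/funext => n /=; rewrite /event_avg -avgsD; apply: eq_avgs => s.
  rewrite size_nseq => ss; rewrite !indic_asbool.
  have s0 : nth 0%N s 0 \in s by apply: mem_nth; rewrite ss graph_gt0.
  have [sg|ns] := pselect (sees (edge_code F) s g); last first.
    by rewrite !asboolF ?addr0//; move=> [].
  have Js := sees_joined cF ss sg; rewrite (asboolT Js).
  have [_ Jc] := Js.
  have [c0|nc0] := pselect (conn g i (nth 0%N s 0)).
    rewrite (@asboolT (inside g (side g i true) (edge_code F) s)).
      rewrite asboolF ?addr0// => -[_ /(_ _ s0)[h _]].
      by have := h c0.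
    by split=> // y ys; split=> // _; apply: conn_trans c0 _; exact: Jc.
  rewrite asboolF; last by move=> [_ /(_ _ s0)[_ h]]; apply: nc0; exact: h.
  rewrite add0r (@asboolT (inside g (side g i false) (edge_code F) s))//.
  split=> // y ys; split=> // cy; exfalso; apply: nc0.
  by apply: conn_trans cy _; exact: Jc.
have {a_ge1} a1E : a = 1 by apply/eqP; rewrite eq_le a1 a_ge1.
apply/eqP; rewrite eq_le q1 /=.
have := cvgM cd cd; rewrite a1E mulr1 => cdd.
apply: (@ler_cvg_seq _ (fun n => density R (conn g i) n * density R (conn g i) n)
  (fun n => event_avg R (joined [::]) 2 n g)); [exact: cdd|exact: typical_joined|].
move=> n n0.
rewrite !densityD1 avgs_mul; apply: ler_avgs => s /= ss.
rewrite !indic_asbool.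
case: asboolP => [c0|_]; last by rewrite mul0r ler0n.
case: asboolP => [c1|_]; last by rewrite mulr0 ler0n.
rewrite mulr1 (@asboolT (joined [::] s g))//.
case: s ss c0 c1 => [|x [|y []]]//= _ c0 c1; split=> // u v.
have ci z : z \in [:: x; y] -> conn g i z by rewrite !inE => /orP[]/eqP ->.
by move=> /ci cu /ci cv; exact: conn_trans (conn_sym cu) cv.
Qed.

(** By exchangeability any two vertices are connected with the same probability.
    *)
Lemma ae_connected (L : probability ngraph R) Gam : samples L Gam ->
  ~ disconnected_limit Gam -> {ae L, forall g, forall i j, conn g i j}.
Proof.
move=> LG /(connected_join_prob LG) q1.
apply: ae_all_count => i; apply: ae_all_count => j.
have [->|ij] := eqVneq i j; first by apply: aeW => g; exact: conn_refl.
have mJ := @measurable_joined [::] [:: i; j].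
exists (~` joined [::] [:: i; j]); split.
- exact: measurableC.
- rewrite probability_setC//.
  rewrite (natural_eq (t := iota 0 2) LG (@natural_joined 2 [::]))//; last 2 first.
    by move=> s; exact: measurable_joined.
    by rewrite /= inE ij.
  rewrite -[L _]fineK ?fin_num_measure//; last exact: measurable_joined.
  by rewrite -/(join_prob L [::] 2) q1 subee.
- move=> g /= nc [_ Jc]; apply: nc; apply: Jc; rewrite !inE eqxx ?orbT//.
Qed.

End connected_limits.

(** * Existence of the random graph of a limit *)

Section prescribed_intersections.
Context (R : realType) (Lam : seq nat -> R).

(** The probability, by inclusion and exclusion, that the events in A occur and
    those in Z do not. *)
Fixpoint incl_excl (A Z : seq nat) : R :=
  if Z is z :: Z' then incl_excl A Z' - incl_excl (z :: A) Z' else Lam A.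

Hypothesis Lam_set : forall s t, s =i t -> Lam s = Lam t.
Hypothesis Lam0 : Lam [::] = 1.
Hypothesis Lam_ge0 : forall A Z, 0 <= incl_excl A Z.

Lemma incl_excl_set A B Z : A =i B -> incl_excl A Z = incl_excl B Z.
Proof.
elim: Z A B => [|z Z IH] A B AB /=; first exact: Lam_set.
by rewrite (IH _ _ AB) (IH (z :: A) (z :: B))// => x; rewrite !inE AB.
Qed.

(** The history of bits along which the intervals containing u are nested:
    the indices of the bits on, of the bits off, and the left endpoint. *)
Definition step (u : R) (k : nat) (h : seq nat * seq nat * R) :=
  let: (A, Z, a) := h in
  if u < a + incl_excl (k :: A) Z then (k :: A, Z, a)
  else (A, k :: Z, a + incl_excl (k :: A) Z).

Fixpoint history (u : R) (k : nat) : seq nat * seq nat * R :=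
  if k is k'.+1 then step u k' (history u k') else ([::], [::], 0).

Definition bit (n : nat) : set R :=
  [set u | u < (history u n).2 + incl_excl (n :: (history u n).1.1) (history u n).1.2].

Definition bits (s : seq nat) : set R := [set u | forall n, n \in s -> bit n u].

Let itv A Z a : set R := `[a, a + incl_excl A Z[%classic.

Let itvE A Z a u : itv A Z a u <-> a <= u < a + incl_excl A Z.
Proof. by rewrite /itv /= in_itv. Qed.

Let mu := @lebesgue_measure R.

Lemma incl_excl_split A Z k :
  incl_excl A Z = incl_excl (k :: A) Z + incl_excl A (k :: Z).
Proof. by rewrite /= addrC subrK. Qed.

(** Induction on the number d of stages that remain to be split; the first
    hypothesis on the interval says that it is one of the intervals of stage k.
    *)
Lemma bits_measure d k A Z a s :
    (forall u, itv A Z a u -> history u k = (A, Z, a)) ->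
    (forall x, x \in s -> (k <= x < k + d)%N) ->
  measurable (itv A Z a `&` bits s) /\
  mu (itv A Z a `&` bits s) = (incl_excl (s ++ A) Z)%:E.
Proof.
elim: d k A Z a s => [|d IH] k A Z a s inv sk.
  have -> : s = [::].
    by case: s sk => // x s /(_ x (mem_head _ _)); lia.
  have -> : bits [::] = setT by apply/seteqP; split.
  rewrite setIT; split; first exact: measurable_itv.
  rewrite /mu /itv lebesgue_measure_itv /= lte_fin ltrDl.
  have := Lam_ge0 A Z; rewrite le_eqVlt => /predU1P[<-|->].
    by rewrite ltxx.
  by rewrite -EFinB addrAC subrr add0r.
have pE := incl_excl_split A Z k.
set p1 := incl_excl (k :: A) Z in pE *; set p2 := incl_excl A (k :: Z) in pE *.
have p1_ge0 : 0 <= p1 by exact: Lam_ge0.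
have p2_ge0 : 0 <= p2 by exact: Lam_ge0.
have on_sub : itv (k :: A) Z a `<=` itv A Z a.
  by move=> u /itvE; rewrite -/p1 => /andP[h1 h2]; apply/itvE; rewrite h1 pE; lra.
have off_sub : itv A (k :: Z) (a + p1) `<=` itv A Z a.
  by move=> u /itvE; rewrite -/p2 => /andP[h1 h2]; apply/itvE; rewrite pE; lra.
have on_inv u : itv (k :: A) Z a u -> history u k.+1 = (k :: A, Z, a).
  move=> hu; have /itvE := hu; rewrite -/p1 => /andP[_ h].
  by rewrite /= (inv _ (on_sub _ hu)) /step -/p1 h.
have off_inv u : itv A (k :: Z) (a + p1) u -> history u k.+1 = (A, k :: Z, a + p1).
  move=> hu; have /itvE := hu => /andP[h _].
  by rewrite /= (inv _ (off_sub _ hu)) /step -/p1 ltNge h.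
have bitE u : itv A Z a u -> (bit k u <-> u < a + p1).
  by move=> hu; rewrite /bit /= (inv _ hu).
have [ks|ks] := boolP (k \in s).
  pose s' := [seq x <- s | x != k].
  have e : itv A Z a `&` bits s = itv (k :: A) Z a `&` bits s'.
    apply/seteqP; split=> u [hu bu].
      have bk := (bitE u hu).1 (bu k ks).
      split; last by move=> n; rewrite mem_filter => /andP[_ /bu].
      by move: hu => /itvE/andP[h _]; apply/itvE; rewrite -/p1 h bk.
    split; first exact: on_sub.
    move=> n ns; have [->|nk] := eqVneq n k; last by apply: bu; rewrite mem_filter nk.
    by apply/(bitE u (on_sub _ hu)); move: hu => /itvE/andP[].
  rewrite e; have [|m1 m2] := IH k.+1 (k :: A) Z a s' on_inv.
  - by move=> x; rewrite mem_filter => /andP[xk /sk]; lia.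
  split=> //; rewrite m2; congr _%:E; apply: incl_excl_set => x.
  rewrite !mem_cat inE mem_filter; have [->|] := eqVneq x k; first by rewrite ks orbT.
  by rewrite andTb.
have sk' x : x \in s -> (k.+1 <= x < k.+1 + d)%N.
  by move=> xs; have := sk x xs; have : x != k by [apply: contraNneq ks => <-]; lia.
have [m1 e1] := IH k.+1 (k :: A) Z a s on_inv sk'.
have [m2 e2] := IH k.+1 A (k :: Z) (a + p1) s off_inv sk'.
have e : itv A Z a `&` bits s =
    (itv (k :: A) Z a `&` bits s) `|` (itv A (k :: Z) (a + p1) `&` bits s).
  rewrite -setIUl; congr (_ `&` _); apply/seteqP; split=> u.
    move=> /itvE; rewrite pE => /andP[h1 h2].
    have [h|h] := ltP u (a + p1); [left|right]; apply/itvE; first by rewrite h1.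
    by rewrite -/p2 h -addrA.
  by move=> [/on_sub|/off_sub].
rewrite e; split; first exact: measurableU.
rewrite /mu in e1 e2 *; rewrite measureU//= ?e1 ?e2; last first.
  apply/seteqP; split=> // u [[/itvE/andP[_ h1] _] [/itvE/andP[h2 _] _]].
  by move: h1; rewrite -/p1 ltNge h2.
rewrite -EFinD; congr _%:E; rewrite (incl_excl_split (s ++ A) Z k); congr (_ + _).
by apply: incl_excl_set => x; rewrite !(mem_cat, inE) orbCA.
Qed.

Lemma bits_measure01 s :
  measurable (`[0, 1[%classic `&` bits s) /\
  mu (`[0, 1[%classic `&` bits s) = (Lam s)%:E.
Proof.
have [] := @bits_measure (\max_(x <- s) x).+1 0 [::] [::] 0 s.
- by move=> u _.
- move=> x xs /=; by rewrite ltnS (big_rem x)//= leq_maxl.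
by rewrite /itv /= Lam0 add0r cats0.
Qed.

End prescribed_intersections.

Lemma mnormalizeE d (T : measurableType d) (R : realType)
    (nu : {measure set T -> \bar R}) (P : probability T R) U :
  nu setT = 1%E -> mnormalize nu P U = nu U.
Proof. by move=> nu1; rewrite /mnormalize nu1 onee_eq0 /= invr1 mule1. Qed.

(** Consistency of the prescription amounts to the nonnegativity of its sums by
    inclusion and exclusion. The events are unions of intervals of [0, 1). *)
Lemma prescribed_intersections (R : realType) (Lam : seq nat -> R) :
    (forall s t, s =i t -> Lam s = Lam t) -> Lam [::] = 1 ->
    (forall A Z, 0 <= incl_excl Lam A Z) ->
  exists (P : probability (measurableTypeR R) R) (B : nat -> set (measurableTypeR R)),
    (forall n, measurable (B n)) /\
    forall s, P [set u | forall n, n \in s -> B n u] = (Lam s)%:E.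
Proof.
move=> Lset L0 Lge0.
have mD : measurable (`[0, 1[%classic : set R) by exact: measurable_itv.
have bm := bits_measure01 Lset L0 Lge0.
pose P := mnormalize (mrestr (@lebesgue_measure R) mD) (dirac (0 : measurableTypeR R)).
exists P, (fun n => `[0, 1[%classic `&` bit Lam n); split.
  move=> n; have [+ _] := bm [:: n]; congr measurable; congr (_ `&` _).
  apply/seteqP; split=> u; first by apply; rewrite mem_head.
  by move=> bu k; rewrite mem_seq1 => /eqP ->.
move=> s.
have PE U : P U = (@lebesgue_measure R) (U `&` `[0, 1[%classic).
  apply: mnormalizeE; rewrite /= /mrestr setTI lebesgue_measure_itv /= lte_fin ltr01.
  by rewrite oppr0 adde0.
apply: (etrans (PE _)).
have [_ <-] := bm s; congr (lebesgue_measure _); apply/seteqP; split=> u.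
  move=> [h u01]; split=> // n /h[].
  by [].
by move=> [u01 h]; split=> // n ns; split=> //; exact: h.
Qed.

Section law_of_limit.
Context (R : realType).

(** Only increasing pairs are retained, so that each edge has a single code. *)
Definition pairs (s : seq nat) : seq (nat * nat) :=
  [seq p <- pmap (@pickle_inv (nat * nat)%type) s | (p.1 < p.2)%N].

Lemma mem_pairs s p : (p \in pairs s) = (p.1 < p.2)%N && (pickle p \in s).
Proof.
by rewrite mem_filter; congr (_ && _); rewrite (can2_mem_pmap pickle_invK pickleK_inv).
Qed.

Lemma hom_density_edge_graph K K' E E' (H : sgraph) : E =i E' ->
    (forall p, p \in E -> (p.1 <= K)%N && (p.2 <= K)%N) -> (K <= K')%N ->
  hom_density R (edge_graph K' E') H = hom_density R (edge_graph K E) H.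
Proof.
move=> EE' bE KK'.
apply: (@hom_density_embed R (edge_graph K E) (edge_graph K' E')
  (@widen_ord K.+1 K'.+1 KK')).
- by move=> x y /(congr1 val) /= /val_inj.
- move=> x y /andP[xy e]; apply/andP; split; last by rewrite -!EE'.
  by apply: contraNneq xy => /(congr1 val) /= /val_inj ->.
- move=> u v /andP[uv e].
  have e' : ((u : nat, v : nat) \in E) || ((v : nat, u : nat) \in E) by rewrite !EE'.
  have [ub vb] : (u < K.+1)%N /\ (v < K.+1)%N.
    by case/orP: e' => /bE /andP[/= ? ?]; rewrite !ltnS.
  exists (Ordinal ub), (Ordinal vb); split; try exact: val_inj.
  exact/andP.
Qed.

Definition pairs_density (H : sgraph) (s : seq nat) : R :=
  hom_density R (edge_graph (edge_bound (pairs s)) (pairs s)) H.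

(** The map f sends the pair coded by n to an edge; a number that codes no
    increasing pair imposes no condition. *)
Definition hit (H : sgraph) K (f : {ffun 'I_K.+1 -> H}) (n : nat) : bool :=
  if pickle_inv n is Some p then
    (p.1 < p.2)%N ==> adj (f (inord p.1)) (f (inord p.2))
  else true.

Definition below_bound K (s : seq nat) : Prop :=
  forall p, p \in pairs s -> (p.1 <= K)%N && (p.2 <= K)%N.

Lemma pairs_densityE (H : sgraph) K s : below_bound K s ->
  pairs_density H s = favg (fun f : {ffun 'I_K.+1 -> H} => (all (hit f) s)%:R).
Proof.
move=> bs; have bK : (edge_bound (pairs s) <= K)%N.
  by apply/bigmax_leqP_seq => p ps _; rewrite geq_max bs.
rewrite /pairs_density -(@hom_density_edge_graph _ K (pairs s) (pairs s))//; last first.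
  by move=> p; exact: edge_boundP.
rewrite hom_densityE /favg; congr (_ / _); apply: eq_bigr => f _; congr (_%:R); congr nat_of_bool.
apply/idP/allP.
  move=> /forallP hom n ns; rewrite /hit; case E : (pickle_inv n) => [[i j]|]//=.
  apply/implyP => ij.
  have pn : pickle (i, j) = n by have := @pickle_invK (nat * nat)%type n; rewrite E.
  have ps : (i, j) \in pairs s by rewrite mem_pairs ij /= pn.
  have /andP[/= iK jK] := bs _ ps.
  move/forallP: (hom (inord i)) => /(_ (inord j))/implyP; apply.
  apply/andP; split; last by rewrite !inordK// ps.
  by apply/eqP => /(congr1 val) /=; rewrite !inordK// => e; rewrite e ltnn in ij.
move=> h; apply/forallP => x; apply/forallP => y; apply/implyP => /andP[xy].
have key (u v : 'I_K.+1) : ((u : nat, v : nat) \in pairs s) -> adj (f u) (f v).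
  rewrite mem_pairs /= => /andP[uv /h]; rewrite /hit pickleK_inv /= uv /=.
  by rewrite !inord_val.
by case/orP => /key //; rewrite adj_sym.
Qed.

Lemma favgB (F H : finType) (h1 h2 : {ffun F -> H} -> R) :
  favg (fun f => h1 f - h2 f) = favg h1 - favg h2.
Proof. by rewrite /favg sumrB mulrBl. Qed.

(** In a finite graph inclusion and exclusion computes the proportion of the
    maps that hit A and miss Z, which is nonnegative; nonnegativity persists in
    the limit. *)
Lemma incl_excl_densityE (H : sgraph) K A Z : below_bound K (A ++ Z) ->
  incl_excl (pairs_density H) A Z =
  favg (fun f : {ffun 'I_K.+1 -> H} => (all (hit f) A && all (fun n => ~~ hit f n) Z)%:R).
Proof.
elim: Z A => [|z Z IH] A b /=.
  rewrite (@pairs_densityE _ K); last by move: b; rewrite cats0.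
  by congr favg; apply/funext => f; rewrite andbT.
have sub s t : {subset s <= t} -> below_bound K t -> below_bound K s.
  by move=> st bt p ps; apply: bt; move: ps; rewrite !mem_pairs => /andP[-> /st].
rewrite !IH; last 2 first.
- by apply: sub b => x; rewrite /= !(mem_cat, inE); case: (x == z); case: (x \in A); case: (x \in Z).
- by apply: sub b => x; rewrite /= !(mem_cat, inE); case: (x == z); case: (x \in A); case: (x \in Z).
rewrite -favgB; congr favg; apply/funext => f /=.
by case: (hit f z); case: (all _ A); case: (all _ Z); rewrite /= ?subrr ?subr0.
Qed.

Lemma incl_excl_density_ge0 (H : sgraph) A Z : 0 <= incl_excl (pairs_density H) A Z.
Proof.
rewrite (@incl_excl_densityE _ (edge_bound (pairs (A ++ Z)))).
  by apply: favg_ge0 => f; rewrite ler0n.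
by move=> p; exact: edge_boundP.
Qed.

Context (Gam : graph_limit R).

Definition pairs_limit (s : seq nat) : R := Gam (edge_graph (edge_bound (pairs s)) (pairs s)).

Lemma incl_excl_limit_ge0 A Z : 0 <= incl_excl pairs_limit A Z.
Proof.
have [G [_ cG]] := t_limP Gam.
have c B Y : incl_excl (pairs_density (G n)) B Y @[n --> \oo] --> incl_excl pairs_limit B Y.
  elim: Y B => [|y Y IH] B /=; first exact: cG.
  by apply: cvgB; exact: IH.
rewrite -(cvg_lim (@norm_hausdorff _ R^o) (c A Z)).
apply: limr_ge; first by apply/cvg_ex; eexists; exact: c.
by apply: nearW => n; exact: incl_excl_density_ge0.
Qed.

Lemma pairs_limit_embed (F : graph) (f : F -> nat) s : injective f ->
    (forall x y : F, adj x y -> (f x < f y)%N -> (f x, f y) \in pairs s) ->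
    (forall p, p \in pairs s -> exists x y : F, [/\ adj x y, f x = p.1 & f y = p.2]) ->
  pairs_limit s = Gam F.
Proof.
move=> inj_f h1 h2; pose K := maxn (edge_bound (pairs s)) (\max_(x : F) f x).
have -> : pairs_limit s = Gam (edge_graph K (pairs s)).
  have [G [_ cG]] := t_limP Gam.
  rewrite /pairs_limit -(cvg_lim (@norm_hausdorff _ R^o) (cG (edge_graph K (pairs s)))).
  apply/esym/(cvg_lim (@norm_hausdorff _ R^o)).
  rewrite (_ : (fun n => _) = fun n => hom_density R (edge_graph (edge_bound (pairs s)) (pairs s)) (G n)).
    exact: cG.
  apply/funext => n; apply: hom_density_edge_graph => //; last exact: leq_maxl.
  by move=> p; exact: edge_boundP.
have fK x : (f x < K.+1)%N.
  by rewrite ltnS; apply: leq_trans (leq_maxr _ _); exact: leq_bigmax.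
apply: (@graph_limit_embed R Gam F (edge_graph K (pairs s)) (fun x => Ordinal (fK x))).
- by move=> x y /(congr1 val) /= /inj_f.
- move=> x y xy; have nxy : f x != f y.
    by apply: contraTneq xy => /inj_f ->; rewrite adj_irr.
  apply/andP; split; first by apply: contraNneq nxy => /(congr1 val) /= ->.
  move: nxy; rewrite neq_ltn /= => /orP[] h; apply/orP; [left|right]; apply: h1 => //.
  by rewrite adj_sym.
- move=> u v /andP[_ /orP[]] /h2[x [y [xy e1 e2]]].
    by exists x, y; split=> //; exact: val_inj.
  by exists y, x; split; rewrite 1?adj_sym//; exact: val_inj.
Qed.

Lemma pairs_limit_set s t : s =i t -> pairs_limit s = pairs_limit t.
Proof.
move=> st; have e p : (p \in pairs s) = (p \in pairs t) by rewrite !mem_pairs st.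
have bd E E' : E =i E' -> (edge_bound E <= edge_bound E')%N.
  move=> EE'; apply/bigmax_leqP_seq => p pE _; rewrite geq_max edge_boundP//.
  by rewrite -EE'.
have be : edge_bound (pairs s) = edge_bound (pairs t).
  by apply/eqP; rewrite eqn_leq !bd// => p; rewrite e.
have [G [_ cG]] := t_limP Gam.
rewrite /pairs_limit be -(cvg_lim (@norm_hausdorff _ R^o) (cG (edge_graph _ (pairs s)))).
apply: (cvg_lim (@norm_hausdorff _ R^o)).
rewrite (_ : (fun n => _) = fun n => hom_density R (edge_graph (edge_bound (pairs t)) (pairs t)) (G n)).
  exact: cG.
apply/funext => n; apply: (@hom_density_edge_graph _ _ (pairs t) (pairs s)) => [p|p|]//.
exact: edge_boundP.
Qed.

Lemma pairs_limit0 : pairs_limit [::] = 1.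
Proof.
apply/eqP; rewrite eq_le graph_limit_le1/=.
apply: (@graph_limit_transfer _ Gam (edge_graph _ _) (fun x => 1 <= x)); first exact: closed_ge.
move=> H H0; rewrite -/(pairs_density H [::]) (@pairs_densityE H 0); last by [].
rewrite /favg /= sumr_const.
by rewrite divff// pnatr_eq0 -lt0n card_ffun expn_gt0 H0.
Qed.

End law_of_limit.

Section graph_of_events.
Context d (T : measurableType d) (B : nat -> set T).
Hypothesis mB : forall n, measurable (B n).

Definition event_adj (u : T) (i j : nat) : bool :=
  `[< (i < j)%N /\ B (pickle (i, j)) u >] || `[< (j < i)%N /\ B (pickle (j, i)) u >].

Lemma event_adj_sym u x y : event_adj u x y = event_adj u y x.
Proof. by rewrite /event_adj orbC. Qed.

Lemma event_adj_irr u x : event_adj u x x = false.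
Proof. by rewrite /event_adj !asboolF// ltnn => -[]. Qed.

Definition event_graph u : ngraph := NGraph (event_adj_sym u) (event_adj_irr u).

Lemma measurable_event_graph : measurable_fun setT event_graph.
Proof.
apply: measurable_to_ngraph => i j.
rewrite (_ : [set x | _] = (if (i < j)%N then B (pickle (i, j)) else set0) `|`
    (if (j < i)%N then B (pickle (j, i)) else set0)).
  by apply: measurableU; case: ifP.
apply/seteqP; split=> u /=; rewrite /event_adj.
  by move=> /orP[] /asboolP[ij Bu]; [left|right]; rewrite ij.
by case=> h; apply/orP; [left|right]; apply/asboolP; move: h; case: ifP.
Qed.

End graph_of_events.

(** The edge between i < j is the event whose number codes the pair (i, j). *)
Lemma random_graph_exists (R : realType) (Gam : graph_limit R) :
  exists L : probability ngraph R, samples L Gam.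
Proof.
have [P [B [mB PB]]] := prescribed_intersections (@pairs_limit_set R Gam)
  (pairs_limit0 Gam) (@incl_excl_limit_ge0 R Gam).
pose X : {mfun measurableTypeR R >-> ngraph} :=
  HB.pack (event_graph B) (isMeasurableFun.Build _ _ _ _ _ (measurable_event_graph mB)).
exists (distribution P X) => F f inj_f.
pose s := [seq pickle (f p.1, f p.2) |
  p <- enum [pred p : F * F | adj p.1 p.2 && (f p.1 < f p.2)%N]].
have s_pairs p : p \in pairs s -> exists x y : F, [/\ adj x y, f x = p.1 & f y = p.2].
  rewrite mem_pairs => /andP[_ /mapP[[x y]]]; rewrite mem_enum inE /= => /andP[xy _].
  by move=> /(pcan_inj pickleK) ->; exists x, y.
have pairs_s x y : adj x y -> (f x < f y)%N -> (f x, f y) \in pairs s.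
  move=> xy fxy; rewrite mem_pairs fxy; apply/mapP; exists (x, y) => //.
  by rewrite mem_enum inE /= xy.
rewrite -(pairs_limit_embed Gam inj_f pairs_s s_pairs) -PB.
congr (P _); apply/seteqP; split=> u /=.
  move=> h _ /mapP[[x y] + ->]; rewrite mem_enum inE /= => /andP[xy fxy].
  have /orP[/asboolP[]//|/asboolP[]] := h _ _ xy.
  by rewrite ltnNge ltnW.
move=> h x y xy; have nxy : f x != f y.
  by apply: contraTneq xy => /inj_f ->; rewrite adj_irr.
move: nxy; rewrite neq_ltn => /orP[] fxy; apply/orP; [left|right]; apply/asboolP; split=> //;
  apply: h; apply/mapP.
- by exists (x, y) => //; rewrite mem_enum inE /= xy.
- by exists (y, x) => //; rewrite mem_enum inE /= adj_sym xy.
Qed.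

(** * Thinning *)

Section bernoulli_events.
Context (R : realType) (alpha : R).
Hypothesis alpha01 : 0 < alpha <= 1.

Definition bernoulli_weight (s : seq nat) : R := alpha ^+ size (undup s).

Lemma bernoulli_weight_set s t : s =i t -> bernoulli_weight s = bernoulli_weight t.
Proof. by move=> /perm_undup/perm_size e; rewrite /bernoulli_weight e. Qed.

Lemma bernoulli_incl_excl A Z : incl_excl bernoulli_weight A Z =
  (~~ has (mem A) Z)%:R * alpha ^+ size (undup A) * (1 - alpha) ^+ size (undup Z).
Proof.
elim: Z A => [|z Z IH] A /=; first by rewrite mul1r expr0 mulr1.
have [zA|zA] /= := boolP (z \in A).
  rewrite (@incl_excl_set _ _ bernoulli_weight_set (z :: A) A).
    by rewrite subrr !mul0r.
  by move=> x; rewrite inE; case: eqP => // ->.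
have e : incl_excl bernoulli_weight (z :: A) Z =
  (~~ has (mem A) Z && (z \notin Z))%:R * alpha ^+ (size (undup A)).+1 * (1 - alpha) ^+ size (undup Z).
  rewrite IH /= (negbTE zA) /=; congr (_%:R * _ * _); congr nat_of_bool.
  have -> : has (mem (z :: A)) Z = has (mem A) Z || has (pred1 z) Z.
    by rewrite -has_predU; apply: eq_has => x; rewrite /= inE orbC.
  by rewrite negb_or has_pred1.
rewrite e IH; have [zZ|zZ] /= := boolP (z \in Z).
  by rewrite andbF !mul0r subr0.
by rewrite andbT exprS [in RHS]exprS; ring.
Qed.

(** Independent events of probability alpha. Infinitely many of them occur,
    since d of them fail together with probability (1 - alpha)^d. *)
Lemma bernoulli_events : exists (P : probability (measurableTypeR R) R)
    (B : nat -> set (measurableTypeR R)),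
  [/\ forall n, measurable (B n),
    forall s, P [set u | forall n, n \in s -> B n u] = (bernoulli_weight s)%:E &
    {ae P, forall u, infinite_set [set n | B n u]}].
Proof.
have /andP[a0 a1] := alpha01.
have [||P [B [mB PB]]] := prescribed_intersections bernoulli_weight_set.
- by rewrite /bernoulli_weight expr0.
- by move=> A Z; rewrite bernoulli_incl_excl !mulr_ge0 ?exprn_ge0 ?subr_ge0// ltW.
exists P, B; split=> //.
pose on (s : seq nat) := [set u | forall n, n \in s -> B n u].
pose off (s : seq nat) := [set u | forall n, n \in s -> ~ B n u].
have m_on s : measurable (on s).
  apply: (@measurable_all_count nat _ (measurableTypeR R) (fun n => [set u | n \in s -> B n u])) => n.
  exact: measurable_imply.
have m_off s : measurable (off s).
  apply: (@measurable_all_count nat _ (measurableTypeR R) (fun n => [set u | n \in s -> ~ B n u])) => n.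
  by apply: measurable_imply; exact: measurableC.
have P_onoff A Z : P (on A `&` off Z) = (incl_excl bernoulli_weight A Z)%:E.
  elim: Z A => [|z Z IH] A /=.
    rewrite (_ : off [::] = setT) ?setIT; first exact: PB.
    by apply/seteqP; split.
  have -> : on A `&` off (z :: Z) = (on A `&` off Z) `\` (on (z :: A) `&` off Z).
    apply/seteqP; split=> u.
      move=> [onu offu]; split; last by move=> [/(_ z (mem_head _ _)) Bz _]; apply: (offu z) => //; exact: mem_head.
      by split=> // n nZ; apply: offu; rewrite inE nZ orbT.
    move=> [[onu offu] nn]; split=> // n; rewrite inE => /predU1P[->|/offu//] Bz.
    by apply: nn; split=> // k; rewrite inE => /predU1P[->//|/onu].
  rewrite measureD; [|exact: measurableI|exact: measurableI|]; last first.
    by rewrite (le_lt_trans (probability_le1 _ _)) ?ltry//; exact: measurableI.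
  rewrite (_ : (on A `&` off Z) `&` (on (z :: A) `&` off Z) = on (z :: A) `&` off Z).
    by rewrite /= !IH -EFinB.
  apply/seteqP; split=> u; first by move=> [_].
  move=> [onu offu]; split=> //; split=> // n nA; apply: onu.
  by rewrite inE nA orbT.
have P_off n d : P (off (iota n d)) = ((1 - alpha) ^+ d)%:E.
  have -> : off (iota n d) = on [::] `&` off (iota n d).
    by rewrite (_ : on [::] = setT) ?setTI//; apply/seteqP; split.
  rewrite P_onoff bernoulli_incl_excl /= expr0 mulr1 undup_id ?iota_uniq// size_iota.
  by rewrite (_ : has _ _ = false) ?mul1r//; elim: (iota n d).
have : {ae P, forall u, forall n, exists m, (n <= m)%N /\ B m u}.
  apply: ae_all_count => n; apply: negligible_small => e e0.
  have c : (1 - alpha) ^+ d @[d --> \oo] --> 0 by apply: cvg_expr; rewrite ger0_norm; lra.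
  have [d _ /(_ d)] : \forall d \near \oo, `|0 - (1 - alpha) ^+ d| <= e.
    by move/cvgrPdist_le : c; apply.
  rewrite /= sub0r normrN => /(_ (leqnn _)) de.
  exists (off (iota n d)); last first.
    by rewrite P_off lee_fin; apply: le_trans de; exact: ler_norm.
  split=> // u nB m; rewrite mem_iota => /andP[nm _] Bm; apply: nB.
  by exists m.
apply: filterS => u h /finite_seqP[s sE].
have [m [sm Bm]] := h (\max_(x <- s) x).+1.
have ms : m \in s by move: Bm; rewrite -[B m u]/([set n | B n u] m) sE.
by move: sm; rewrite ltnNge (big_rem m)//= leq_maxl.
Qed.

End bernoulli_events.

Section thinning.
Context (g : ngraph) (A : set nat).
Definition thin_adj i j : bool := [&& nadj g i j, `[< A i >] & `[< A j >]].
Lemma thin_adj_sym x y : thin_adj x y = thin_adj y x.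
Proof. by rewrite /thin_adj nadj_sym; congr (_ && _); rewrite andbC. Qed.
Lemma thin_adj_irr x : thin_adj x x = false.
Proof. by rewrite /thin_adj nadj_irr. Qed.
Definition thin : ngraph := NGraph thin_adj_sym thin_adj_irr.

Lemma conn_thin_pull f a b : (forall n, A (f n)) ->
  conn (pull f g) a b -> conn thin (f a) (f b).
Proof.
move=> Af cab; apply: (@conn_pull f thin a b).
have -> // : pull f thin = pull f g.
by apply: ngraph_eq => i j; rewrite /= /pull_adj /= /thin_adj !asboolT ?andbT.
Qed.

Lemma nonisolated_thin i : nonisolated thin i -> A i.
Proof. by move=> [j /and3P[_ /asboolP]]. Qed.

End thinning.

Section thinned_law.
Context (R : realType).

Lemma ae_probability1 d (T : measurableType d) (L : probability T R) (C : set T) :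
  measurable C -> {ae L, forall x, C x} -> L C = 1%E.
Proof.
move=> mC aeC; have : L (~` C) = 0%E.
  by apply/negligibleP => //; exact: measurableC.
rewrite probability_setC// => h.
by rewrite -[L C]adde0 -h addeC subeK// fin_num_measure.
Qed.

Lemma setI_full_eq d (T : measurableType d) (L : probability T R) (S C : set T) :
  measurable S -> measurable C -> L C = 1%E -> L (S `&` C) = L S.
Proof.
move=> mS mC C1; rewrite -[in RHS](setIT S).
by apply: setI_null_eq => //; rewrite probability_setT.
Qed.

Lemma infinite_enumeration (A : set nat) : infinite_set A ->
  exists f : nat -> nat, [/\ injective f, forall n, A (f n) & forall a, A a -> exists n, f n = a].
Proof.
move=> infA; have := eq_card_nat (countableP A) infA.
rewrite card_eq_sym => /card_set_bijP[f [fun_f inj_f surj_f]]; exists f; split.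
- by move=> i j; apply: inj_f; rewrite inE.
- by move=> n; exact: fun_f.
- by move=> a /surj_f[n _ <-]; exists n.
Qed.

Context (Gam : graph_limit R) (alpha : R).
Hypothesis conG : ~ disconnected_limit Gam.
Hypothesis alpha01 : 0 < alpha <= 1.

(** The graph of a connected limit, thinned to a random set of vertices. This
    set is almost surely infinite, hence the range of an injection, along which
    the graph has the same law: the retained vertices are almost surely
    connected to each other by paths of retained vertices. So any vertices are
    joined as soon as they are retained. *)
Lemma thinned_law_exists : exists m : {measure set ngraph -> \bar R},
  (forall (F : graph) (f : F -> nat), connected_graph F -> has_edge F -> injective f ->
     m (copy f) = (alpha ^+ #|F| * Gam F)%:E) /\
  (forall F : graph, (1 < #|F|)%N ->
     m (joined (edge_code F) (iota 0 #|F|)) = (alpha ^+ #|F| * Gam F)%:E).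
Proof.
have [L LG] := random_graph_exists Gam.
have [P [B [mB PB infB]]] := bernoulli_events alpha01.
pose A u : set nat := [set n | B n u].
pose X (x : measurableTypeR R * ngraph) : ngraph := thin x.2 (A x.1).
have mX : measurable_fun setT X.
  apply: measurable_to_ngraph => i j.
  rewrite (_ : [set x | _] = (B i `&` B j) `*` [set g | nadj g i j]).
    by apply: measurableX; [exact: measurableI|exact: measurable_edge].
  apply/seteqP; split=> -[u g] /=; rewrite /thin_adj /=.
    by move=> /and3P[-> /asboolP Bi /asboolP Bj].
  by move=> [[Bi Bj] ->]; rewrite !asboolT.
pose Xm : {mfun (measurableTypeR R * ngraph)%type >-> ngraph} :=
  HB.pack X (isMeasurableFun.Build _ _ _ _ _ mX).
exists (pushforward (P \x L)%E Xm); split.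
  move=> F f cF [x0 [y0 e0]] inj_f; rewrite /pushforward /=.
  (* every vertex of F lies on an edge, so a copy in the thinned graph is retained
     *)
  have nbr (x : F) : exists y : F, adj x y.
    have [->|nx] := eqVneq x x0; first by exists y0.
    have /connectP[[|z p] /= pth lst] := cF x x0; first by rewrite lst eqxx in nx.
    by exists z; case/andP: pth.
  pose s := [seq f x | x <- enum F].
  transitivity ((P \x L)%E ([set u | forall n, n \in s -> B n u] `*` copy f)).
    congr ((P \x L)%E _); apply/seteqP; split=> -[u g] /=; rewrite /X /=.
      move=> h; split=> [n /mapP[x _ ->]|x y xy]; last by have /and3P[] := h _ _ xy.
      by have [y /h/and3P[_ /asboolP]] := nbr x.
    move=> [on gf] x y xy /=; rewrite /thin_adj gf//= !asboolT//;
      by apply: on; apply: map_f; rewrite mem_enum.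
  have m_on : measurable [set u | forall n, n \in s -> B n u].
    apply: (@measurable_all_count nat _ (measurableTypeR R) (fun n => [set u | n \in s -> B n u])) => n.
    exact: measurable_imply.
  rewrite product_measure1E//=; last exact: measurable_copy.
  have us : uniq s by rewrite map_inj_uniq// enum_uniq.
  have ss : size s = #|F| by rewrite size_map -cardE.
  by rewrite PB (LG _ _ inj_f) -EFinM /bernoulli_weight undup_id// ss.
move=> F F1; set k := #|F|; set e := edge_code F; rewrite /pushforward /=.
have mQ : measurable (joined e (iota 0 k)) by exact: measurable_joined.
have mXQ : measurable (X @^-1` joined e (iota 0 k)).
  by have := @mX measurableT _ mQ; rewrite setTI.
pose on := [set u | forall n, n \in iota 0 k -> B n u].
have m_on : measurable on.
  apply: (@measurable_all_count nat _ (measurableTypeR R) (fun n => [set u | n \in iota 0 k -> B n u])) => n.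
  exact: measurable_imply.
have Lsees : L (sees e (iota 0 k)) = (Gam F)%:E.
  have inj_r : injective (fun x : F => enum_rank x : nat).
    by move=> x y /val_inj/enum_rank_inj.
  rewrite -(LG _ _ inj_r); congr (L _); apply/seteqP; split=> g.
    move=> /(sees_copy g (size_iota _ _)) h x y /h; rewrite !nth_iota//.
  by move=> h; apply/sees_copy; rewrite ?size_iota// => x y xy; rewrite !nth_iota// !add0n; exact: h.
have key : {ae P, forall u, L (xsection (X @^-1` joined e (iota 0 k)) u) =
    ((\1_on u : R)%:E * (Gam F)%:E)%E}.
  apply: filterS infB => u infA; rewrite indic_asbool.
  have xsE : xsection (X @^-1` joined e (iota 0 k)) u =
      [set g | joined e (iota 0 k) (thin g (A u))].
    by apply/seteqP; split=> g; rewrite /xsection /= inE.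
  rewrite xsE; case: asboolP => [onu|noff]; last first.
    rewrite mul0e (_ : [set g | _] = set0) ?measure0//.
    apply/seteqP; split=> // g [_ Jc]; apply: noff => n nk.
    apply: (@nonisolated_thin g (A u)); apply/nonisolatedP.
    have [n' [n'k n'n]] : exists n', n' \in iota 0 k /\ n' != n.
      case: n {nk} => [|n]; first by exists 1%N; rewrite mem_iota.
      by exists 0%N; rewrite mem_iota /= add0n (ltn_trans _ F1).
    by exists n' => //; exact: Jc.
  rewrite mul1e -Lsees.
  have [f [inj_f Af fA]] := infinite_enumeration infA.
  pose C := [set g : ngraph | forall a b, conn g a b].
  have mC : measurable C.
    apply: (@measurable_all_count nat _ ngraph (fun a => [set g | forall b, conn g a b])) => a.
    by apply: (@measurable_all_count nat _ ngraph (fun b => [set g | conn g a b])) => b;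
      exact: measurable_conn.
  have C1 : L (pull f @^-1` C) = 1%E.
    by rewrite (samples_pull LG)//; apply: ae_probability1 => //; exact: ae_connected LG conG.
  have mpC : measurable (pull f @^-1` C).
    by rewrite -[X in measurable X]setTI; exact: measurable_pull.
  have mxs : measurable [set g | joined e (iota 0 k) (thin g (A u))].
    by rewrite -xsE; exact: measurable_xsection.
  have mS := measurable_sees e (iota 0 k).
  apply/eqP; rewrite eq_le; apply/andP; split.
    apply: le_measure; rewrite ?inE// => g [/allP sg _]; apply/allP => p /sg.
    by move=> /and3P[-> -> /and3P[]].
  rewrite -(setI_full_eq mS mpC C1).
  apply: le_measure; rewrite ?inE//; first exact: measurableI.
  move=> g [/allP sg cg]; split.
    apply/allP => p /sg /and3P[p1 p2 ep]; rewrite p1 p2 /= /thin_adj ep !asboolT//;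
      by apply: onu; apply: mem_nth.
  move=> x y /onu/fA[a <-] /onu/fA[b <-]; apply: conn_thin_pull => //; exact: cg.
apply: (@etrans _ _ (\int[P]_u ((\1_on u : R)%:E * (Gam F)%:E))%E).
  apply: ae_eq_integral => //.
  - exact: measurable_fun_xsection.
  - apply: emeasurable_funM => //; apply/measurable_EFinP; exact: measurable_indic.
  - by apply: filterS key => u hu _; exact: hu.
rewrite ge0_integralZr//; last first.
- by rewrite lee_fin graph_limit_ge0.
- by apply/measurable_EFinP; exact: measurable_indic.
have Pon : P on = (alpha ^+ k)%:E.
  by rewrite PB /bernoulli_weight undup_id ?iota_uniq// size_iota.
by rewrite integral_indic//= setIT Pon -EFinM.
Unshelve. all: exact: mX.
Qed.

End thinned_law.

(** * Connected vertices in a direct sum *)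

Section measures_on_unions.
Context d (T : measurableType d) (R : realType).
Context (m1 m2 : {measure set T -> \bar R}) (Pi : set (set T)).
Hypothesis mPi : forall A, Pi A -> measurable A.
Hypothesis PiI : forall A B, Pi A -> Pi B -> Pi (A `&` B).
Hypothesis m12 : forall A, Pi A -> m1 A = m2 A.

(** Inclusion and exclusion: measures that agree on a family closed under
    intersection agree on its countable unions, even when they have different
    total masses. *)
Lemma measure_eq_bigcup (l : nat -> set T) : (forall n, Pi (l n)) ->
  m1 (\bigcup_n l n) = m2 (\bigcup_n l n).
Proof.
have fin_eq n (k : nat -> set T) : (forall n, Pi (k n)) ->
    m1 (\big[setU/set0]_(i < n) k i) = m2 (\big[setU/set0]_(i < n) k i).
  elim: n k => [|n IH] k Pk; first by rewrite !big_ord0 !measure0.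
  rewrite !big_ord_recr /=; apply: eq_measureU.
  - by apply: bigsetU_measurable => i _; exact: mPi.
  - exact: mPi.
  - exact: IH.
  - exact: m12.
  - by rewrite big_distrl /=; apply: (IH (fun i => k i `&` k n)) => i; exact: PiI.
move=> Pl; have ml n : measurable (l n) by exact: mPi.
pose U n := \big[setU/set0]_(i < n) l i.
have mU n : measurable (U n) by apply: bigsetU_measurable.
have ndU : nondecreasing_seq U.
  by move=> n n' nn'; apply/subsetPset; exact: subset_bigsetU.
have UE : \bigcup_n l n = \bigcup_n U n.
  apply/seteqP; split=> [x [n _ lx]|x [n _]].
    by exists n.+1 => //; rewrite /U -bigcup_mkord; exists n => //=.
  by rewrite /U -bigcup_mkord => -[i _ lx]; exists i.
have c (m : {measure set T -> \bar R}) : m \o U @ \oo --> m (\bigcup_n U n).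
  by apply: nondecreasing_cvg_mu => //; exact: bigcupT_measurable.
rewrite UE -(cvg_lim _ (c m1))// -(cvg_lim _ (c m2))//.
have e : m1 \o U = m2 \o U by apply/funext => n; exact: fin_eq.
by rewrite e.
Qed.

End measures_on_unions.

Section connected_edge_lists.
Implicit Types (e E : seq (nat * nat)) (g : ngraph).

Section list_graph.
Context (E : seq (nat * nat)).
Definition list_adj i j : bool := (i != j) && (((i, j) \in E) || ((j, i) \in E)).
Lemma list_adj_sym x y : list_adj x y = list_adj y x.
Proof. by rewrite /list_adj eq_sym orbC. Qed.
Lemma list_adj_irr x : list_adj x x = false.
Proof. by rewrite /list_adj eqxx. Qed.
Definition list_graph : ngraph := NGraph list_adj_sym list_adj_irr.
End list_graph.

Lemma conn_mono g g' i j : (forall x y, nadj g x y -> nadj g' x y) ->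
  conn g i j -> conn g' i j.
Proof.
move=> gg' [p [+ <-]]; elim: p i => [|k p IH] i /=; first by move=> _; exact: conn_refl.
by move=> /andP[/gg'/conn_edge ik /IH]; exact: conn_trans.
Qed.

(** The edges of a connected loopless graph through the vertex 0. *)
Definition rooted_edges E : Prop := forall p, p \in E ->
  [/\ p.1 != p.2, conn (list_graph E) 0 p.1 & conn (list_graph E) 0 p.2].

Lemma list_adj_sub E1 E2 x y : {subset E1 <= E2} ->
  nadj (list_graph E1) x y -> nadj (list_graph E2) x y.
Proof.
by move=> s12 /andP[xy /orP[]/s12 h]; apply/andP; split=> //; rewrite h ?orbT.
Qed.

Lemma rooted_cat E1 E2 : rooted_edges E1 -> rooted_edges E2 -> rooted_edges (E1 ++ E2).
Proof.
move=> r1 r2 p; rewrite mem_cat => /orP[/r1[a b c]|/r2[a b c]]; split=> //;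
  (apply: conn_mono; [|exact: b || exact: c]) => x y; apply: list_adj_sub => z zE;
  by rewrite mem_cat zE ?orbT.
Qed.

Lemma contains_list E g : contains E g ->
  forall x y, nadj (list_graph E) x y -> nadj g x y.
Proof.
by move=> /allP gE x y /andP[_ /orP[/gE//|/gE]]; rewrite nadj_sym.
Qed.

(** A finite certificate for [joined]. Certificates are closed under union, as
    inclusion and exclusion requires. *)
Definition joining e k E : Prop := [/\ rooted_edges E,
  forall n, (n < k)%N -> conn (list_graph E) 0 n &
  forall p, p \in e -> [/\ (p.1 < k)%N, (p.2 < k)%N & nadj (list_graph E) p.1 p.2]].

Lemma joining_cat e k E1 E2 : joining e k E1 -> joining e k E2 -> joining e k (E1 ++ E2).
Proof.
have s12 z : z \in E1 -> z \in E1 ++ E2 by move=> zE; rewrite mem_cat zE.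
move=> [r1 c1 e1] [r2 _ _]; split; first exact: rooted_cat.
  by move=> n /c1; apply: conn_mono => x y; exact: list_adj_sub.
by move=> p /e1[a b c]; split=> //; exact: list_adj_sub c.
Qed.

Lemma rooted_path g n : conn g 0 n ->
  exists E, [/\ rooted_edges E, contains E g & conn (list_graph E) 0 n].
Proof.
move=> [p [+ <-]]; elim/last_ind: p => [_|p z IH] /=.
  by exists [::]; split=> //; exact: conn_refl.
rewrite rcons_path last_rcons => /andP[/IH[E [rE gE cE]] ez].
set y := last 0%N p in cE ez *.
have yz : y != z by apply: contraTneq ez => ->; rewrite /= nadj_irr.
have sub x : x \in E -> x \in (y, z) :: E by move=> xE; rewrite inE xE orbT.
have mono a : conn (list_graph E) 0 a -> conn (list_graph ((y, z) :: E)) 0 a.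
  by apply: conn_mono => u v; exact: list_adj_sub.
have cz : conn (list_graph ((y, z) :: E)) 0 z.
  apply: conn_trans (mono _ cE) _; apply: conn_edge.
  by rewrite /= /list_adj yz mem_head.
exists ((y, z) :: E); split=> //.
  move=> q; rewrite inE => /predU1P[-> /=|/rE[a b c]]; first by split=> //; exact: mono.
  by split=> //; exact: mono.
by apply/allP => q; rewrite inE => /predU1P[->//|]; move/allP: gE; apply.
Qed.

(** Paths from 0 to the other vertices, together with the edges e, form a
    certificate. *)
Lemma joinedP e k g : (0 < k)%N ->
  joined e (iota 0 k) g <-> exists E, joining e k E /\ contains E g.
Proof.
move=> k0; split.
  move=> [/allP sg Jc].
  have [E1 [r1 g1 c1]] : exists E, [/\ rooted_edges E, contains E g &
      forall n, (n < k)%N -> conn (list_graph E) 0 n].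
    suff H m : (m <= k)%N -> exists E, [/\ rooted_edges E, contains E g &
        forall n, (n < m)%N -> conn (list_graph E) 0 n] by exact: H (leqnn k).
    elim: m => [_|m IH mk]; first by exists [::].
    have [E [r gE c]] := IH (ltnW mk).
    have [|E' [r' gE' c']] := @rooted_path g m.
      by apply: Jc; rewrite mem_iota.
    exists (E ++ E'); split; first exact: rooted_cat.
      by rewrite contains_cat.
    move=> n; rewrite ltnS leq_eqVlt => /predU1P[->|/c].
      by move: c'; apply: conn_mono => x y; apply: list_adj_sub => z zE; rewrite mem_cat zE orbT.
    by apply: conn_mono => x y; apply: list_adj_sub => z zE; rewrite mem_cat zE.
  have eg p : p \in e -> [/\ (p.1 < k)%N, (p.2 < k)%N & nadj g p.1 p.2].
    move=> /sg; rewrite !size_iota => /and3P[p1 p2].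
    by rewrite !nth_iota// !add0n.
  have ne p : p \in e -> p.1 != p.2.
    by move=> /eg[_ _]; apply: contraTneq => ->; rewrite nadj_irr.
  have mono a : conn (list_graph E1) 0 a -> conn (list_graph (e ++ E1)) 0 a.
    by apply: conn_mono => x y; apply: list_adj_sub => z zE; rewrite mem_cat zE orbT.
  exists (e ++ E1); split; last first.
    by rewrite contains_cat; split=> //; apply/allP => p /eg[].
  split.
  - move=> p; rewrite mem_cat => /orP[pe|/r1[a b c]]; last by split=> //; exact: mono.
    by have [a b _] := eg p pe; split; [exact: ne|exact/mono/c1|exact/mono/c1].
  - by move=> n /c1; exact: mono.
  - move=> p pe; have [a b _] := eg p pe; split=> //=.
    by rewrite /list_adj ne//= mem_cat -surjective_pairing pe.
move=> [E [[rE cE eE] gE]]; have sub := contains_list gE; split.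
  apply/allP => p /eE[a b c]; rewrite !size_iota a b /= !nth_iota// !add0n.
  exact: sub.
move=> x y; rewrite !mem_iota !add0n => /cE cx /cE cy.
by apply: (conn_mono sub); apply: conn_trans (conn_sym cx) cy.
Qed.

(** The vertices that E connects to 0 and the edges E form a connected graph. *)
Lemma joining_copy e k E : (1 < k)%N -> joining e k E ->
  exists (F : graph) (f : F -> nat),
    [/\ connected_graph F, has_edge F, injective f & contains E = copy f].
Proof.
move=> k1 [rE cE _]; set h := list_graph E; pose K := edge_bound E.
pose V : finType := {x : 'I_K.+1 | `[< conn h 0 x >]}.
pose a : rel V := fun x y => nadj h (val x) (val y).
have a_sym : symmetric a by move=> x y; rewrite /a nadj_sym.
have a_irr : irreflexive a by move=> x; rewrite /a nadj_irr.
have c0 : `[< conn h 0 (ord0 : 'I_K.+1) >] by apply/asboolP; exact: conn_refl.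
pose v0 : V := Sub ord0 c0.
have V0 : (0 < #|SGraph a_sym a_irr|)%N by apply/card_gt0P; exists v0.
pose F := Graph V0; pose f (x : F) : nat := val x.
have adj_bound x y : nadj h x y -> (x < K.+1)%N /\ (y < K.+1)%N.
  by case/andP=> _ /orP[] /edge_boundP/andP[/= ? ?]; rewrite !ltnS.
have lift x : conn h 0 x -> (x < K.+1)%N -> exists u : F, f u = x.
  by move=> cx xK; exists (Sub (Ordinal xK) (asboolT cx)).
have path_connect p (u : F) : path (iadj h) (f u) p ->
    exists v : F, f v = last (f u) p /\ connect (@adj F) u v.
  elim: p u => [|z p IH] u /=; first by exists u; rewrite connect0.
  move=> /andP[uz]; have cz : conn h 0 z.
    have uz' : nadj h (f u) z by [].
    apply: (@conn_trans _ _ (f u)); last exact: conn_edge.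
    by have /asboolP := valP u.
  have [w wz] := lift z cz (adj_bound (f u) z uz).2.
  rewrite -wz in uz *.
  move=> /IH[v [vl wv]]; exists v; split=> //.
  by apply: connect_trans wv; apply: connect1.
have inj_f : injective f by move=> x y /val_inj/val_inj.
have v0_connect (u : F) : connect (@adj F) v0 u.
  have /asboolP[p [pp pl]] := valP u.
  have [v [vl cv]] := path_connect p v0 pp.
  by rewrite (_ : u = v)//; apply: inj_f; rewrite vl.
have sym_c : connect_sym (@adj F) by apply: sym_connect_sym; exact: a_sym.
exists F, f; split=> //.
- move=> x y; apply: connect_trans (v0_connect y).
  by rewrite sym_c.
- have [[|z p] [/= pp pl]] := cE 1%N k1; first by [].
  move/andP: pp => [e0 _]; have {}e0 : nadj h 0 z by [].
  have bz := (adj_bound _ _ e0).2.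
  have [w wz] := lift z (conn_edge e0) bz.
  by exists v0, w; rewrite /= /a -/(f w) wz.
- apply/seteqP; split=> g.
    by move=> gE x y; exact: contains_list gE _ _.
  move=> fg; apply/allP => p pE; have [ne c1 c2] := rE p pE.
  have /andP[b1 b2] := edge_boundP pE.
  have [u up] := lift _ c1 b1; have [v vp] := lift _ c2 b2.
  have := fg u v; rewrite up vp; apply.
  by rewrite /= /a -/(f u) -/(f v) up vp /= /list_adj ne -surjective_pairing pE.
Qed.

End connected_edge_lists.

Section join_prob_of_direct_sum.
Context (R : realType) (L : probability ngraph R) (Gam : graph_limit R).
Context (M : option nat) (alpha : nat -> R) (Gammas : nat -> graph_limit R).

(** The sum of the thinned laws of the summands and the law of the direct sum
    give the same mass to every copy of a connected graph with an edge. The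
    event [joined] is a countable union of such copies, so they give it the same
    mass too. *)
Lemma join_prob_direct_sum (F : graph) : samples L Gam ->
    is_decomposition Gam M alpha Gammas -> (1 < #|F|)%N ->
  (join_prob L (edge_code F) #|F|)%:E =
    \esum_(i in [set i | below M i]) (alpha i ^+ #|F| * Gammas i F)%:E.
Proof.
move=> LG [conG a_gt0 [a_ge0 a_sum GamE]] F1.
have a_le1 i : below M i -> alpha i <= 1.
  move=> bi; rewrite -lee_fin; apply: le_trans a_sum.
  rewrite /weight_sum; apply: esum_ge; exists [set i]; last by rewrite fsbig_set1.
  by split=> // j ->.
have /choice[m hm] : forall i, exists m : {measure set ngraph -> \bar R},
    (below M i ->
      (forall (F : graph) (f : F -> nat), connected_graph F -> has_edge F ->
         injective f -> m (copy f) = (alpha i ^+ #|F| * Gammas i F)%:E) /\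
      (forall F : graph, (1 < #|F|)%N ->
         m (joined (edge_code F) (iota 0 #|F|)) = (alpha i ^+ #|F| * Gammas i F)%:E)) /\
    (~~ below M i -> forall X, m X = 0%E).
  move=> i; have [bi|nbi] := boolP (below M i); last first.
    by exists mzero; split.
  have ai : 0 < alpha i <= 1 by rewrite a_gt0//= a_le1.
  by have [m hm] := thinned_law_exists (conG i bi) ai; exists m; split.
pose mu := mseries m 0.
have muE X (v : nat -> R) : (forall i, below M i -> m i X = (v i)%:E) ->
    mu X = \esum_(i in [set i | below M i]) (v i)%:E.
  move=> hv; rewrite /mu /mseries nneseries_esumT//.
  rewrite [RHS]esum_mkcond; apply: eq_esum => i _.
  case: ifPn => [|]; first by rewrite inE => /hv.
  by rewrite notin_setE /= => /negP nb; have [_ ->] := hm i.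
set k := #|F|; set e := edge_code F.
have k0 : (0 < k)%N by exact: ltnW.
pose Pi : set (set ngraph) := [set A | A = set0 \/ exists E, joining e k E /\ A = contains E].
have mPi A : Pi A -> measurable A.
  by move=> [->//|[E [_ ->]]]; exact: measurable_contains.
have PiI A B : Pi A -> Pi B -> Pi (A `&` B).
  move=> [->|[E1 [j1 ->]]]; first by left; rewrite set0I.
  move=> [->|[E2 [j2 ->]]]; first by left; rewrite setI0.
  by right; exists (E1 ++ E2); rewrite contains_cat; split=> //; exact: joining_cat.
have LmuPi A : Pi A -> L A = mu A.
  move=> [->|[E [jE ->]]]; first by rewrite !measure0.
  have [F' [f [cF eF inj_f ->]]] := joining_copy F1 jE.
  rewrite (LG _ _ inj_f) GamE// (muE _ (fun i => alpha i ^+ #|F'| * Gammas i F'))// => i bi.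
  by have [h _] := hm i; have [h1 _] := h bi; exact: h1.
pose l n : set ngraph := if @unpickle (seq (nat * nat)) n is Some E then
  (if `[< joining e k E >] then contains E else set0) else set0.
have Pl n : Pi (l n).
  rewrite /l; case: unpickle => [E|]; last by left.
  by case: asboolP => jE; [right; exists E|left].
have lE : joined e (iota 0 k) = \bigcup_n l n.
  apply/seteqP; split=> g.
    move=> /(joinedP _ _ k0)[E [jE gE]]; exists (pickle E) => //.
    by rewrite /l pickleK asboolT.
  move=> [n _]; rewrite /l; case: unpickle => // E.
  by case: asboolP => // jE gE; apply/joinedP => //; exists E.
have mJ := @measurable_joined e (iota 0 k).
rewrite /join_prob fineK ?fin_num_measure// {1}lE.
rewrite (measure_eq_bigcup mPi PiI LmuPi Pl) -lE.
apply: muE => i bi; have [h _] := hm i; have [_ h2] := h bi; exact: h2.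
Qed.

End join_prob_of_direct_sum.

(** * Uniqueness of weighted families of limits *)

(** Isolated vertices raise the number of vertices of F without changing its
    density. *)
Section padding.
Context (F : graph) (d : nat).
Definition pad_adj : rel (F + 'I_d)%type := fun u v =>
  match u, v with inl x, inl y => adj x y | _, _ => false end.
Lemma pad_adj_sym : symmetric pad_adj.
Proof. by move=> [x|x] [y|y] //=; rewrite adj_sym. Qed.
Lemma pad_adj_irr : irreflexive pad_adj.
Proof. by move=> [x|x] //=; rewrite adj_irr. Qed.
Lemma pad_gt0 : (0 < #|SGraph pad_adj_sym pad_adj_irr|)%N.
Proof. by rewrite /= card_sum addn_gt0 graph_gt0. Qed.
Definition pad : graph := Graph pad_gt0.

Lemma card_pad : #|pad| = (#|F| + d)%N.
Proof. by rewrite /= card_sum card_ord. Qed.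

Lemma graph_limit_pad (R : realType) (Gam : graph_limit R) : Gam pad = Gam F.
Proof.
apply: (@graph_limit_embed R Gam F pad inl) => //.
- by move=> x y [].
- by move=> [x|x] [y|y] //= xy; exists x, y.
Qed.
End padding.

Section point_graph.
Lemma point_adj_irr : irreflexive (fun _ _ : unit => false). Proof. by []. Qed.
Lemma point_adj_sym : symmetric (fun _ _ : unit => false). Proof. by []. Qed.
Lemma point_gt0 : (0 < #|SGraph point_adj_sym point_adj_irr|)%N.
Proof. by rewrite /= card_unit. Qed.
Definition point_graph : graph := Graph point_gt0.

Lemma graph_limit_point (R : realType) (Gam : graph_limit R) : Gam point_graph = 1.
Proof.
apply/eqP; rewrite eq_le graph_limit_le1/=.
apply: (@graph_limit_transfer _ Gam point_graph (fun x => 1 <= x)); first exact: closed_ge.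
move=> H H0; rewrite hom_densityE /favg (eq_bigr (fun=> 1)).
  by rewrite sumr_const divff// pnatr_eq0 -lt0n card_ffun expn_gt0 H0.
move=> f _; rewrite (_ : is_hom f = true)//.
by apply/forallP => x; apply/forallP.
Qed.
End point_graph.

Section selection.
Implicit Types (P : pred nat).

Definition count_below P n : nat := \sum_(i < n) P i.

Lemma count_belowS P n : count_below P n.+1 = (count_below P n + P n)%N.
Proof. by rewrite /count_below big_ord_recr. Qed.

Lemma count_below_mono P n n' : (n <= n')%N -> (count_below P n <= count_below P n')%N.
Proof.
move=> /subnK <-; elim: (n' - n)%N => // k IH.
by rewrite addSn count_belowS (leq_trans IH)// leq_addr.
Qed.

Lemma select_exists P n r : (r < count_below P n)%N ->
  exists i, [/\ (i < n)%N, P i & count_below P i = r].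
Proof.
elim: n => [|n IH]; first by rewrite /count_below big_ord0.
rewrite count_belowS; have [/IH[i [ltin Pi ci]] _|ge] := ltnP r (count_below P n).
  by exists i; split=> //; exact: ltnW.
case: (boolP (P n)) => Pn; last by rewrite addn0 ltnNge ge.
rewrite addn1 ltnS => le; exists n; split=> //.
by apply/eqP; rewrite eqn_leq ge le.
Qed.

Lemma select_unique P i j : P i -> P j -> count_below P i = count_below P j -> i = j.
Proof.
move=> Pi Pj e; case: (ltngtP i j) => // ij.
  by have := count_below_mono P ij; rewrite count_belowS Pi e addn1 ltnn.
by have := count_below_mono P ij; rewrite count_belowS Pj e addn1 ltnn.
Qed.

End selection.

Lemma cvg_comb0 (R : realType) (c : R) (u v w : nat -> R) :
  u @ \oo --> 0 -> v @ \oo --> 0 -> (forall n, w n = u n - c * v n) -> w @ \oo --> 0.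
Proof.
move=> u0 v0 wE; rewrite (_ : w = fun n => u n - c * v n); last exact/funext.
rewrite -[0](subr0 0) -[X in _ --> _ - X](mulr0 c).
by apply: cvgB => //; apply: cvgM => //; exact: cvg_cst.
Qed.

Lemma separating_densities (R : realType) (A : nat -> graph_limit R)
    (G : graph_limit R) J : exists gs : seq (graph * R),
  (forall j, (j < J)%N -> A j <> G -> has (fun p => `[< A j p.1 = p.2 >]) gs) /\
  ~~ has (fun p => `[< G p.1 = p.2 >]) gs.
Proof.
elim: J => [|J [gs [sep ngs]]]; first by exists [::].
have [AG|AG] := pselect (A J = G).
  exists gs; split=> // j; rewrite ltnS leq_eqVlt => /predU1P[-> //|]; exact: sep.
have [F neF] : exists F, G F <> A J F.
  apply: contrapT => all; apply: AG; apply: graph_limit_eq => F.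
  by apply: contrapT => ne; apply: all; exists F => e; exact: ne.
exists ((F, A J F) :: gs); split=> [j|] /=.
  rewrite ltnS leq_eqVlt => /predU1P[-> _|jJ ne]; first by rewrite asboolT.
  by rewrite sep ?orbT.
by rewrite negb_or ngs andbT; apply/asboolP.
Qed.

(** The function h vanishes on the pairs other than (x, G) with weight above y;
    the remaining terms are at most C y^n times their weights, which sum to at
    most 1. *)
Lemma dominant_weight (R : realType) (K : Type) (w : nat -> R) (A : nat -> K)
    (h : R -> K -> R) (x y C : R) (G : K) (n N : nat) (P : pred nat) :
  (forall j, 0 <= w j) -> (forall n, \sum_(j < n) w j <= 1) ->
  0 <= C -> 0 <= y -> (forall x G, 0 <= x <= 1 -> `|h x G| <= C) ->
  (forall j, P j -> w j = x /\ A j = G) ->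
  (forall j, ~~ P j -> h (w j) (A j) = 0 \/ w j <= y) ->
  `|\sum_(j < N) h (w j) (A j) * w j ^+ n.+1 - h x G * x ^+ n.+1 * (count_below P N)%:R|
    <= C * y ^+ n.
Proof.
move=> w0 w1 C0 y0 hC PE PN.
have wle j : w j <= 1.
  by apply: le_trans (w1 j.+1); rewrite big_ord_recr/= lerDr sumr_ge0.
rewrite /count_below natr_sum mulr_sumr -sumrB (le_trans (ler_norm_sum _ _ _))//.
apply: (@le_trans _ _ (\sum_(j < N) C * y ^+ n * w j)); last first.
  by rewrite -mulr_sumr ler_piMr// mulr_ge0// exprn_ge0.
apply: ler_sum => j _; case: (boolP (P j)) => Pj /=.
  have [<- <-] := PE _ Pj; rewrite mulr1 subrr normr0.
  by rewrite !mulr_ge0// exprn_ge0.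
rewrite mulr0 subr0; case: (PN _ Pj) => [->|wy].
  by rewrite mul0r normr0 !mulr_ge0// exprn_ge0.
rewrite exprSr mulrA normrM (ger0_norm (w0 j)) ler_wpM2r// normrM ler_pM//.
  by apply: hC; rewrite w0 wle.
by rewrite ger0_norm ?exprn_ge0// lerXn2r ?nnegrE.
Qed.

Lemma geometric_lt (R : realType) (c C x y : R) : 0 < c -> 0 <= C -> 0 <= y < x ->
  exists n0, forall n, (n0 <= n)%N -> C * y ^+ n < c * x ^+ n.
Proof.
move=> c0 C0 /andP[y0 yx]; have x0 : 0 < x by exact: le_lt_trans yx.
have : C * (y / x) ^+ n @[n --> \oo] --> 0.
  rewrite -[0](mulr0 C); apply: cvgM; first exact: cvg_cst.
  apply: cvg_expr; rewrite ger0_norm ?divr_ge0 ?(ltW x0)//.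
  by rewrite ltr_pdivrMr// mul1r.
move=> /cvgrPdist_lt/(_ _ c0)[n0 _ H]; exists n0 => n /H.
rewrite sub0r normrN => /(le_lt_trans (ler_norm _)).
by rewrite expr_div_n mulrA ltr_pdivrMr// exprn_gt0.
Qed.

Section unique_decomposition.
Context (R : realType) (a b : nat -> R) (A B : nat -> graph_limit R).
Hypothesis a_ge0 : forall j, 0 <= a j.
Hypothesis b_ge0 : forall j, 0 <= b j.
Hypothesis a_sum : forall n, \sum_(j < n) a j <= 1.
Hypothesis b_sum : forall n, \sum_(j < n) b j <= 1.
Hypothesis AB : forall F : graph, (1 < #|F|)%N ->
  \sum_(j < n) (a j ^+ #|F| * A j F - b j ^+ #|F| * B j F) @[n --> \oo] --> 0.

Let term (h : R -> graph_limit R -> R) (F : graph) (n j : nat) : R :=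
  h (a j) (A j) * (a j ^+ n * A j F) - h (b j) (B j) * (b j ^+ n * B j F).

(** The exponent of the weights is separated from the number of vertices of F,
    which is possible by padding, for all large exponents. *)
Let balanced (h : R -> graph_limit R -> R) : Prop :=
  forall F : graph, exists n0, forall n, (n0 <= n)%N ->
    \sum_(j < N) term h F n j @[N --> \oo] --> 0.

Lemma balanced1 : balanced (fun _ _ => 1).
Proof.
move=> F; exists (maxn 2 #|F|) => n; rewrite geq_max => /andP[n2 nF].
have := @AB (pad F (n - #|F|)); rewrite card_pad subnKC// => /(_ n2).
under eq_fun do under eq_bigr do rewrite !graph_limit_pad.
by under [in X in _ -> X]eq_fun do under eq_bigr do rewrite /term !mul1r.
Qed.

(** Each term is multiplied by its weight when the exponent grows by 1. *)
Lemma balanced_weight h w : balanced h -> balanced (fun x G => (x - w) * h x G).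
Proof.
move=> bh F; have [n0 hn] := bh F; exists n0 => n nn.
apply: (@cvg_comb0 _ w (fun N => \sum_(j < N) term h F n.+1 j) (fun N => \sum_(j < N) term h F n j)) => [||N].
- by apply: hn; exact: leqW.
- exact: hn.
by rewrite mulr_sumr -sumrB; apply: eq_bigr => j _; rewrite /term !exprS; ring.
Qed.

(** Each term is multiplied by its density of F0 when F is replaced by a
    disjoint union with F0. *)
Lemma balanced_graph h F0 c : balanced h -> balanced (fun x G => (G F0 - c) * h x G).
Proof.
move=> bh F; have [n0 hn] := bh F; have [n1 hn1] := bh (disjoint_union F0 F).
exists (maxn n0 n1) => n; rewrite geq_max => /andP[nn0 nn1].
apply: (@cvg_comb0 _ c (fun N => \sum_(j < N) term h (disjoint_union F0 F) n j) (fun N => \sum_(j < N) term h F n j)) => [||N].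
- exact: hn1.
- exact: hn.
rewrite mulr_sumr -sumrB; apply: eq_bigr => j _.
by rewrite /term !graph_limit_disjoint; ring.
Qed.

(** The product of the x - w for w in ws and of the G(F) - c for (F, c) in gs.
    *)
Let poly (ws : seq R) (gs : seq (graph * R)) (x : R) (G : graph_limit R) : R :=
  foldr (fun w y => (x - w) * y) (foldr (fun p y => (G p.1 - p.2) * y) 1 gs) ws.

Lemma balanced_poly ws gs : balanced (poly ws gs).
Proof.
elim: ws => [|w ws IH]; last exact: balanced_weight.
elim: gs => [|[F c] gs IH]; first exact: balanced1.
exact: balanced_graph.
Qed.

Lemma poly_bounded ws gs : exists2 C, 0 <= C &
  forall x G, 0 <= x <= 1 -> `|poly ws gs x G| <= C.
Proof.
elim: ws => [|w ws [C C0 hC]].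
  elim: gs => [|[F c] gs [C C0 hC]]; first by exists 1 => // x G _; rewrite normr1.
  exists ((1 + `|c|) * C) => [|x G x01]; first by rewrite mulr_ge0// addr_ge0.
  rewrite /= normrM ler_pM//; last exact: hC x01.
  rewrite (le_trans (ler_normB _ _))// lerD2r.
  by rewrite ger0_norm ?graph_limit_ge0 ?graph_limit_le1.
exists ((1 + `|w|) * C) => [|x G x01]; first by rewrite mulr_ge0// addr_ge0.
rewrite /= normrM ler_pM//; last exact: hC x01.
rewrite (le_trans (ler_normB _ _))// lerD2r.
by case/andP: x01 => x0 x1; rewrite ger0_norm.
Qed.

Lemma poly_eq0 ws gs x (G : graph_limit R) : (x \in ws) || has (fun p => `[< G p.1 = p.2 >]) gs ->
  poly ws gs x G = 0.
Proof.
elim: ws => [|w ws IH] /=.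
  elim: gs => [|p gs IH] //= /orP[/asboolP ->|/IH ->]; first by rewrite subrr mul0r.
  by rewrite mulr0.
by rewrite inE -orbA => /orP[/eqP ->|/IH]; rewrite ?subrr ?mul0r// => ->; rewrite mulr0.
Qed.

Lemma poly_neq0 ws gs x (G : graph_limit R) : x \notin ws -> ~~ has (fun p => `[< G p.1 = p.2 >]) gs ->
  poly ws gs x G != 0.
Proof.
move=> + hg; elim: ws => [_|w ws IH] /=.
  elim: gs hg => [|p gs IH] /=; first by rewrite oner_eq0.
  by rewrite negb_or => /andP[/asboolP np /IH]; rewrite mulf_eq0 negb_or subr_eq0 => ->; rewrite andbT; apply/eqP.
by rewrite inE negb_or => /andP[xw /IH]; rewrite mulf_eq0 negb_or subr_eq0 => ->; rewrite andbT.
Qed.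

Let keyA x G : pred nat := fun j => `[< a j = x /\ A j = G >].
Let keyB x G : pred nat := fun j => `[< b j = x /\ B j = G >].

Lemma weights_small (w : nat -> R) (x : R) : (forall j, 0 <= w j) ->
  (forall n, \sum_(j < n) w j <= 1) -> 0 < x -> exists J, forall j, (J <= j)%N -> w j <= x.
Proof.
move=> w0 ws x0.
have : cvgn (series w).
  apply: nondecreasing_is_cvgn; first by apply: nondecreasing_series => n _ _.
  by exists 1 => _ [n _ <-]; rewrite /series /= big_mkord.
move=> /cvg_series_cvg_0/cvgrPdist_le/(_ _ x0)[J _ HJ].
by exists J => j /HJ; rewrite sub0r normrN; apply: le_trans; exact: ler_norm.
Qed.

(** A polynomial in the weight and in finitely many densities isolates the pair
    (x, G) among the pairs of weight at least x, and the smaller weights are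
    negligible in high powers. *)
Lemma multiplicity_eq x G : 0 < x -> exists J,
  [/\ forall j, (J <= j)%N -> ~~ keyA x G j, forall j, (J <= j)%N -> ~~ keyB x G j &
      count_below (keyA x G) J = count_below (keyB x G) J].
Proof.
move=> x0; have x2 : 0 < x / 2 by lra.
have [Ja hJa] := weights_small a_ge0 a_sum x2.
have [Jb hJb] := weights_small b_ge0 b_sum x2.
pose J := maxn Ja Jb.
have aJ j : (J <= j)%N -> a j <= x / 2.
  by move=> h; apply: hJa; apply: leq_trans h; exact: leq_maxl.
have bJ j : (J <= j)%N -> b j <= x / 2.
  by move=> h; apply: hJb; apply: leq_trans h; exact: leq_maxr.
have [gsA [sA nA]] := separating_densities A G J.
have [gsB [sB nB]] := separating_densities B G J.
pose all_weights := [seq a j | j <- iota 0 J] ++ [seq b j | j <- iota 0 J].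
(* the zeros of h: all larger weights, and a density separating each other limit
   from G *)
pose ws := [seq w <- all_weights | x < w].
pose gs := gsA ++ gsB.
(* the largest weight below x, or the bound x / 2 valid beyond J *)
pose y := \big[Num.max/(x / 2)]_(w <- all_weights | w < x) w.
have yx : 0 <= y < x.
  apply/andP; split; last by rewrite /y; elim/big_ind: _ => [|u v ux vx|//]; [lra|rewrite gt_max ux].
  by apply: le_trans (bigmax_ge_id _ _ _ _); exact: ltW.
have [y0 _] := andP yx.
have h0 : poly ws gs x G != 0.
  apply: poly_neq0; first by rewrite mem_filter ltxx.
  by rewrite has_cat negb_or nA.
have [C C0 hC] := poly_bounded ws gs.
have sideA j : ~~ keyA x G j -> poly ws gs (a j) (A j) = 0 \/ a j <= y.
  move=> /asboolP nk; case: (leqP J j) => jJ.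
    by right; apply: le_trans (aJ j jJ) _; exact: bigmax_ge_id.
  have aw : a j \in all_weights.
    by rewrite mem_cat map_f// mem_iota.
  case: (ltgtP (a j) x) => ajx.
  - by right; rewrite /y; apply: (@le_bigmax_seq _ _ _ _ _ (a j) (fun w => w < x) id).
  - by left; apply: poly_eq0; rewrite mem_filter ajx aw.
  - left; apply: poly_eq0; apply/orP; right; rewrite has_cat sA// => AG.
    exact: nk.
have sideB j : ~~ keyB x G j -> poly ws gs (b j) (B j) = 0 \/ b j <= y.
  move=> /asboolP nk; case: (leqP J j) => jJ.
    by right; apply: le_trans (bJ j jJ) _; exact: bigmax_ge_id.
  have aw : b j \in all_weights.
    by rewrite mem_cat orbC map_f// mem_iota.
  case: (ltgtP (b j) x) => ajx.
  - by right; rewrite /y; apply: (@le_bigmax_seq _ _ _ _ _ (b j) (fun w => w < x) id).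
  - by left; apply: poly_eq0; rewrite mem_filter ajx aw.
  - left; apply: poly_eq0; apply/orP; right; rewrite has_cat orbC sB// => BG.
    exact: nk.
have farA j : (J <= j)%N -> ~~ keyA x G j.
  by move=> jJ; apply/asboolP => -[ajx _]; have := aJ j jJ; lra.
have farB j : (J <= j)%N -> ~~ keyB x G j.
  by move=> jJ; apply/asboolP => -[ajx _]; have := bJ j jJ; lra.
exists J; split=> //.
have frozen (Q : pred nat) n : (forall j, (J <= j)%N -> ~~ Q j) -> (J <= n)%N ->
    count_below Q n = count_below Q J.
  move=> Qf /subnK <-; elim: (n - J)%N => // k IH.
  by rewrite addSn count_belowS IH (negbTE (Qf _ (leq_addl _ _))) addn0.
set p := count_below (keyA x G) J; set q := count_below (keyB x G) J.
have [n0 bal] := balanced_poly ws gs point_graph.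
have main n : (n0 <= n)%N -> `|poly ws gs x G * x ^+ n.+1 * (p%:R - q%:R)| <= 2 * C * y ^+ n.
  move=> nn0.
  have lim0 := bal n.+1 (leqW nn0).
  apply/ler_addgt0Pr => e e0; move/cvgrPdist_lt: lim0 => /(_ _ e0)[N0 _ HN].
  have := HN (maxn N0 J) (leq_maxl _ _); rewrite /= sub0r normrN.
  set M := maxn N0 J; have JM : (J <= M)%N by exact: leq_maxr.
  have := @dominant_weight _ _ a A (poly ws gs) x y C G n M (keyA x G) a_ge0 a_sum C0 y0 hC
    (fun j k => asboolW k) sideA.
  have := @dominant_weight _ _ b B (poly ws gs) x y C G n M (keyB x G) b_ge0 b_sum C0 y0 hC
    (fun j k => asboolW k) sideB.
  rewrite !frozen// -/p -/q => hB hA.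
  rewrite (eq_bigr (fun j : 'I_M => poly ws gs (a j) (A j) * a j ^+ n.+1 -
     poly ws gs (b j) (B j) * b j ^+ n.+1)) => [|j _]; last first.
    by rewrite /term !graph_limit_point !mulr1.
  rewrite sumrB; move: hA hB.
  set SA := (\sum_(j < M) poly ws gs (a j) (A j) * a j ^+ n.+1).
  set SB := (\sum_(j < M) poly ws gs (b j) (B j) * b j ^+ n.+1).
  set Z := poly ws gs x G * x ^+ n.+1.
  rewrite mulrBr -mulrA; move: (C * y ^+ n) (Z * p%:R) (Z * q%:R) => D Zp Zq.
  rewrite !ler_norml ltr_norml => /andP[h1 h2] /andP[h3 h4] /andP[h5 h6].
  by apply/andP; split; lra.
apply/eqP; apply/negPn/negP => pq.
have c0 : 0 < `|poly ws gs x G| * x by rewrite mulr_gt0// normr_gt0.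
have [n1 lt] := geometric_lt c0 (mulr_ge0 (ler0n R 2) C0) yx.
have := lt (maxn n0 n1) (leq_maxr _ _); have := main (maxn n0 n1) (leq_maxl _ _).
move: (maxn n0 n1) => n le; rewrite ltNge => /negP; apply; apply: le_trans le.
rewrite !normrM normrX (ger0_norm (ltW x0)) exprS -!mulrA ler_pM2l ?normr_gt0//.
rewrite ler_pM2l// ler_peMr ?exprn_ge0 ?(ltW x0)//.
clear main; wlog pq' : p q pq / (q < p)%N => [hw|].
  by case: (ltngtP p q) pq => // pq _; [rewrite distrC|]; apply: hw; rewrite ?gtn_eqF.
by rewrite ger0_norm -?natrB ?(ltnW pq')// ler1n subn_gt0.
Qed.

(** Equal multiplicities give a bijection that keeps the rank of an index among the
    indices with the same pair. *)
Lemma weighted_matching : exists sigma : nat -> nat,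
  set_bij [set j | 0 < a j] [set i | 0 < b i] sigma /\
  forall j, 0 < a j -> A j = B (sigma j) /\ a j = b (sigma j).
Proof.
have /choice[sigma sP] : forall j, exists i, 0 < a j -> keyB (a j) (A j) i /\
    count_below (keyB (a j) (A j)) i = count_below (keyA (a j) (A j)) j.
  move=> j.
  have [aj|aj] := boolP (0 < a j); last by exists 0%N.
  have [J [kA _ e]] := multiplicity_eq (A j) aj.
  have kj : keyA (a j) (A j) j by apply/asboolP.
  have jJ : (j < J)%N by rewrite ltnNge; apply/negP => /kA; rewrite kj.
  have : (count_below (keyA (a j) (A j)) j < count_below (keyB (a j) (A j)) J)%N.
    rewrite -e; apply: leq_trans (count_below_mono _ jJ).
    by rewrite count_belowS kj addn1.
  by move=> /select_exists[i [_ ki ci]]; exists i.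
exists sigma; split; last first.
  by move=> j aj; have [/asboolP[-> ->]] := sP j aj.
split=> [j /= aj|j j' /set_mem /= aj /set_mem /= aj' e|i /= bi].
- by have [/asboolP[-> _]] := sP j aj.
- have [/asboolP[b1 B1] c1] := sP j aj; have [/asboolP[b2 B2] c2] := sP j' aj'.
  have ea : a j = a j' by rewrite -b1 -b2 e.
  have eA : A j = A j' by rewrite -B1 -B2 e.
  apply: (@select_unique (keyA (a j) (A j))); [exact/asboolP|exact/asboolP|].
  by rewrite -c1 e ea eA c2.
have [J [_ kB e]] := multiplicity_eq (B i) bi.
have ki : keyB (b i) (B i) i by apply/asboolP.
have iJ : (i < J)%N by rewrite ltnNge; apply/negP => /kB; rewrite ki.
have : (count_below (keyB (b i) (B i)) i < count_below (keyA (b i) (B i)) J)%N.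
  rewrite e; apply: leq_trans (count_below_mono _ iJ).
  by rewrite count_belowS ki addn1.
move=> /select_exists[j [_ /asboolP[aj Aj] cj]]; exists j => /=; first by rewrite aj.
have aj0 : 0 < a j by rewrite aj.
have [] := sP j aj0; rewrite aj Aj => ks cs.
by apply: (select_unique ks ki); rewrite cs cj.
Qed.

End unique_decomposition.

(** * The random graph of a kernel *)

Section power_prob.
Context (R : realType) (d : measure_display) (S : measurableType d).
Variable mu : probability S R.

Definition box n (B : 'I_n -> set S) : set (n.-tuple S) :=
  [set x | forall i, B i (tnth x i)].

Definition boxes n : set (set (n.-tuple S)) :=
  [set A | exists2 B : 'I_n -> set S, (forall i, measurable (B i)) & A = box B].

Arguments boxes n : clear implicits.

Lemma measurable_box n (B : 'I_n -> set S) :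
  (forall i, measurable (B i)) -> measurable (box B).
Proof.
move=> mB; rewrite (_ : box B = \bigcap_(i in setT) ((@tnth n S ^~ i) @^-1` B i)).
  apply: fin_bigcap_measurable => // i _; rewrite -[X in measurable X]setTI.
  exact: measurable_tnth.
by apply/seteqP; split=> x h i => [_|]; exact: h.
Qed.

Lemma boxes_generate n : (@measurable _ (n.-tuple S)) = <<s boxes n >>.
Proof.
apply/seteqP; split; last first.
  apply: smallest_sub; first exact: sigma_algebra_measurable.
  by move=> _ [B mB ->]; exact: measurable_box.
apply: smallest_sub; first exact: smallest_sigma_algebra.
elim/big_ind: _ => // [C D CG DG|i _]; first by rewrite subUset.
move=> _ [B mB <-]; apply: sub_sigma_algebra.
exists (fun j => if j == i then B else setT) => [j|]; first by case: ifP.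
rewrite setTI; apply/seteqP; split=> x /= => [Bx j|/(_ i)]; last by rewrite eqxx.
by case: eqP => // ->.
Qed.

Lemma boxesI_closed n : setI_closed (boxes n).
Proof.
move=> _ _ [B mB ->] [C mC ->]; exists (fun i => B i `&` C i).
  by move=> i; exact: measurableI.
by apply/seteqP; split=> x /= => [[Bx Cx] i|h]; [split|split=> i; have [] := h i].
Qed.

Lemma power_prob_box n (B : 'I_n -> set S) : (forall i, measurable (B i)) ->
  power_prob mu n (box B) = (\prod_(i < n) mu (B i))%E.
Proof.
elim: n B => [|n IH] B mB.
  by rewrite big_ord0 /= diracE mem_set// => -[].
rewrite big_ord_recl /= -IH => [|i]; last exact: mB.
rewrite /distribution /pushforward /=.
rewrite -[RHS]product_measure1E; [|exact: mB|by apply: measurable_box => i; exact: mB].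
congr (_ _); apply/seteqP; split=> -[x t] /=; rewrite /box /=.
  move=> h; split; first exact: (h ord0).
  by move=> i; have := h (lift ord0 i); rewrite /tuple_cons tnthS.
move=> [h0 h] i; case: (unliftP ord0 i) => [j ->|->] //.
by rewrite /tuple_cons tnthS.
Qed.

Lemma power_prob_unique n (m : {measure set (n.-tuple S) -> \bar R}) :
  (forall B : 'I_n -> set S, (forall i, measurable (B i)) ->
    m (box B) = (\prod_(i < n) mu (B i))%E) ->
  forall A, measurable A -> m A = power_prob mu n A.
Proof.
move=> mE; have box0 : box (fun _ : 'I_n => setT) = setT.
  by apply/seteqP; split.
apply: (@measure_unique _ _ _ (boxes n) (fun=> setT)).
- exact: boxes_generate.
- exact: boxesI_closed.
- by move=> _; exists (fun=> setT).
- by rewrite bigcup_const//; exists 0%N.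
- by move=> _ [B mB ->]; rewrite mE// -power_prob_box.
- move=> _; rewrite -box0 mE// big1 ?ltry// => i _; exact: probability_setT.
Qed.

End power_prob.

Section iid_sequence.
Context (R : realType) (d : measure_display) (S : measurableType d)
  (d' : measure_display) (Omega : measurableType d') (P : probability Omega R)
  (mu : probability S R) (X : nat -> {RV P >-> S}).
Hypothesis iidX : iid mu X.
Context (n : nat) (e : 'I_n -> nat).
Hypothesis inj_e : injective e.

Definition sample_tuple (w : Omega) : n.-tuple S := [tuple X (e i) w | i < n].

Lemma measurable_sample_tuple : measurable_fun setT sample_tuple.
Proof.
apply/measurable_fun_tnthP => i.
rewrite (_ : _ \o _ = X (e i)) ?measurable_funPT//.
by apply/funext => w /=; rewrite tnth_mktuple.
Qed.

HB.instance Definition _ :=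
  isMeasurableFun.Build _ _ _ _ sample_tuple measurable_sample_tuple.

Lemma sample_tuple_law A : measurable A ->
  distribution P sample_tuple A = power_prob mu n A.
Proof.
apply: power_prob_unique => B mB.
pose B' k := if [pick i | e i == k] is Some i then B i else setT.
have B'e i : B' (e i) = B i.
  rewrite /B'; case: pickP => [j /eqP/inj_e -> //|/(_ i)]; by rewrite eqxx.
have [law prodE] := iidX.
have := prodE [seq e i | i <- enum 'I_n] B'.
rewrite map_inj_uniq ?enum_uniq// => /(_ isT).
rewrite big_map big_enum /= => prodB.
rewrite /distribution /pushforward /=.
transitivity (P [set w | forall i, i \in [seq e i | i <- enum 'I_n] -> B' i (X i w)]).
  congr (P _); apply/seteqP; split=> w /=; rewrite /box /=.
    by move=> h k /mapP[i _ ->]; rewrite B'e; have := h i; rewrite tnth_mktuple.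
  move=> h i; rewrite tnth_mktuple -B'e; apply: h.
  by apply: map_f; rewrite mem_enum.
rewrite prodB => [|k]; last by rewrite /B'; case: pickP.
by apply: eq_bigr => i _; rewrite B'e -(law (e i) (B i)).
Qed.

End iid_sequence.

Lemma ae_distribution (R : realType) (d d' : measure_display) (T : measurableType d)
    (U : measurableType d') (P : probability T R) (f : {RV P >-> U}) (Q : U -> Prop) :
  {ae distribution P f, forall y, Q y} -> {ae P, forall x, Q (f x)}.
Proof.
move=> [Z [mZ Z0 QZ]]; exists (f @^-1` Z); split => //.
  by rewrite -[X in measurable X]setTI; exact: measurable_funPT.
by move=> x /= Qx; exact: QZ.
Qed.

Section kernel_samples.
Context (R : realType) (Gamma : graph_limit R)
  (dS : measure_display) (S : measurableType dS) (mu : probability S R)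
  (W : S * S -> R) (hW : is_kernel W) (hGamma : represents mu W Gamma)
  (dO : measure_display) (Omega : measurableType dO) (P : probability Omega R)
  (G : Omega -> igraph) (hG : is_G_infty P mu W G).

Definition sampled_graph (w : Omega) : ngraph := ngraph_of (G w).

Let measurable_sampled_graph : measurable_fun setT sampled_graph.
Proof. by apply: measurable_to_ngraph => i j; case: hG => + _; apply. Qed.

Let oriented (F : graph) : seq (F * F) :=
  [seq p <- index_enum (F * F)%type | adj p.1 p.2 && (enum_rank p.1 < enum_rank p.2)%N].

Let hom_weight (F : graph) (x : #|F|.-tuple S) : R :=
  \prod_(p <- oriented F) W (tnth x (enum_rank p.1), tnth x (enum_rank p.2)).

Lemma measurable_hom_weight F : measurable_fun setT (@hom_weight F).
Proof.
case: hW => mW _ _; apply: measurable_prod => p _.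
apply: (measurableT_comp mW).
by apply/measurable_fun_pairP; split; exact: measurable_tnth.
Qed.

(** Integrated over the whole space, the conditional probability of a set of
    edges is the probability of these edges. There an edge is oriented by the
    order of the natural numbers and in the integral for F by the ranks of the
    vertices of F; the symmetry of W reconciles the two. *)
Lemma kernel_copy_prob (F : graph) (f : F -> nat) : injective f ->
  P [set w | forall x y : F, adj x y -> iadj (G w) (f x) (f y)] = (Gamma F)%:E.
Proof.
move=> inj_f; have [mW symW W01] := hW; have [mG [X [iidX condX]]] := hG.
pose e (i : 'I_#|F|) := f (enum_val i).
have inj_e : injective e by move=> i j /inj_f/enum_val_inj.
pose edge (p : F * F) := (minn (f p.1) (f p.2), maxn (f p.1) (f p.2)).
have adjE (g : igraph) p : iadj g (edge p).1 (edge p).2 = iadj g (f p.1) (f p.2).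
  by rewrite /edge /minn /maxn /=; case: ifP => // _; exact: iadj_sym.
have [] := condX [seq edge p | p <- oriented F].
- rewrite map_inj_in_uniq ?filter_uniq ?index_enum_uniq// => -[x y] [x' y'].
  rewrite !mem_filter /= => /andP[/andP[_ xy] _] /andP[/andP[_ xy'] _] [] e1 e2.
  have [[/inj_f -> /inj_f ->] //|[/inj_f ex /inj_f ey]] :
    (f x = f x' /\ f y = f y') \/ (f x = f y' /\ f y = f x') by lia.
  by move: xy xy'; rewrite ex ey ltnNge => /negP + /ltnW.
- apply/allP => _ /mapP[[x y] + ->]; rewrite mem_filter /= => /andP[/andP[xy _] _].
  rewrite /edge /minn /maxn /=; case: (ltngtP (f x) (f y)) => //= /inj_f fxy.
  by move: xy; rewrite fxy adj_irr.
move=> _ /(_ setT) condP.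
have {condP} : P (setT `&` [set w | all (fun p => iadj (G w) p.1 p.2)
      [seq edge p | p <- oriented F]]) =
    (\int[P]_w (hom_weight (sample_tuple X e w))%:E)%E.
  rewrite condP; last first.
    have : sigma_of X (setT `\` set0) by apply: sigma_algebraCD; exact: sigma_algebra0.
    by rewrite setD0.
  apply: eq_integral => w _; congr EFin; rewrite big_map; apply: eq_bigr => p _.
  rewrite !tnth_mktuple /e !enum_rankK /edge /minn /maxn /=.
  by case: ifP => // _; exact: symW.
rewrite setTI => condP; transitivity (P [set w | all (fun p => iadj (G w) p.1 p.2)
      [seq edge p | p <- oriented F]]).
  congr (P _); apply/seteqP; split=> w /= h.
    apply/allP => _ /mapP[p + ->]; rewrite mem_filter => /andP[/andP[xy _] _].
    by rewrite adjE; exact: h.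
  move=> x y xy; move/allP: h => h.
  wlog lt : x y xy / (enum_rank x < enum_rank y)%N => [hw|].
    have [lt|lt|e'] := ltngtP (enum_rank x) (enum_rank y).
    - exact: hw.
    - by rewrite iadj_sym; apply: hw => //; rewrite adj_sym.
    - by move: xy; rewrite (enum_rank_inj (val_inj e')) adj_irr.
  rewrite -(adjE _ (x, y)); apply: h; apply: map_f.
  by rewrite mem_filter /= xy lt mem_index_enum.
rewrite condP hGamma.
have mh := @measurable_hom_weight F.
transitivity (\int[distribution P (sample_tuple X e)]_x (hom_weight x)%:E)%E.
  rewrite ge0_integral_pushforward//.
    exact/measurable_EFinP.
  by move=> x _; rewrite lee_fin prodr_ge0// => p _; case/andP: (W01 (tnth x (enum_rank p.1), tnth x (enum_rank p.2))).
rewrite (eq_measure_integral (power_prob mu #|F|)) => [|A mA _]; last first.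
  exact: sample_tuple_law.
by apply: eq_integral => x _; rewrite /hom_weight big_filter.
Qed.

Lemma kernel_samples : exists L : probability ngraph R, samples L Gamma /\
  forall Q : ngraph -> Prop, {ae L, forall g, Q g} -> {ae P, forall w, Q (ngraph_of (G w))}.
Proof.
pose f : {RV P >-> ngraph} :=
  HB.pack sampled_graph (isMeasurableFun.Build _ _ _ _ sampled_graph measurable_sampled_graph).
exists (distribution P f); split; last by move=> Q; exact: (@ae_distribution _ _ _ _ _ P f).
by move=> F h inj_h; rewrite -(kernel_copy_prob inj_h).
Qed.

End kernel_samples.

(** * Components and summands *)

Lemma series_nneseries (R : realType) (u : nat -> R) (x : R) :
  series u @ \oo --> x -> (\sum_(0 <= i <oo) (u i)%:E = x%:E)%E.
Proof.
move=> ux; apply/cvg_lim => //.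
rewrite (_ : (fun n => _) = EFin \o series u); first exact: cvg_EFin (nearW _ _) ux.
by apply/funext => n; rewrite /= sumEFin.
Qed.

Lemma nneseries_series (R : realType) (u : nat -> R) (x : R) :
  (forall i, 0 <= u i) -> (\sum_(0 <= i <oo) (u i)%:E = x%:E)%E ->
  series u @ \oo --> x.
Proof.
move=> u0 ux; suff : (EFin \o series u) @ \oo --> x%:E by move/fine_cvgP => [].
rewrite -ux (_ : EFin \o series u = fun n => (\sum_(0 <= i < n) (u i)%:E)%E).
  by apply: is_cvg_nneseries => n _ _; rewrite lee_fin.
by apply/funext => n; rewrite /= sumEFin.
Qed.

Lemma esum_below (R : realType) M (u : nat -> R) : (forall i, below M i -> 0 <= u i) ->
  (\esum_(i in [set i | below M i]) (u i)%:E =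
   \sum_(0 <= i <oo) (if below M i then u i else 0)%:E)%E.
Proof.
move=> u0; rewrite -(@nneseries_esum _ _ (below M)) => [|i bi]; last by rewrite lee_fin u0.
rewrite eseries_mkcond; congr (limn _); apply/funext => n.
by apply: eq_bigr => i _; case: ifP.
Qed.

Lemma below_series_cvg (R : realType) M (u : nat -> R) (x : R) :
  (forall i, below M i -> 0 <= u i) ->
  (\esum_(i in [set i | below M i]) (u i)%:E = x%:E)%E ->
  series (fun i => if below M i then u i else 0) @ \oo --> x.
Proof.
move=> u0; rewrite esum_below//; apply: nneseries_series => i.
by case: ifP => // /u0.
Qed.

Section typical_decomposition.
Context (R : realType) (L : probability ngraph R) (Gamma : graph_limit R).
Hypothesis LG : samples L Gamma.
Context (g : ngraph) (N : option nat) (V : nat -> set nat).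
Hypothesis typ : typical L g.
Hypothesis hV : lists_components g N V.

Local Notation weight := (weight R N V).

Lemma listed_limits : exists Gs : nat -> graph_limit R, forall j, 0 < weight j ->
  graph_cvg (induced_sgraph g (V j)) (Gs j) /\
  forall F : graph, avgs (nseq #|F| n) (\1_(inside g (V j) (edge_code F))) @[n --> \oo]
    --> weight j ^+ #|F| * Gs j F.
Proof.
have /choice[Gs GsP] : forall j, exists Gam' : graph_limit R, 0 < weight j ->
  graph_cvg (induced_sgraph g (V j)) Gam' /\
  forall F : graph, avgs (nseq #|F| n) (\1_(inside g (V j) (edge_code F))) @[n --> \oo]
    --> weight j ^+ #|F| * Gam' F; last by exists Gs.
move=> j; have [w0|_] := boolP (0 < weight j); last by exists Gamma.
have bj := weight_below w0; have [x ex] := listed_root hV bj.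
move: w0; rewrite /weight bj ex -side_true => w0.
by have [Gam' h] := side_limit typ w0; exists Gam'.
Qed.

Lemma noniso_prob_le1 : noniso_prob L <= 1.
Proof.
rewrite -lee_fin /noniso_prob fineK ?fin_num_measure//; last exact: measurable_noniso.
by apply: probability_le1; exact: measurable_noniso.
Qed.

Lemma listed_component j : below N j ->
  [/\ infinite_set (V j) \/ singleton_set (V j), has_density (V j) (weight j) &
      infinite_set (V j) <-> 0 < weight j].
Proof.
move=> bj; have [x ex] := listed_root hV bj.
have infw : infinite_set (V j) <-> 0 < weight j.
  by rewrite /weight bj ex; exact: conn_infinite typ x.
split=> //; last first.
  rewrite /has_density; under eq_fun do rewrite densityE.
  exact: (@weight_cvg _ _ _ typ _ _ hV _ bj).
have [nx|/isolated_conn e] := pselect (nonisolated g x).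
  by left; rewrite ex; apply/(conn_infinite typ)/(nonisolated_density typ).
by right; exists x; rewrite ex.
Qed.

Lemma isolated_union :
  \bigcup_(j in [set j | below N j /\ singleton_set (V j)]) V j = ~` nonisolated_set g.
Proof.
have [_ hV2 _] := hV; apply/seteqP; split=> x /=.
  move=> [j [bj [y ey]]] Vx /(weight_nonisolated typ hV bj Vx).
  have [_ _ <-] := listed_component bj.
  by rewrite ey => inf; apply: inf; exact: finite_set1.
move=> /isolated_conn e; have [|j bj ej] := hV2 (conn g x); first by exists x.
exists j; last by rewrite ej e.
by split=> //; exists x; rewrite ej.
Qed.

Section decomposition.
Context (M : option nat) (alpha : nat -> R) (Gammas : nat -> graph_limit R).
Hypothesis dec : is_decomposition Gamma M alpha Gammas.
Context (Gs : nat -> graph_limit R).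
Hypothesis GsP : forall j, 0 < weight j -> forall F : graph,
  avgs (nseq #|F| n) (\1_(inside g (V j) (edge_code F))) @[n --> \oo]
    --> weight j ^+ #|F| * Gs j F.

(** Extended by 0 off the list, for the comparison with a sequence of weights on
    nat. *)
Let beta i := if below M i then alpha i else 0.

Let beta_ge0 i : 0 <= beta i.
Proof. by rewrite /beta; case: ifP => // bi; case: dec => _ h _; exact/ltW/h. Qed.

Let alpha_ge0 i : below M i -> 0 <= alpha i.
Proof. by move=> bi; case: dec => _ h _; exact/ltW/h. Qed.

Let beta_le1 n : \sum_(i < n) beta i <= 1.
Proof.
case: dec => _ _ [_ s1 _]; rewrite -lee_fin; apply: le_trans s1.
rewrite /weight_sum esum_below// -sumEFin -(big_mkord predT (fun i => (beta i)%:E)).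
by apply: nneseries_lim_ge => i _ _; rewrite lee_fin.
Qed.

(** The listed components and the summands of the decomposition both compute
    [join_prob] for every graph with at least two vertices. *)
Lemma component_matching : exists sigma : nat -> nat,
  set_bij [set j | 0 < weight j] [set i | below M i] sigma /\
  forall j, 0 < weight j -> Gs j = Gammas (sigma j) /\ weight j = alpha (sigma j).
Proof.
have [|||||sigma [bij eqs]] := @weighted_matching R weight beta Gs Gammas.
- by move=> j; rewrite (weight_ge0 typ hV).
- exact: beta_ge0.
- move=> n; apply: le_trans noniso_prob_le1; apply: le_trans (series_weight_le typ hV n).
  by rewrite /series /= big_mkord.
- exact: beta_le1.
- move=> F F1; pose q := join_prob L (edge_code F) #|F|.
  have c1 := @series_heavy_cvg _ _ _ typ _ _ hV _ GsP F F1.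
  have c2 : series (fun i => if below M i then alpha i ^+ #|F| * Gammas i F else 0) @ \oo --> q.
    apply: below_series_cvg; last by rewrite -(join_prob_direct_sum LG dec F1).
    by move=> i bi; rewrite mulr_ge0 ?graph_limit_ge0 ?exprn_ge0 ?alpha_ge0.
  rewrite -[X in _ --> X](subrr q) (_ : (fun n => _) =
    series (fun j => weight j ^+ #|F| * Gs j F) \-
    series (fun i => if below M i then alpha i ^+ #|F| * Gammas i F else 0)).
    by apply: cvgB; [exact: c1|exact: c2].
  apply/funext => n; rewrite /series /= !big_mkord -sumrB; apply: eq_bigr => i _.
  rewrite /beta; case: ifP => //.
  by rewrite expr0n gtn_eqF ?(ltnW F1)//= mul0r.
have positive : [set i | 0 < beta i] = [set i | below M i].
  apply/seteqP; split=> i /=; rewrite /beta; case: ifP => //; first by rewrite ltxx.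
  by case: dec => _ h _ /h.
exists sigma; rewrite -positive; split=> // j w0; have [-> ->] := eqs j w0.
split=> //; rewrite /beta ifT//.
by have [fn _ _] := bij; have := fn j w0; rewrite positive.
Qed.

Lemma weight_sum_noniso : weight_sum M alpha = (noniso_prob L)%:E.
Proof.
have [sigma [bij eqs]] := component_matching.
rewrite /weight_sum (reindex_esum _ _ _ _ bij) -(series_nneseries (@series_weight_cvg _ _ _ typ _ _ hV)).
rewrite nneseries_esumT => [|j]; last by rewrite lee_fin (weight_ge0 typ hV).
rewrite [LHS]esum_mkcond; apply: eq_esum => j _.
case: ifPn => [|jn]; first by rewrite inE /= => /eqs[_ ->].
congr EFin; apply/esym/eqP; rewrite eq_le (weight_ge0 typ hV) andbT leNgt.
by apply: contra jn => w0; rewrite inE.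
Qed.

Lemma isolated_density :
  let alpha0 := 1 - fine (weight_sum M alpha) in
  let V0 := \bigcup_(j in [set j | below N j /\ singleton_set (V j)]) V j in
  [/\ has_density V0 alpha0, V0 = set0 <-> alpha0 = 0 &
      alpha0 = 0 <-> weight_sum M alpha = 1%E].
Proof.
rewrite /= weight_sum_noniso /= isolated_union.
have dV0 : has_density (~` nonisolated_set g) (1 - noniso_prob L).
  rewrite /has_density; under eq_fun do rewrite densityE.
  have : 1 - density R (nonisolated_set g) n @[n --> \oo] --> 1 - noniso_prob L.
    by apply: cvgB; [exact: cvg_cst|exact: nonisolated_density_cvg typ].
  apply: cvg_trans; apply: near_eq_cvg; exists 1%N => // n /= n0.
  by rewrite densityC.
split=> //; split.
- move=> e; move: dV0; rewrite e /has_density; under eq_fun do rewrite densityE.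
  by move=> /(cvg_unique (@norm_hausdorff _ R^o)); apply; apply: density_finite; exact: finite_set0.
- move=> /eqP; rewrite subr_eq0 eq_sym => /eqP p1.
  by apply/seteqP; split=> // x /=; apply; exact: (typical_complete typ p1 x).
- by move=> /eqP; rewrite subr_eq0 => /eqP <-.
- by move=> [->]; rewrite subrr.
Qed.

End decomposition.
End typical_decomposition.

Theorem theorem1p22 (R : realType) (Gamma : graph_limit R)
  (dS : measure_display) (S : measurableType dS) (mu : probability S R)
  (W : S * S -> R) (hW : is_kernel W) (hGamma : represents mu W Gamma)
  (dO : measure_display) (Omega : measurableType dO) (P : probability Omega R)
  (G : Omega -> igraph) (hG : is_G_infty P mu W G)
  (N : Omega -> option nat) (V : Omega -> nat -> set nat)
  (hV : forall w, lists_components (G w) (N w) (V w)) :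
  {ae P, forall w,
    exists (Gamma' : nat -> graph_limit R) (nu : nat -> R),
      (forall j, below (N w) j ->
        [/\ infinite_set (V w j) \/ singleton_set (V w j),
            infinite_set (V w j) ->
              graph_cvg (fun n => induced_sgraph (G w) (V w j) n) (Gamma' j),
            has_density (V w j) (nu j) &
            infinite_set (V w j) <-> 0 < nu j]) /\
      (forall (M : option nat) (alpha : nat -> R)
          (Gammas : nat -> graph_limit R),
        is_decomposition Gamma M alpha Gammas ->
        let alpha0 := 1 - fine (weight_sum M alpha) in
        let V0 := \bigcup_(j in [set j | below (N w) j /\
                                         singleton_set (V w j)]) V w j in
        (exists sigma : nat -> nat,
          set_bij [set j | below (N w) j /\ 0 < nu j] [set i | below M i] sigma /\
          forall j, below (N w) j -> 0 < nu j ->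
            Gamma' j = Gammas (sigma j) /\ nu j = alpha (sigma j)) /\
        [/\ has_density V0 alpha0,
            V0 = set0 <-> alpha0 = 0 &
            alpha0 = 0 <-> weight_sum M alpha = 1%E])}.
Proof.
have [L [LG aeL]] := kernel_samples hW hGamma hG.
apply: filterS (aeL _ (ae_typical LG)) => w typ.
have lV := hV w; rewrite -(ngraph_ofK (G w)) in lV *.
have [Gs GsP] := listed_limits Gamma typ lV.
exists Gs, (weight R (N w) (V w)); split=> [j bj|M alpha Gammas dec].
  have [h1 h2 h3] := listed_component typ lV bj; split=> // inf.
  by have [] := GsP j (h3.1 inf).
have GsP2 j : 0 < weight R (N w) (V w) j -> forall F : graph,
    avgs (nseq #|F| n) (\1_(inside (ngraph_of (G w)) (V w j) (edge_code F))) @[n --> \oo]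
      --> weight R (N w) (V w) j ^+ #|F| * Gs j F by case/GsP.
split; last exact: (isolated_density LG typ lV dec GsP2).
have [sigma [bij eqs]] := component_matching LG typ lV dec GsP2.
exists sigma; split=> [|j _]; last exact: eqs.
rewrite (_ : [set j | _ /\ _] = [set j | 0 < weight R (N w) (V w) j])//.
apply/seteqP; split=> j /= => [[]//|w0]; split=> //; exact: weight_below w0.
Qed.
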